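(* Let $g:\mathbb{R}^l\times\mathbb{R}^n\times\mathbb{R}^n\to\mathbb{R}^s$ be twice continuously differentiable, $D\subset\mathbb{R}^s$ convex polyhedral, $\Gamma(p,x):=\{z\in\mathbb{R}^n\mid g(p,x,z)\in D\}$, $G(p,x):=\widehat N_{\Gamma(p,x)}(x)$, $\Psi(p,x,z):=\widehat N_{\Gamma(p,x)}(z)$. Let $f:\mathbb{R}^l\times\mathbb{R}^n\to\mathbb{R}^n$ be continuously differentiable, let $(\bar p,\bar x)$ satisfy $0\in f(\bar p,\bar x)+G(\bar p,\bar x)$, and assume that there is $\kappa>0$ such that $\mathrm{dist}(z,\Gamma(p,x))\le\kappa\,\mathrm{dist}(g(p,x,z),D)$ for all $(p,x,z)$ in a neighborhood of $(\bar p,\bar x,\bar x)$. Then for all $(p,x)\in\mathrm{dom}\,G$ sufficiently close to $(\bar p,\bar x)$, all $x^*\in G(p,x)$ and all $(q,u)\in\mathbb{R}^l\times\mathbb{R}^n$ we have $$DG((p,x),x^* )(q,u)\subset D\Psi((p,x,x),x^* )(q,u,u)$$ $$=\Big\{\nabla(b(\cdot)^T\lambda)(p,x)(q,u)+b(p,x)^TN_{\mathcal{K}_D(\tilde g(p,x),\lambda)}\big(\nabla\tilde g(p,x)(q,u)\big)\ \Big|\ \lambda\in\tilde\Lambda\big((p,x),x^*;(q,u)\big)\Big\},$$ where the last set denotes the union of the indicated sets over all such $\lambda$. On the other hand, given (for such $(p,x)$ and $x^*$) $(q,u)\in\mathbb{R}^l\times\mathbb{R}^n$, $\lambda\in\tilde\Lambda((p,x),x^*;(q,u))$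 and $\eta\in N_{\mathcal{K}_D(\tilde g(p,x),\lambda)}(\nabla\tilde g(p,x)(q,u))$, assume that the mapping $F:\mathbb{R}^l\times\mathbb{R}^n\times\mathbb{R}^s\rightrightarrows\mathbb{R}^s\times\mathbb{R}^s$, $$F(p',x',\mu):=(\tilde g(p',x'),\mu)-\mathrm{gph}\,N_D,$$ is metrically subregular in direction $(q,u,\eta)$ at $((p,x,\lambda),(0,0))$. Then $$\nabla(b(\cdot)^T\lambda)(p,x)(q,u)+b(p,x)^T\eta\in DG((p,x),x^* )(q,u)$$ and the tangent $\big(q,u,\nabla(b(\cdot)^T\lambda)(p,x)(q,u)+b(p,x)^T\eta\big)$ to $\mathrm{gph}\,G$ at $((p,x),x^* )$ is derivable.
   Context: Cones. $T_\Omega(\bar z):=\{u\mid\exists u_k\to u,\ t_k\downarrow0:\ \bar z+t_ku_k\in\Omega\ \forall k\}$ for $\bar z\in\Omega$ (tangent cone). A tangent $u\in T_\Omega(\bar z)$ is derivable if $\mathrm{dist}(\bar z+tu,\Omega)=o(t)$ as $t\downarrow0$. $\widehat N_\Omega(\bar z):=T_\Omega(\bar z)^\circ$ (negative polar) is the regular normal cone, written $N_\Omega(\bar z)$ for convex $\Omega$. All these cones are $\emptyset$ if $\bar z\notin\Omega$. $[a]^\perp$ is the orthogonal complement of the span of $a$. Critical cone: $\mathcal{K}_D(z,z^* ):=T_D(z)\cap[z^*]^\perp$ for $z^*\in N_D(z)$. $\mathrm{dist}(x,\emptyset)=\infty$. Graphical derivative: $DF(\bar x,\bar y)(u):=\{v\mid(u,v)\in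 T_{\mathrm{gph}\,F}(\bar x,\bar y)\}$. Directional metric subregularity. Let $\mathcal{V}_{\rho,\delta}(u):=\{d\mid\|d\|\le\rho,\ \big\|\|u\|d-\|d\|u\big\|\le\delta\|u\|\|d\|\}$; a directional neighborhood of $u$ is a set containing some $\mathcal{V}_{\rho,\delta}(u)$, $\rho,\delta>0$. $F$ is metrically subregular in direction $u$ at $(\bar x,\bar y)\in\mathrm{gph}\,F$ if there are a directional neighborhood $\mathcal{U}$ of $u$ and $\kappa\ge0$ with $\mathrm{dist}(x,F^{-1}(\bar y))\le\kappa\,\mathrm{dist}(\bar y,F(x))$ for all $x\in\bar x+\mathcal{U}$. Notation. $\nabla$ is the Jacobian, $\nabla_i$ the partial Jacobian in the $i$-th argument. $\tilde g(p,x):=g(p,x,x)$, $b(p,x):=\nabla_3g(p,x,x)$. $\mathrm{dom}\,G=\{(p,x)\mid G(p,x)\ne\emptyset\}$. For $y=(p,x,z)$ and $v=(q,u,w)$: $\Lambda(y,y^* ):=\{\lambda\in N_D(g(y))\mid\nabla g(y)^T\lambda=y^*\}$ and $\Lambda(y,y^*;v):=\arg\max\{v^T\nabla^2(\lambda^Tg)(y)v\mid\lambda\in\Lambda(y,y^* )\}$. $\Xi((p,x),x^*;(q,u)):=\{\mu\in N_D(\tilde g(p,x))\mid b(p,x)^T\mu=x^*,\ \nabla\tilde g(p,x)(q,u)\in\mathcal{K}_D(\tilde g(p,x),\mu)\}$. $\tilde\Lambda((p,x),x^*;(q,u))$ is the union of the sets $\Lambda((p,x,x),\nabla g(p,x,x)^T\mu;(q,u,u))$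 over all $\mu\in\Xi((p,x),x^*;(q,u))$. ''For all $(p,x)$ sufficiently close to $(\bar p,\bar x)$'' means: for all $(p,x)$ in some neighborhood of $(\bar p,\bar x)$. *)

(* Defs.v *)
From mathcomp Require Import all_boot all_order all_algebra.
From mathcomp Require Import all_classical all_reals all_analysis.
Import Order.TTheory GRing.Theory Num.Theory.
Import numFieldNormedType.Exports.

Set Implicit Arguments.
Unset Strict Implicit.
Unset Printing Implicit Defensive.

Local Open Scope classical_set_scope.
Local Open Scope ring_scope.

(** Vectors of R^n are row vectors and products of Euclidean spaces are spaces
    of concatenated rows: (p, x) is [row_mx p x]. The library's [jacobian]
    acts on rows from the right, hence is the transpose of the usual Jacobian
    matrix: the directional derivative of [f] at [x] along [v] is
    [v *m jacobian f x], and the adjoint applied to [lam] is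
    [lam *m (jacobian f x)^T]. *)

Section Euclidean.
Variable R : realType.

Definition dot n (u v : 'rV[R]_n) : R := (u *m v^T) 0 0.

(** The norm [`|x|] of the library is the maximum norm on matrices. *)
Definition eucl_norm n (u : 'rV[R]_n) : R := Num.sqrt (dot u u).

(** [setdist x set0 = +oo] *)
Definition setdist n (x : 'rV[R]_n) (S : set 'rV[R]_n) : \bar R :=
  ereal_inf [set (eucl_norm (x - y))%:E | y in S].

Definition convex_polyhedral n (D : set 'rV[R]_n) : Prop :=
  exists (m : nat) (A : 'M[R]_(n, m)) (c : 'rV[R]_m),
    D = [set x | forall j, (x *m A) 0 j <= c 0 j].

End Euclidean.

Section Smoothness.
Variable R : realType.

(** In finite dimension, pointwise continuity of [x |-> 'd f x] is the same as
    continuity in the operator norm. *)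
Definition C1 (U V : normedModType R) (f : U -> V) : Prop :=
  (forall x, differentiable f x) /\
  (forall v, continuous (fun x => 'd f x v)).

Definition C2 m n (f : 'rV[R]_m -> 'rV[R]_n) : Prop :=
  C1 f /\ C1 (jacobian f).

Definition hessian m (phi : 'rV[R]_m -> R) (y : 'rV[R]_m) : 'M[R]_m :=
  \matrix_(i, j)
    derive (fun z => derive phi z (delta_mx 0 j)) y (delta_mx 0 i).

End Smoothness.

Section VariationalAnalysis.
Variable R : realType.

Definition tangent_cone n (Omega : set 'rV[R]_n) (z : 'rV[R]_n) :
    set 'rV[R]_n :=
  [set u | Omega z /\
     exists (uk : nat -> 'rV[R]_n) (tk : nat -> R),
       [/\ uk @ \oo --> u, forall k, 0 < tk k, tk @ \oo --> (0 : R) &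
           forall k, Omega (z + tk k *: uk k)]].

Definition derivable_tangent n (Omega : set 'rV[R]_n) (z u : 'rV[R]_n) : Prop :=
  tangent_cone Omega z u /\
  forall eps : R, 0 < eps ->
    \forall t \near (0 : R)^'+, (setdist (z + t *: u) Omega <= (eps * t)%:E)%E.

(** The condition [Omega z] makes the cone empty outside [Omega]; the polar of
    the empty set alone would be the whole space. *)
Definition normal_cone n (Omega : set 'rV[R]_n) (z : 'rV[R]_n) : set 'rV[R]_n :=
  [set v | Omega z /\ forall u, tangent_cone Omega z u -> dot v u <= 0].

(** Only meaningful for [zs] in [normal_cone D z]. *)
Definition critical_cone n (D : set 'rV[R]_n) (z zs : 'rV[R]_n) :
  set 'rV[R]_n := tangent_cone D z `&` [set u | dot zs u = 0].

Definition gph m n (F : 'rV[R]_m -> set 'rV[R]_n) : set 'rV[R]_(m + n) :=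
  [set row_mx w.1 w.2 | w in [set w : 'rV[R]_m * 'rV[R]_n | F w.1 w.2]].

Definition graphical_derivative m n (F : 'rV[R]_m -> set 'rV[R]_n)
    (x : 'rV[R]_m) (y : 'rV[R]_n) (u : 'rV[R]_m) : set 'rV[R]_n :=
  [set v | tangent_cone (gph F) (row_mx x y) (row_mx u v)].

Definition dir_ball n (rho delta : R) (u : 'rV[R]_n) : set 'rV[R]_n :=
  [set d | eucl_norm d <= rho /\
     eucl_norm (eucl_norm u *: d - eucl_norm d *: u) <=
       delta * eucl_norm u * eucl_norm d].

Definition dir_nbhd n (u : 'rV[R]_n) (U : set 'rV[R]_n) : Prop :=
  exists rho delta : R, [/\ 0 < rho, 0 < delta & dir_ball rho delta u `<=` U].

Definition dir_subregular m n (F : 'rV[R]_m -> set 'rV[R]_n)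
    (u xb : 'rV[R]_m) (yb : 'rV[R]_n) : Prop :=
  F xb yb /\
  exists (U : set 'rV[R]_m) (kappa : R), [/\ dir_nbhd u U, 0 <= kappa &
    forall d, U d ->
      (setdist (xb + d)%R [set x | F x yb] <=
       kappa%:E * setdist yb (F (xb + d)%R))%E].

End VariationalAnalysis.

Section ConstraintSystem.
Variables (R : realType) (l n s : nat).
Variables (g : 'rV[R]_(l + n + n) -> 'rV[R]_s) (D : set 'rV[R]_s).

(** (p, x) |-> (p, x, x) *)
Definition diag_xx (px : 'rV[R]_(l + n)) : 'rV[R]_(l + n + n) :=
  row_mx px (rsubmx px).

Definition gtilde (px : 'rV[R]_(l + n)) : 'rV[R]_s := g (diag_xx px).

(** Transpose of the partial Jacobian of [g] in its third argument. *)
Definition bT (px : 'rV[R]_(l + n)) : 'M[R]_(n, s) :=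
  jacobian (fun z : 'rV[R]_n => g (row_mx px z)) (rsubmx px).

Definition Gamma (px : 'rV[R]_(l + n)) : set 'rV[R]_n :=
  [set z | D (g (row_mx px z))].

Definition Gmap (px : 'rV[R]_(l + n)) : set 'rV[R]_n :=
  normal_cone (Gamma px) (rsubmx px).

Definition Psi (pxz : 'rV[R]_(l + n + n)) : set 'rV[R]_n :=
  normal_cone (Gamma (lsubmx pxz)) (rsubmx pxz).

Definition Lambda (y ys : 'rV[R]_(l + n + n)) : set 'rV[R]_s :=
  [set lam | normal_cone D (g y) lam /\ lam *m (jacobian g y)^T = ys].

Definition curvature (lam : 'rV[R]_s) (y v : 'rV[R]_(l + n + n)) : R :=
  dot (v *m hessian (fun z => dot lam (g z)) y) v.

Definition Lambda_dir (y ys v : 'rV[R]_(l + n + n)) : set 'rV[R]_s :=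
  [set lam | Lambda y ys lam /\
     forall lam', Lambda y ys lam' -> curvature lam' y v <= curvature lam y v].

Definition Xi (px : 'rV[R]_(l + n)) (xs : 'rV[R]_n) (qu : 'rV[R]_(l + n)) :
    set 'rV[R]_s :=
  [set mu | [/\ normal_cone D (gtilde px) mu, mu *m (bT px)^T = xs &
     critical_cone D (gtilde px) mu (qu *m jacobian gtilde px)]].

Definition Lambda_tilde (px : 'rV[R]_(l + n)) (xs : 'rV[R]_n)
    (qu : 'rV[R]_(l + n)) : set 'rV[R]_s :=
  \bigcup_(mu in Xi px xs qu)
    Lambda_dir (diag_xx px) (mu *m (jacobian g (diag_xx px))^T) (diag_xx qu).

(** The normal cone to the critical cone at [lam], in direction [qu]. *)
Definition critical_normal (px qu : 'rV[R]_(l + n)) (lam : 'rV[R]_s) :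
    set 'rV[R]_s :=
  normal_cone (critical_cone D (gtilde px) lam) (qu *m jacobian gtilde px).

Definition second_order_elt (px qu : 'rV[R]_(l + n)) (lam eta : 'rV[R]_s) :
    'rV[R]_n :=
  qu *m jacobian (fun px' => lam *m (bT px')^T) px + eta *m (bT px)^T.

Definition Fmap (y : 'rV[R]_(l + n + s)) : set 'rV[R]_(s + s) :=
  [set row_mx (gtilde (lsubmx y)) (rsubmx y) - w | w in gph (normal_cone D)].

End ConstraintSystem.

(* Main.v *)
From HB Require Import structures.
Require Import Defs.
From mathcomp Require Import all_boot all_order all_algebra.
From mathcomp Require Import all_classical all_reals all_analysis.
From mathcomp Require Import ring lra.
Import Order.TTheory GRing.Theory Num.Theory.
Import numFieldNormedType.Exports.

Set Implicit Arguments.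
Unset Strict Implicit.
Unset Printing Implicit Defensive.

Local Open Scope classical_set_scope.
Local Open Scope ring_scope.

(** Write [y = (p, x, z)], [J] for the Jacobian of [g] at [y], [B] for its block
    in [z], [v] for the direction, [d = v J], and [L] for the differential of the
    Jacobian at [y], so that [dot lam (v *m L v)] is the curvature of
    [dot lam (g _)] along [v]. Everything is done for the mapping [normal_map]
    sending [(q, z)] to the normal cone at [z] of the feasible set
    [{z | g (q, z) \in D}], without reference to the diagonal. [Psi] is an
    instance of it, and [Gmap] is its restriction to the diagonal, which gives
    the first inclusion.

    Multipliers. Metric regularity of the constraints in [z], uniform in the
    parameters, passes to the linearised constraints; separating a normal vector
    [x] from the compact convex set of all [B^T lam], [lam] normal to [D] with
    [|lam| <= kappa |x|], then shows that [x] belongs to this set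
    ([normal_multiplier]).

    Upper estimate ([limit_multiplier], [normal_map_derivative]). Consider normal
    vectors [xs + t_k x_k] at [y + t_k u_k], with multipliers [lam_k]. These are
    bounded, and since [D] has finitely many faces one may assume that the active
    constraints are the same for all [k] and that [lam_k] converges to some [lam].
    Both [lam_k] and [lam] are orthogonal to [g (y + t_k u_k) - g y], on which
    every other normal to [D] at [g y] is nonpositive: the second-order expansion
    of [g] yields the maximality of the curvature at [lam]. The quotients
    [(lam_k - lam) / t_k] lie in a finitely generated cone. They need not
    converge, but the image of this cone under [B^T] is closed, which provides
    [eta].

    Lower estimate ([normal_map_approached]). Maximality of [lam] is optimality in
    a linear program, whose dual solution [w] ([lp_dual]) makes the parabola
    [y + t v + t^2 w] satisfy the constraints up to [o(t^2)], and orthogonally to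
    [lam + t eta]. Over the feasible set for the parameter on this parabola,
    minimise [- dot (xs + t vs) z + rho |z - z_t|^2], where [z_t] is the last
    component of the point of the parabola. As [lam + t eta] is a multiplier whose
    slope at [z_t] is [xs + t vs] up to [o(t)], the Lagrangian bounds this function
    from below, while regularity gives a feasible point at distance [o(t^2)] from
    [z_t]. So the minimiser is at distance [o(t)] from [z_t], and its first-order
    condition is the normal vector sought.

    Subregularity ([subregular_approached]). The segment
    [(g y + t d, lam + t eta)] lies in the graph of the normal cone of the
    polyhedron [D] for small [t], so the constraint system defining [Fmap] has
    residual [o(t)] along [(qu, eta)]. Subregularity yields exact solutions
    [(px', mu)] at distance [o(t)], and [B^T mu] at [px'] is the normal vector
    sought, now with both arguments of [Psi] on the diagonal. *)

(** * Inner product and norms *)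

Section Dot.
Context {R : realType}.

Lemma dotE n (u v : 'rV[R]_n) : dot u v = \sum_j u 0 j * v 0 j.
Proof. by rewrite /dot mxE; apply: eq_bigr => j _; rewrite mxE. Qed.

Lemma dotC n (u v : 'rV[R]_n) : dot u v = dot v u.
Proof. by rewrite !dotE; apply: eq_bigr => j _; rewrite mulrC. Qed.

Lemma dotDl n (u v w : 'rV[R]_n) : dot (u + v) w = dot u w + dot v w.
Proof. by rewrite /dot mulmxDl mxE. Qed.

Lemma dotDr n (u v w : 'rV[R]_n) : dot w (u + v) = dot w u + dot w v.
Proof. by rewrite dotC dotDl !(dotC _ w). Qed.

Lemma dotZl n a (u w : 'rV[R]_n) : dot (a *: u) w = a * dot u w.
Proof. by rewrite /dot -scalemxAl mxE. Qed.

Lemma dotZr n a (u w : 'rV[R]_n) : dot w (a *: u) = a * dot w u.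
Proof. by rewrite dotC dotZl dotC. Qed.

Lemma dotNl n (u w : 'rV[R]_n) : dot (- u) w = - dot u w.
Proof. by rewrite -scaleN1r dotZl mulN1r. Qed.

Lemma dotNr n (u w : 'rV[R]_n) : dot w (- u) = - dot w u.
Proof. by rewrite dotC dotNl dotC. Qed.

Lemma dotBl n (u v w : 'rV[R]_n) : dot (u - v) w = dot u w - dot v w.
Proof. by rewrite dotDl dotNl. Qed.

Lemma dotBr n (u v w : 'rV[R]_n) : dot w (u - v) = dot w u - dot w v.
Proof. by rewrite dotDr dotNr. Qed.

Lemma dot0l n (w : 'rV[R]_n) : dot 0 w = 0.
Proof. by rewrite /dot mul0mx mxE. Qed.

Lemma dot0r n (w : 'rV[R]_n) : dot w 0 = 0.
Proof. by rewrite dotC dot0l. Qed.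

Definition dotlin := (dotDl, dotDr, dotNl, dotNr, dotZl, dotZr, dot0l, dot0r).

Lemma dot_mulmx m n (u : 'rV[R]_m) (A : 'M[R]_(m, n)) (v : 'rV[R]_n) :
  dot (u *m A) v = dot u (v *m A^T).
Proof. by rewrite /dot trmx_mul trmxK mulmxA. Qed.

Lemma dot_ge0 n (u : 'rV[R]_n) : 0 <= dot u u.
Proof. by rewrite dotE; apply: sumr_ge0 => j _; rewrite -expr2 sqr_ge0. Qed.

Lemma coord_le_norm m n (A : 'M[R]_(m, n)) i j : `|A i j| <= `|A|.
Proof.
rewrite [leRHS]/Num.norm /= mx_normrE.
by apply/bigmax_geP; right => /=; exists (i, j).
Qed.

Lemma norm_le_coord m n (A : 'M[R]_(m, n)) e :
  0 <= e -> (forall i j, `|A i j| <= e) -> `|A| <= e.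
Proof.
move=> e0 Ae; rewrite [leLHS]/Num.norm /= mx_normrE.
by apply/bigmax_leP; split => // -[i j] _ /=.
Qed.

Lemma norm_coord_lt m n (A : 'M[R]_(m, n)) e :
  0 < e -> (forall i j, `|A i j| < e) -> `|A| < e.
Proof.
move=> e0 Ae; rewrite [ltLHS]/Num.norm /= mx_normrE.
by apply/bigmax_ltP; split => // -[i j] _ /=.
Qed.

Lemma sqr_norm_le_dot n (u : 'rV[R]_n) : `|u| ^+ 2 <= dot u u.
Proof.
rewrite -(ger0_norm (dot_ge0 u)) -[leRHS]sqr_sqrtr ?normr_ge0//.
rewrite lerXn2r ?nnegrE ?sqrtr_ge0//.
apply: norm_le_coord; first exact: sqrtr_ge0.
move=> i j; rewrite -sqrtr_sqr ler_wsqrtr// ger0_norm ?dot_ge0// dotE ord1.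
rewrite (bigD1 j)//= expr2 lerDl.
by apply: sumr_ge0 => k _; rewrite -expr2 sqr_ge0.
Qed.

Lemma sum_le_const n (F : 'I_n -> R) c :
  (forall j, F j <= c) -> \sum_j F j <= n%:R * c.
Proof.
move=> Fc; rewrite mulr_natl -[n in leRHS]card_ord -sumr_const.
by apply: ler_sum => j _; apply: Fc.
Qed.

Lemma dot_le_norm n (u v : 'rV[R]_n) : `|dot u v| <= n%:R * (`|u| * `|v|).
Proof.
rewrite dotE (le_trans (ler_norm_sum _ _ _))//.
apply: sum_le_const => j.
by rewrite normrM ler_pM// coord_le_norm.
Qed.

Lemma norm_mulmx m n p (A : 'M[R]_(m, n)) (B : 'M[R]_(n, p)) :
  `|A *m B| <= n%:R * (`|A| * `|B|).
Proof.
apply: norm_le_coord; first by rewrite !mulr_ge0.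
move=> i j; rewrite mxE (le_trans (ler_norm_sum _ _ _))//.
apply: sum_le_const => k.
by rewrite normrM ler_pM// coord_le_norm.
Qed.

Lemma norm_trmx m n (A : 'M[R]_(m, n)) : `|A^T| = `|A|.
Proof.
apply/le_anti/andP; split; apply: norm_le_coord => // i j.
  by rewrite mxE coord_le_norm.
by have := coord_le_norm A^T j i; rewrite mxE.
Qed.

Lemma dot_row_mx m n (a c : 'rV[R]_m) (b d : 'rV[R]_n) :
  dot (row_mx a b) (row_mx c d) = dot a c + dot b d.
Proof. by rewrite /dot tr_row_mx mul_row_col mxE. Qed.

Lemma dot_scalar (a : 'rV[R]_1) (b : R) : dot a b%:M = a 0 0 * b.
Proof. by rewrite dotE big_ord1 [b%:M 0 0]mxE mulr1n. Qed.

(** ** Euclidean norm *)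

Lemma eucl_norm_ge0 n (u : 'rV[R]_n) : 0 <= eucl_norm u.
Proof. exact: sqrtr_ge0. Qed.

Lemma sqr_eucl_norm n (u : 'rV[R]_n) : eucl_norm u ^+ 2 = dot u u.
Proof. by rewrite sqr_sqrtr ?dot_ge0. Qed.

Lemma norm_le_eucl n (u : 'rV[R]_n) : `|u| <= eucl_norm u.
Proof.
rewrite -(@ler_pXn2r _ 2)// ?nnegrE ?eucl_norm_ge0//.
by rewrite sqr_eucl_norm sqr_norm_le_dot.
Qed.

Lemma eucl_le_norm n (u : 'rV[R]_n) : eucl_norm u <= n%:R * `|u|.
Proof.
rewrite -(@ler_pXn2r _ 2)// ?nnegrE ?eucl_norm_ge0 ?mulr_ge0//.
rewrite sqr_eucl_norm (le_trans (ler_norm _))// (le_trans (dot_le_norm _ _))//.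
rewrite exprMn -expr2 ler_wpM2r ?exprn_ge0//.
by rewrite expr2 -natrM ler_nat; case: (n) => // k; rewrite leq_pmulr.
Qed.

Lemma eucl_normZ n a (u : 'rV[R]_n) : eucl_norm (a *: u) = `|a| * eucl_norm u.
Proof.
by rewrite /eucl_norm dotZl dotZr mulrA -expr2 sqrtrM ?sqr_ge0// sqrtr_sqr.
Qed.

Lemma eucl_norm0 n : eucl_norm (0 : 'rV[R]_n) = 0.
Proof. by rewrite /eucl_norm dot0l sqrtr0. Qed.

Lemma eucl_norm0_eq0 n (u : 'rV[R]_n) : eucl_norm u = 0 -> u = 0.
Proof.
by move=> u0; apply/eqP; rewrite -normr_le0 -u0 norm_le_eucl.
Qed.

Lemma cauchy_schwarz n (u v : 'rV[R]_n) :
  dot u v <= eucl_norm u * eucl_norm v.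
Proof.
have [/eucl_norm0_eq0->|u0] := eqVneq (eucl_norm u) 0.
  by rewrite dot0l eucl_norm0 mul0r.
have [/eucl_norm0_eq0->|v0] := eqVneq (eucl_norm v) 0.
  by rewrite dot0r eucl_norm0 mulr0.
have := dot_ge0 (eucl_norm v *: u - eucl_norm u *: v).
rewrite !dotlin -!sqr_eucl_norm (dotC v u).
have := eucl_norm_ge0 u; rewrite le0r (negbTE u0)/= => {}u0.
have := eucl_norm_ge0 v; rewrite le0r (negbTE v0)/= => {}v0.
set a := eucl_norm u in u0 *; set b := eucl_norm v in v0 *; set c := dot u v.
have ab : 0 < a * b by rewrite mulr_gt0.
rewrite [X in 0 <= X](_ : _ = 2 * (a * b) * (a * b - c)); last by ring.
by rewrite pmulr_rge0 ?subr_ge0// mulr_gt0.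
Qed.

Lemma eucl_normD n (u v : 'rV[R]_n) :
  eucl_norm (u + v) <= eucl_norm u + eucl_norm v.
Proof.
rewrite -(@ler_pXn2r _ 2)// ?nnegrE ?addr_ge0 ?eucl_norm_ge0//.
rewrite sqrrD !sqr_eucl_norm !dotlin (dotC v u).
have := cauchy_schwarz u v; lra.
Qed.

Lemma eucl_normN n (u : 'rV[R]_n) : eucl_norm (- u) = eucl_norm u.
Proof. by rewrite -scaleN1r eucl_normZ normrN1 mul1r. Qed.

(** ** Convergence of matrices *)

Lemma cvg_mx T (F : set_system T) m n (M : T -> 'M[R]_(m, n)) (L : 'M[R]_(m, n)) :
  Filter F -> (forall i j, M k i j @[k --> F] --> L i j) -> M @ F --> L.
Proof.
move=> FF ML; apply/cvgrPdist_lt => e e0.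
have : \forall k \near F, forall i j, `|L i j - M k i j| < e.
  by apply: filter_forall => i; apply: filter_forall => j; apply: cvgr_dist_lt.
by apply: filterS => k Mk; apply: norm_coord_lt => // i j; rewrite !mxE.
Qed.

Lemma cvg_coord T (F : set_system T) m n (M : T -> 'M[R]_(m, n)) (L : 'M[R]_(m, n))
    i j : Filter F -> M @ F --> L -> M k i j @[k --> F] --> L i j.
Proof.
move=> FF ML; apply/cvgrPdist_lt => e e0.
move/cvgr_dist_lt: ML => /(_ _ e0); apply: filterS => k.
by apply: le_lt_trans; have := coord_le_norm (L - M k) i j; rewrite !mxE.
Qed.

Lemma cvg_mulmx T (F : set_system T) m n p (A : T -> 'M[R]_(m, n))
    (B : T -> 'M[R]_(n, p)) (a : 'M[R]_(m, n)) (b : 'M[R]_(n, p)) : Filter F ->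
  A @ F --> a -> B @ F --> b -> A k *m B k @[k --> F] --> a *m b.
Proof.
move=> FF Aa Bb; apply: cvg_mx => i j; rewrite mxE.
under eq_fun do rewrite mxE.
apply: cvg_big; first exact: add_continuous.
by move=> k _; apply: cvgM; exact: cvg_coord.
Qed.

Lemma cvg_trmx T (F : set_system T) m n (A : T -> 'M[R]_(m, n))
    (a : 'M[R]_(m, n)) : Filter F ->
  A @ F --> a -> (A k)^T @[k --> F] --> a^T.
Proof.
move=> FF Aa; apply: cvg_mx => i j; rewrite mxE.
under eq_fun do rewrite mxE.
exact: cvg_coord.
Qed.

Lemma cvg_dot T (F : set_system T) n (u v : T -> 'rV[R]_n)
    (a b : 'rV[R]_n) : Filter F ->
  u @ F --> a -> v @ F --> b -> dot (u k) (v k) @[k --> F] --> dot a b.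
Proof.
by move=> FF ua vb; apply: cvg_coord; apply: cvg_mulmx => //; apply: cvg_trmx.
Qed.

Lemma norm_row_mx m n p (A : 'M[R]_(m, n)) (B : 'M[R]_(m, p)) :
  `|row_mx A B| <= `|A| + `|B|.
Proof.
apply: norm_le_coord; first by rewrite addr_ge0.
move=> i j; rewrite mxE; case: splitP => k _.
  by rewrite (le_trans (coord_le_norm _ _ _))// lerDl.
by rewrite (le_trans (coord_le_norm _ _ _))// lerDr.
Qed.

Lemma norm_lsubmx m n p (A : 'M[R]_(m, n + p)) : `|lsubmx A| <= `|A|.
Proof. by apply: norm_le_coord => // i j; rewrite mxE coord_le_norm. Qed.

Lemma norm_rsubmx m n p (A : 'M[R]_(m, n + p)) : `|rsubmx A| <= `|A|.
Proof. by apply: norm_le_coord => // i j; rewrite mxE coord_le_norm. Qed.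

Lemma norm_dsubmx m n p (A : 'M[R]_(m + n, p)) : `|dsubmx A| <= `|A|.
Proof. by apply: norm_le_coord => // i j; rewrite mxE coord_le_norm. Qed.

End Dot.

(** * Finitely generated cones *)

Section Farkas.
Context {R : realType} {n : nat}.
Implicit Types (r : seq 'rV[R]_n) (x w : 'rV[R]_n).

(** The convex cone generated by [r], by recursion on [r]: no family of
    coefficients has to be handled, and Farkas' lemma is an induction on [r]. *)
Fixpoint fcone r x : Prop :=
  if r is a :: r' then exists2 t : R, 0 <= t & fcone r' (x - t *: a)
  else x = 0.

Lemma fcone0 r : fcone r 0.
Proof.
by elim: r => //= a r IH; exists 0 => //; rewrite scale0r subr0.
Qed.

Lemma fconeD r x y : fcone r x -> fcone r y -> fcone r (x + y).
Proof.
elim: r x y => [|a r IH] x y /=; first by move=> -> ->; rewrite addr0.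
move=> [t t0 xt] [u u0 yu]; exists (t + u); first exact: addr_ge0.
by rewrite scalerDl opprD addrACA; exact: IH.
Qed.

Lemma fconeZ r k x : 0 <= k -> fcone r x -> fcone r (k *: x).
Proof.
elim: r x => [|a r IH] x k0 /=; first by move=> ->; rewrite scaler0.
move=> [t t0 xt]; exists (k * t); first exact: mulr_ge0.
by rewrite -scalerA -scalerBr; exact: IH.
Qed.

Lemma fcone_mem r a : a \in r -> fcone r a.
Proof.
elim: r => //= b r IH; rewrite inE => /orP[/eqP <-|/IH ar].
  by exists 1 => //; rewrite scale1r subrr; exact: fcone0.
by exists 0 => //; rewrite scale0r subr0.
Qed.

Lemma fcone_sub r r' x : {in r, forall a, fcone r' a} -> fcone r x -> fcone r' x.
Proof.
elim: r x => [|a r IH] x rr' /=; first by move=> ->; exact: fcone0.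
move=> [t t0 xt]; rewrite -(subrK (t *: a) x); apply: fconeD.
  by apply: IH => // b br; apply: rr'; rewrite inE br orbT.
by apply: fconeZ => //; apply: rr'; rewrite inE eqxx.
Qed.

Lemma fcone_dot_le0 r x w :
  {in r, forall a, dot w a <= 0} -> fcone r x -> dot w x <= 0.
Proof.
elim: r x => [|a r IH] x wr /=; first by move=> ->; rewrite dot0r.
move=> [t t0 xt]; rewrite -(subrK (t *: a) x) dotDr dotZr.
have wa : dot w a <= 0 by apply: wr; rewrite inE eqxx.
have wx : dot w (x - t *: a) <= 0.
  by apply: IH => // b br; apply: wr; rewrite inE br orbT.
have := mulr_ge0_le0 t0 wa; lra.
Qed.

Lemma fcone_dot_eq0 r x w :
  {in r, forall a, dot w a = 0} -> fcone r x -> dot w x = 0.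
Proof.
move=> wr xr; apply/eqP; rewrite eq_le; apply/andP; split.
  by apply: fcone_dot_le0 xr => a /wr ->.
rewrite -oppr_le0 -dotNl; apply: fcone_dot_le0 xr => a /wr.
by rewrite dotNl => ->; rewrite oppr0.
Qed.

End Farkas.

(** Induction on the number of generators: if a vector [w] separates [x] from
    the first generators but not from the last one [a], everything is projected
    along [a] to the hyperplane orthogonal to [w]. *)
Lemma farkas (R : realType) n (r : seq 'rV[R]_n) (x : 'rV[R]_n) :
  fcone r x \/
  exists2 w, {in r, forall a, dot w a <= 0} & 0 < dot w x.
Proof.
elim: {r}(size r) {-2}r (eqxx (size r)) x => [|k IH] [|a r]//= sr x.
  have [->|x0] := eqVneq x 0; first by left.
  right; exists x => //; rewrite lt_def dot_ge0 andbT -sqr_eucl_norm.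
  rewrite expf_eq0/=; apply: contraNneq x0 => x0.
  exact/eqP/eucl_norm0_eq0.
have [xr|[w wr wx]] := IH r sr x.
  by left; exists 0 => //; rewrite scale0r subr0.
have [wa|wa] := leP (dot w a) 0.
  by right; exists w => // b; rewrite inE => /orP[/eqP->//|/wr].
pose p b := dot w a *: b - dot w b *: a.
have [|xr|[w' w'r w'x]] := IH (map p r) _ (p x); first by rewrite size_map.
  have wai : 0 <= (dot w a)^-1 by rewrite invr_ge0 ltW.
  left; have {xr} : fcone (a :: r) (p x).
    apply: fcone_sub xr => _ /mapP[b br ->]; rewrite /p -scaleNr.
    apply: fconeD; apply: fconeZ; rewrite ?oppr_ge0 ?wr//; first exact: ltW.
      by apply: fcone_mem; rewrite inE br orbT.
    by apply: fcone_mem; rewrite inE eqxx.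
  move=> /(fconeD (fconeZ (ltW wx) (fcone_mem (mem_head a r)))).
  rewrite /p addrC subrK => /(fconeZ wai).
  by rewrite scalerA mulVf ?gt_eqF// scale1r.
right; exists (dot w a *: w' - dot w' a *: w).
  move=> b; rewrite inE => /orP[/eqP->|br].
    by rewrite dotBl !dotZl mulrC subrr.
  have /w'r : p b \in map p r by apply: map_f.
  by rewrite /p dotBr !dotZr dotBl !dotZl mulrC (mulrC (dot w' a)).
by move: w'x; rewrite /p dotBr !dotZr dotBl !dotZl (mulrC (dot w x)).
Qed.

Section ConeLimits.
Context {R : realType}.

Lemma lim_le (x : nat -> R) (l b : R) :
  x @ \oo --> l -> (forall k, x k <= b) -> l <= b.
Proof.
move=> xl xb; apply: (@closed_cvg _ _ _ _ x (fun y => y <= b)) xl.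
  exact: closed_le.
exact: nearW.
Qed.

Lemma lim_eq (x : nat -> R) (l b : R) :
  x @ \oo --> l -> (forall k, x k = b) -> l = b.
Proof.
move=> xl xb; apply/eqP; rewrite eq_le; apply/andP; split.
  by apply: lim_le xl _ => k; rewrite xb.
rewrite -lerN2; apply: (@lim_le (fun k => - x k)); first exact: cvgN.
by move=> k; rewrite xb.
Qed.

Lemma dot_continuous n (w : 'rV[R]_n) : continuous (dot w).
Proof.
move=> x; have w_cst : (fun=> w) @ nbhs x --> w by exact: cvg_cst.
exact: (@cvg_dot _ _ (nbhs x) _ (fun=> w) id w x _ w_cst).
Qed.

Lemma closed_fcone n (r : seq 'rV[R]_n) : closed [set x | fcone r x].
Proof.
rewrite (_ : mkset _ =
    \bigcap_(w in [set w | {in r, forall a, dot w a <= 0}])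
      (dot w @^-1` [set y | y <= 0])).
  apply: closed_bigI => w _; apply: preimage_closed; last exact: closed_le.
  by move=> x _; exact: dot_continuous.
apply/seteqP; split=> x /=; first by move=> rx w wr; exact: fcone_dot_le0 rx.
move=> xr; have [//|[w wr]] := farkas r x.
by rewrite ltNge (xr w wr).
Qed.

Lemma fcone_lim n (r : seq 'rV[R]_n) (x : nat -> 'rV[R]_n) (l : 'rV[R]_n) :
  x @ \oo --> l -> (forall k, fcone r (x k)) -> fcone r l.
Proof.
move=> xl rx; apply: (@closed_cvg _ _ _ _ x _ (@closed_fcone _ r)) xl.
exact: nearW.
Qed.

Lemma fcone_map m n (B : 'M[R]_(m, n)) r x :
  fcone r x -> fcone [seq a *m B | a <- r] (x *m B).
Proof.
elim: r x => [|a r IH] x /=; first by move=> ->; rewrite mul0mx.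
by move=> [t t0 /IH]; exists t => //; rewrite scalemxAl -mulmxBl.
Qed.

Lemma fcone_map_ex m n (B : 'M[R]_(m, n)) r z :
  fcone [seq a *m B | a <- r] z -> exists2 x, fcone r x & z = x *m B.
Proof.
elim: r z => [|a r IH] z /=; first by move=> ->; exists 0; rewrite ?mul0mx.
move=> [t t0 /IH[x rx zx]]; exists (x + t *: a).
  by exists t => //; rewrite addrK.
by rewrite mulmxDl -scalemxAl -zx subrK.
Qed.

(** A generator with [dot w a < 0] has coefficient zero in such a vector [x]. *)
Lemma fcone_face n (r : seq 'rV[R]_n) x w :
  {in r, forall a, dot w a <= 0} -> fcone r x -> dot w x = 0 ->
  fcone [seq a <- r | dot w a == 0] x.
Proof.
elim: r x => [//|a r IH] x wr [t t0 xt] wx.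
have wr' : {in r, forall b, dot w b <= 0}.
  by move=> b br; apply: wr; rewrite inE br orbT.
have wa : dot w a <= 0 by apply: wr; rewrite inE eqxx.
have le0 : dot w (x - t *: a) <= 0 by exact: fcone_dot_le0 xt.
have := mulr_ge0_le0 t0 wa.
move: (le0); rewrite dotBr dotZr wx sub0r => le0' ge0.
have ta0 : t * dot w a = 0 by lra.
have {}xt : fcone [seq b <- r | dot w b == 0] (x - t *: a).
  by apply: IH => //; rewrite dotBr dotZr wx ta0 subr0.
rewrite /=; case: ifPn => [_|wa0]; first by exists t.
move/eqP: ta0; rewrite mulf_eq0 (negbTE wa0) orbF => /eqP t00.
by move: xt; rewrite t00 scale0r subr0.
Qed.

(** Linear programming duality: [lam] maximises the linear functional [h] over
    the generated cone, subject to linear equations given by [J], and [w] is a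
    dual solution complementary to [lam]. Farkas' lemma is applied to the
    homogenised dual system, with an additional coordinate [tau]; the case
    [tau > 0] gives [w], the other one a direction that improves [lam]. *)
Lemma lp_dual m n (r : seq 'rV[R]_n) (J : 'M[R]_(m, n)) (h lam : 'rV[R]_n) :
  fcone r lam ->
  (forall lam', fcone r lam' -> lam' *m J^T = lam *m J^T ->
     dot lam' h <= dot lam h) ->
  exists w : 'rV[R]_m, {in r, forall a, dot a (w *m J + 2^-1 *: h) <= 0} /\
    dot lam (w *m J + 2^-1 *: h) = 0.
Proof.
move=> rlam hmax.
pose M : 'M[R]_(n, m + 1) := row_mx J^T h^T.
have ME (x : 'rV[R]_n) : x *m M = row_mx (x *m J^T) (dot x h)%:M.
  by rewrite mul_mx_row; congr row_mx; rewrite [LHS]mx11_scalar.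
have [xr|[w wr wx]] :=
  farkas [seq a *m M | a <- (- lam) :: r] (row_mx 0 1%:M).
  have [nu [t t0 rnu]] := fcone_map_ex xr.
  rewrite ME => /eq_row_mx[nuJ /(congr1 (fun A : 'M[R]_1 => A 0 0))].
  rewrite !mxE eqxx !mulr1n => nuh; exfalso.
  move: rnu; rewrite scalerN opprK => rnu.
  have t1 : 0 < 1 + t by rewrite ltr_wpDr.
  (* [lam + nu / (1 + t)] satisfies the constraints and has a larger value. *)
  have := hmax ((1 + t)^-1 *: (nu + t *: lam + lam)).
  have -> : dot ((1 + t)^-1 *: (nu + t *: lam + lam)) h =
            dot lam h + (1 + t)^-1.
    by rewrite !dotlin -nuh; field; rewrite gt_eqF.
  have -> : (1 + t)^-1 *: (nu + t *: lam + lam) *m J^T = lam *m J^T.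
    rewrite -scalemxAl !mulmxDl -nuJ add0r -scalemxAl.
    set z := lam *m J^T; rewrite -[X in _ *: (_ + X)](scale1r z).
    by rewrite -scalerDl (addrC t) scalerA mulVf ?gt_eqF// scale1r.
  rewrite gerDl leNgt invr_gt0 t1 => H.
  have : fcone r ((1 + t)^-1 *: (nu + t *: lam + lam)).
    by apply: fconeZ; rewrite ?invr_ge0 ?(ltW t1)//; exact: fconeD.
  by move=> /H/(_ erefl).
have wE a : dot w (a *m M) = dot a (lsubmx w *m J + rsubmx w 0 0 *: h).
  rewrite ME -{1}(hsubmxK w) dot_row_mx dot_scalar dotDr dotZr.
  by rewrite -dot_mulmx (dotC _ a).
have {}wx : 0 < rsubmx w 0 0.
  by move: wx; rewrite -{1}(hsubmxK w) dot_row_mx dot0r add0r dot_scalar mulr1.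
set tau := rsubmx w 0 0 in wE wx.
(* The factor normalises the additional coordinate to [1 / 2]. *)
pose k := (2 * tau)^-1.
have k0 : 0 < k by rewrite invr_gt0 mulr_gt0.
have kE a : dot a ((k *: lsubmx w) *m J + 2^-1 *: h) = k * dot w (a *m M).
  rewrite wE -dotZr scalerDr scalemxAl scalerA; congr (dot _ (_ + _ *: _)).
  by rewrite /k; field; rewrite gt_eqF.
exists (k *: lsubmx w); split=> [a ar|].
  rewrite kE pmulr_rle0//; apply: wr.
  by rewrite inE (map_f (fun a => a *m M) ar) orbT.
rewrite kE; apply/eqP; rewrite mulf_eq0 (gt_eqF k0)/= eq_le; apply/andP; split.
  apply: fcone_dot_le0 (fcone_map M rlam) => _ /mapP[a ar ->].
  by apply: wr; rewrite inE (map_f (fun a => a *m M) ar) orbT.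
have := wr (- lam *m M); rewrite inE eqxx mulNmx dotNr oppr_le0.
exact.
Qed.

End ConeLimits.

(** * Polyhedral sets and their cones *)

Section Tangents.
Context {R : realType} {n : nat}.
Implicit Types (Omega : set 'rV[R]_n) (z u : 'rV[R]_n).

(** Derivability of the direction [u], stated with points of [Omega] instead of
    the distance to [Omega]. *)
Definition approached Omega z u :=
  forall e : R, 0 < e -> \forall t \near (0 : R)^'+,
    exists2 w, `|w - u| <= e & Omega (z + t *: w).

Lemma harmonic_small (e : R) : 0 < e ->
  \forall k \near \oo, (k.+1%:R^-1 : R) < e.
Proof.
move=> e0; have /cvgr0_norm_lt/(_ e e0) := @cvg_harmonic R.
by apply: filterS => k; rewrite ger0_norm// /harmonic invr_ge0.
Qed.

Lemma cvg_of_harmonic p q (x : nat -> 'M[R]_(p, q)) l :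
  (forall k, `|x k - l| <= k.+1%:R^-1) -> x @ \oo --> l.
Proof.
move=> xl; apply/cvgrPdist_lt => e /harmonic_small; apply: filterS => k.
by apply: le_lt_trans; rewrite distrC.
Qed.

Lemma approached_tangent Omega z u :
  Omega z -> approached Omega z u -> tangent_cone Omega z u.
Proof.
move=> Oz app; split => //.
have P k : exists p : 'rV[R]_n * R, [/\ 0 < p.2, p.2 < k.+1%:R^-1,
    `|p.1 - u| <= k.+1%:R^-1 & Omega (z + p.2 *: p.1)].
  have k0 : 0 < (k.+1%:R^-1 : R) by rewrite invr_gt0.
  have /filter_ex[t [[t0 tk] [w wu Ow]]] :
      \forall t \near (0 : R)^'+, (0 < t /\ t < k.+1%:R^-1) /\
        exists2 w, `|w - u| <= k.+1%:R^-1 & Omega (z + t *: w).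
    near=> t; split; last by near: t; exact: app.
    by split; near: t; [exact: nbhs_right_gt|exact: nbhs_right_lt].
  by exists (w, t).
have [p pP] := choice P.
exists (fun k => (p k).1), (fun k => (p k).2); split.
- by apply: cvg_of_harmonic => k; case: (pP k).
- by move=> k; case: (pP k).
- apply/cvgrPdist_lt => e /harmonic_small; apply: filterS => k ke.
  rewrite sub0r normrN; case: (pP k) => p0 pk _ _.
  by rewrite gtr0_norm// (lt_trans pk).
- by move=> k; case: (pP k).
Unshelve. all: end_near. Qed.

Lemma setdist_le Omega x y (e : R) :
  Omega y -> eucl_norm (x - y) <= e -> (setdist x Omega <= e%:E)%E.
Proof.
move=> Oy xy; apply: (@le_trans _ _ (eucl_norm (x - y))%:E).
  by apply: ereal_inf_lbound; exists y.
by rewrite lee_fin.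
Qed.

Lemma setdist_lt_ex Omega x (e : R) :
  (setdist x Omega < e%:E)%E -> exists2 y, Omega y & eucl_norm (x - y) < e.
Proof.
move=> /ereal_inf_lt[_ /= [y Oy <-]]; rewrite lte_fin => xy.
by exists y.
Qed.

Lemma approached_derivable Omega z u :
  Omega z -> approached Omega z u -> derivable_tangent Omega z u.
Proof.
move=> Oz app; split; first exact: approached_tangent.
move=> e e0; have e'0 : 0 < e / n.+1%:R by rewrite divr_gt0.
near=> t.
have t0 : 0 < t by near: t; exact: nbhs_right_gt.
have [w wu Ow] : exists2 w, `|w - u| <= e / n.+1%:R & Omega (z + t *: w).
  by near: t; exact: app.
apply: setdist_le Ow _.
rewrite opprD addrACA subrr add0r -scalerBr eucl_normZ gtr0_norm// mulrC.
rewrite ler_wpM2r ?(ltW t0)// (le_trans (eucl_le_norm _))// distrC.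
rewrite (le_trans (ler_wpM2l _ wu))// mulrCA -[leRHS]mulr1 ler_wpM2l ?ltW//.
by rewrite ltr_pdivrMr// mul1r ltr_nat.
Unshelve. all: end_near. Qed.

End Tangents.

Section Polyhedron.
Context {R : realType} {n m : nat}.
Variables (a : 'I_m -> 'rV[R]_n) (c : 'I_m -> R).

Definition halfspaces : set 'rV[R]_n := [set x | forall j, dot (a j) x <= c j].
Let D := halfspaces.

Definition active (z : 'rV[R]_n) : {set 'I_m} := [set j | dot (a j) z == c j].

Definition gens (S : {set 'I_m}) : seq 'rV[R]_n := [seq a j | j <- enum S].

Lemma gensP (S : {set 'I_m}) (P : 'rV[R]_n -> Prop) :
  (forall j, j \in S -> P (a j)) <-> {in gens S, forall b, P b}.
Proof.
split=> [PS _ /mapP[j + ->]|PS j jS]; first by rewrite mem_enum; exact: PS.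
by apply: PS; apply: map_f; rewrite mem_enum.
Qed.

Lemma fcone_gens_sub (S T : {set 'I_m}) x :
  S \subset T -> fcone (gens S) x -> fcone (gens T) x.
Proof.
move=> /fintype.subsetP ST; apply: fcone_sub; apply/gensP => j /ST jT.
by apply: fcone_mem; apply: map_f; rewrite mem_enum.
Qed.

Lemma near_affine_le (p q r : R) : p <= r -> (p = r -> q <= 0) ->
  \forall t \near (0 : R)^'+, p + t * q <= r.
Proof.
rewrite le_eqVlt => /orP[/eqP -> /(_ erefl) q0|pr _]; near=> t.
  have t0 : 0 < t by near: t; exact: nbhs_right_gt.
  by rewrite gerDl mulr_ge0_le0// ltW.
have t0 : 0 < t by near: t; exact: nbhs_right_gt.
rewrite -lerBrDl.
have : t <= (r - p) / (`|q| + 1).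
  near: t; apply: nbhs_right_le; apply: divr_gt0; first by rewrite subr_gt0.
  by rewrite ltr_pwDr.
rewrite ler_pdivlMr; last by rewrite ltr_pwDr.
apply: le_trans; rewrite ler_wpM2l ?(ltW t0)//.
by rewrite (le_trans (ler_norm _))// lerDl.
Unshelve. all: end_near. Qed.

Lemma halfspaces_feasible z u : D z ->
  (forall j, j \in active z -> dot (a j) u <= 0) ->
  \forall t \near (0 : R)^'+, D (z + t *: u).
Proof.
move=> Dz zu; apply: filter_forall => j.
have := @near_affine_le (dot (a j) z) (dot (a j) u) (c j) (Dz j).
have H : dot (a j) z = c j -> dot (a j) u <= 0.
  by move=> zj; apply: zu; rewrite inE zj.
by move=> /(_ H); apply: filterS => t; rewrite dotDr dotZr.
Qed.

Lemma approached_feasible (Omega : set 'rV[R]_n) z u :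
  (\forall t \near (0 : R)^'+, Omega (z + t *: u)) -> approached Omega z u.
Proof.
move=> Ot e e0; apply: filterS Ot => t Ot; exists u => //.
by rewrite subrr normr0 ltW.
Qed.

(** The difference quotients defining a tangent satisfy the same linear
    inequality, which passes to the limit. *)
Lemma tangent_dot_le (Omega : set 'rV[R]_n) z u v :
  tangent_cone Omega z u ->
  (forall x, Omega x -> dot v (x - z) <= 0) -> dot v u <= 0.
Proof.
move=> [_ [uk [tk [uku tk0 _ Otk]]]] vO.
apply: (@lim_le _ (fun k => dot v (uk k))).
  by apply: cvg_dot => //; exact: cvg_cst.
move=> k; have := vO _ (Otk k); rewrite addrC addKr dotZr.
by rewrite pmulr_rle0.
Qed.

Lemma tangent_halfspaces z u : D z ->
  tangent_cone D z u <-> forall j, j \in active z -> dot (a j) u <= 0.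
Proof.
move=> Dz; split=> [Tu j|zu].
  rewrite inE => /eqP zj; apply: tangent_dot_le Tu _ => x Dx.
  by rewrite dotBr zj subr_le0.
apply: approached_tangent => //; apply: approached_feasible.
exact: halfspaces_feasible.
Qed.

Lemma normal_halfspaces z v :
  normal_cone D z v <-> D z /\ fcone (gens (active z)) v.
Proof.
split=> [[Dz Nv]|[Dz zv]]; last first.
  split=> // u /tangent_halfspaces => /(_ Dz) zu; rewrite dotC.
  by apply: fcone_dot_le0 zv; apply/gensP => j /zu; rewrite dotC.
split=> //; have [//|[w wz]] := farkas (gens (active z)) v.
rewrite ltNge dotC Nv//; apply/tangent_halfspaces => // j jz.
by rewrite dotC; apply: (proj2 (gensP _ (fun b => dot w b <= 0)) wz).
Qed.

Lemma normal_halfspaces_le z x lam (S : {set 'I_m}) : D x ->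
  S \subset active z -> fcone (gens S) lam -> dot lam (x - z) <= 0.
Proof.
move=> Dx /fintype.subsetP Sz Slam; rewrite dotC; apply: fcone_dot_le0 Slam.
apply/gensP => j /Sz; rewrite inE => /eqP zj.
by rewrite dotC dotBr zj subr_le0.
Qed.

Lemma critical_halfspaces z lam d : D z ->
  critical_cone D z lam d <->
  (forall j, j \in active z -> dot (a j) d <= 0) /\ dot lam d = 0.
Proof. by move=> Dz; split=> -[/tangent_halfspaces Td]; split => //; apply/Td. Qed.

(** Combinations of gradients orthogonal to [d] and of [- lam]: this is the form
    in which difference quotients [(lam_k - lam) / t_k] of multipliers occur. *)
Lemma critical_normal_intro z lam d eta (S : {set 'I_m}) : D z ->
  critical_cone D z lam d -> S \subset active z ->
  (forall j, j \in S -> dot (a j) d = 0) ->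
  fcone (- lam :: gens S) eta ->
  normal_cone (critical_cone D z lam) d eta.
Proof.
move=> Dz Kd /fintype.subsetP Sz Sd eta_in; split=> // u Ku; rewrite dotC.
apply: fcone_dot_le0 eta_in => b; rewrite inE => /orP[/eqP->|].
  rewrite dotC; apply: tangent_dot_le Ku _ => x [_ /= lamx].
  by case: Kd => _ /= lamd; rewrite dotNl dotBr lamx lamd subrr oppr0.
apply/(gensP _ (fun b => dot u b <= 0)): b => j jS.
rewrite dotC; apply: tangent_dot_le Ku _ => x /critical_halfspaces => /(_ Dz)[].
by move=> /(_ _ (Sz _ jS)) + _; rewrite dotBr Sd// subr0.
Qed.

(** The active constraints at [z + t d] contain those at [z] orthogonal to [d].
    They generate [lam], as well as [eta] up to a multiple of [lam], which for
    small [t] is absorbed by the coefficient of [lam]. *)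
Lemma critical_normal_segment z lam d eta : normal_cone D z lam ->
  normal_cone (critical_cone D z lam) d eta ->
  dot eta d = 0 /\
  \forall t \near (0 : R)^'+, normal_cone D (z + t *: d) (lam + t *: eta).
Proof.
move=> /normal_halfspaces[Dz Nlam] [/(critical_halfspaces _ _ Dz)[zd lamd] Neta].
pose S := [set j in active z | dot (a j) d == 0].
have Sd j : j \in S -> dot (a j) d = 0 by rewrite inE => /andP[_ /eqP].
(* [lam] is orthogonal to [d], so only constraints of [S] contribute. *)
have Slam : fcone (gens S) lam.
  apply: fcone_sub (fcone_face (w := d) _ Nlam _).
  - move=> b; rewrite mem_filter => /andP[+ /mapP[j + bj]].
    rewrite mem_enum bj dotC => jd jz; apply: fcone_mem; apply: map_f.
    by rewrite mem_enum inE jz.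
  - by apply/(gensP _ (fun b => dot d b <= 0)) => j /zd; rewrite dotC.
  - by rewrite dotC.
(* Otherwise Farkas' lemma gives a direction [w] that is tangent to the critical
   cone at [d] and has a positive product with [eta]. *)
have Seta : fcone [:: lam, - lam & gens S] eta.
  have [//|[w wS]] := farkas [:: lam, - lam & gens S] eta.
  have lamw : dot lam w = 0.
    have := wS lam; have := wS (- lam); rewrite !inE !eqxx orbT dotNr.
    by move=> /(_ isT) + /(_ isT); rewrite dotC; lra.
  have Sw j : j \in S -> dot (a j) w <= 0.
    move=> jS; rewrite dotC; apply: wS; rewrite !inE map_f ?orbT//.
    by rewrite mem_enum.
  rewrite ltNge dotC Neta//; apply: approached_tangent.
    by apply/critical_halfspaces.
  apply: approached_feasible.
  suff : \forall t \near (0 : R)^'+, forall j, j \in active z ->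
      dot (a j) (d + t *: w) <= 0.
    apply: filterS => t Ht; apply/critical_halfspaces => //; split=> //.
    by rewrite dotDr dotZr lamw lamd mulr0 addr0.
  apply: filter_forall => j; have [jz|jz] := boolP (j \in active z); last first.
    by apply: nearW => t.
  have := @near_affine_le (dot (a j) d) (dot (a j) w) 0 (zd _ jz).
  have H : dot (a j) d = 0 -> dot (a j) w <= 0.
    by move=> jd; apply: Sw; rewrite inE jz jd/=.
  by move=> /(_ H); apply: filterS => t tj _; rewrite dotDr dotZr.
split.
  rewrite dotC; apply: fcone_dot_eq0 Seta => b.
  rewrite !inE => /or3P[/eqP->|/eqP->|].
  - by rewrite dotC.
  - by rewrite dotC dotNl lamd oppr0.
  - by apply/(gensP _ (fun b => dot d b = 0)): b => j /Sd; rewrite dotC.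
have Dzd := halfspaces_feasible Dz zd.
case: Seta => t1 t10 [t2 t20 Seta].
near=> t; apply/normal_halfspaces; split; first by near: t.
have t0 : 0 < t by near: t; exact: nbhs_right_gt.
apply: (@fcone_gens_sub S).
  apply/fintype.subsetP => j jS; rewrite inE dotDr dotZr Sd// mulr0 addr0.
  by move: jS; rewrite !inE => /andP[].
have -> : lam + t *: eta =
    (1 + t * (t1 - t2)) *: lam + t *: (eta - t1 *: lam - t2 *: - lam).
  by apply/rowP => i; rewrite !mxE; ring.
apply: fconeD; apply: fconeZ => //.
have : t <= (t2 + 1)^-1.
  by near: t; apply: nbhs_right_le; rewrite invr_gt0 ltr_wpDl.
rewrite -(ler_pM2r (ltr_wpDl t20 (@ltr01 R))) mulVf ?gt_eqF ?ltr_wpDl// mulrDr mulr1.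
have : 0 <= t * t1 by rewrite mulr_ge0// ltW.
by rewrite mulrBr; lra.
Unshelve. all: end_near. Qed.

End Polyhedron.

Lemma convex_polyhedralP (R : realType) n (D : set 'rV[R]_n) :
  convex_polyhedral D ->
  exists m (a : 'I_m -> 'rV[R]_n) (c : 'I_m -> R), D = halfspaces a c.
Proof.
move=> [m [A [c ->]]]; exists m, (fun j => (col j A)^T), (fun j => c 0 j).
suff E x j : (x *m A) 0 j = dot (col j A)^T x.
  by apply/seteqP; split=> x /= xA j; [rewrite -E|rewrite E].
by rewrite mxE dotE; apply: eq_bigr => k _; rewrite !mxE mulrC.
Qed.

(** * Compactness and differentiability *)

Section Sequences.
Context {R : realType}.

Lemma subseq_cvg (T : topologicalType) (x : nat -> T) (l : T) (phi : nat -> nat) :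
  (forall k, (k <= phi k)%N) -> x @ \oo --> l -> x (phi k) @[k --> \oo] --> l.
Proof.
move=> phik; apply: cvg_comp => A [N _ NA]; exists N => // k /= Nk.
by apply: NA => /=; rewrite (leq_trans Nk).
Qed.

(** The selection [phi] need not be monotone: [k <= phi k] is enough for limits
    to be inherited ([subseq_cvg]). *)
Lemma bounded_subsequence n (x : nat -> 'rV[R]_n) (M : R) :
  (forall k, `|x k| <= M) ->
  exists (phi : nat -> nat) (l : 'rV[R]_n),
    (forall k, (k <= phi k)%N) /\ x (phi k) @[k --> \oo] --> l.
Proof.
move=> xM; pose A := [set v : 'rV[R]_n | `|v| <= M].
have cA : compact A.
  apply: bounded_closed_compact.
    by exists M; split; [exact: num_real|move=> y My v /= /le_trans; apply; exact: ltW].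
  rewrite (_ : A = (fun v : 'rV[R]_n => `|v|) @^-1` [set y | y <= M])//.
  apply: preimage_closed; last exact: closed_le.
  by move=> v _; exact: norm_continuous.
have xA : (x @ \oo) A by exists 0%N => // k _; exact: xM.
have [l [_ cl]] := cA (x @ \oo) _ xA.
have P k : exists j, (k <= j)%N /\ `|x j - l| <= k.+1%:R^-1.
  have k0 : 0 < (k.+1%:R^-1 : R) by rewrite invr_gt0.
  have [] := cl (x @` [set j | (k <= j)%N]) (ball l k.+1%:R^-1).
  - by exists k => // j kj; exists j.
  - exact: nbhsx_ballx.
  - move=> _ [[j kj <-]]; rewrite -ball_normE /= => lj; exists j.
    by rewrite distrC ltW.
have [phi phiP] := choice P.
exists phi, l; split=> [k|]; first by case: (phiP k).
by apply: cvg_of_harmonic => k; case: (phiP k).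
Qed.

Lemma constant_subsequence (T : finType) (f : nat -> T) :
  exists (t : T) (phi : nat -> nat),
    (forall k, (k <= phi k)%N) /\ (forall k, f (phi k) = t).
Proof.
apply: contrapT => H.
have P t : exists N, forall k, (N <= k)%N -> f k <> t.
  apply: contrapT => Nt; apply: H; exists t.
  have Q k : exists j, (k <= j)%N /\ f j = t.
    apply: contrapT => Nk; apply: Nt; exists k => j kj fj.
    by apply: Nk; exists j.
  have [phi phiP] := choice Q.
  by exists phi; split=> k; case: (phiP k).
have [N NP] := choice P.
apply: (NP (f (\max_t N t)%N) (\max_t N t)%N) => //.
exact: (leq_bigmax (f (\max_t N t)%N)).
Qed.

Lemma min_attained n (S : set 'rV[R]_n) (f : 'rV[R]_n -> R) (M : R) :
  S !=set0 -> closed S -> (forall x, S x -> `|x| <= M) -> continuous f ->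
  exists2 x, S x & forall y, S y -> f x <= f y.
Proof.
move=> S0 cS SM cf.
have [||c cS' cmin] := EVT_min_rV S0 (f := f).
- apply: bounded_closed_compact => //.
  exists M; split; first exact: num_real.
  by move=> y My v /SM /le_trans; apply; exact: ltW.
- exact: continuous_subspaceT.
- by exists c; [exact: set_mem|move=> y Sy; apply: cmin; exact: mem_set].
Qed.

(** First-order condition for a point nearest to the origin on a segment. *)
Lemma nearest_dot_le0 n (e d : 'rV[R]_n) :
  (forall t : R, 0 < t -> t <= 1 ->
     dot e e <= dot (e - t *: d) (e - t *: d)) -> dot e d <= 0.
Proof.
move=> H; rewrite leNgt; apply/negP => ed.
pose t := Num.min 1 (dot e d / (dot d d + 1)).
have d1 : 0 < dot d d + 1 by rewrite ltr_wpDl ?dot_ge0.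
have t0 : 0 < t by rewrite lt_min ltr01 divr_gt0.
have t1 : t <= 1 by rewrite ge_min lexx.
have td : t * (dot d d + 1) <= dot e d by rewrite -ler_pdivlMr// ge_min lexx orbT.
have := H t t0 t1; rewrite !dotlin (dotC d e).
have : 0 <= dot d d by exact: dot_ge0.
nra.
Qed.

(** Otherwise normalised difference vectors would accumulate at a tangent having
    a product at least [e] with the normal [v]. *)
Lemma normal_cone_frechet n (Omega : set 'rV[R]_n) z v (e : R) :
  normal_cone Omega z v -> 0 < e ->
  \forall z' \near z, Omega z' -> dot v (z' - z) <= e * `|z' - z|.
Proof.
move=> [Oz Nv] e0; apply: contrapT => H.
have P k : exists z', [/\ `|z' - z| <= k.+1%:R^-1, Omega z' &
    e * `|z' - z| < dot v (z' - z)].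
  have k0 : 0 < (k.+1%:R^-1 : R) by rewrite invr_gt0.
  apply: contrapT => Nk; apply: H.
  apply: filterS (nbhsx_ballx z _ k0) => z'; rewrite -ball_normE /= => zz' Oz'.
  rewrite leNgt; apply/negP => lt; apply: Nk; exists z'; split => //.
  by rewrite distrC ltW.
have [x xP] := choice P.
have x0 k : 0 < `|x k - z|.
  rewrite normr_gt0; case: (xP k) => _ _; apply: contraTneq => ->.
  by rewrite normr0 mulr0 dot0r ltxx.
pose u k := `|x k - z|^-1 *: (x k - z).
have u1 k : `|u k| <= 1.
  by rewrite normrZ gtr0_norm ?invr_gt0// mulVf// gt_eqF.
have [phi [l [phik ul]]] := bounded_subsequence u1.
have /Nv : tangent_cone Omega z l.
  split=> //; exists (u \o phi), (fun k => `|x (phi k) - z|); split => //.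
  - have : (fun k => `|x k - z|) @ \oo --> (0 : R).
      rewrite -[0 in X in _ --> X](@normr0 _ 'rV[R]_n); apply: cvg_norm.
      by apply: cvg_of_harmonic => k; rewrite subr0; case: (xP k).
    exact: (@subseq_cvg _ (fun k => `|x k - z|)).
  - move=> k /=; rewrite scalerA divff ?gt_eqF// scale1r addrC subrK.
    by case: (xP (phi k)).
apply/negP; rewrite -ltNge (lt_le_trans e0)//.
rewrite -lerN2; apply: (@lim_le _ (fun k => - dot v (u (phi k)))).
  by apply: cvgN; apply: cvg_dot => //; exact: cvg_cst.
move=> k; rewrite lerN2 dotZr ler_pdivlMl// mulrC ltW//.
by case: (xP (phi k)).
Qed.

End Sequences.

Section Differentials.
Context {R : realType} {U V : normedModType R}.

Lemma diff_bound (f : U -> V) x (e : R) : differentiable f x -> 0 < e ->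
  \forall h \near (0 : U), `|f (x + h) - f x - 'd f x h| <= e * `|h|.
Proof.
move=> df e0; have /diff_locallyP[_ /eqaddoP /(_ e e0)] := df.
apply: filterS => h; rewrite [X in `|X|](_ : _ = f (x + h) - f x - 'd f x h)//.
rewrite -[LHS]/(f (h + x) - (f x + 'd f x h)).
by rewrite opprD addrA [h + x]addrC.
Qed.

(** Difference quotients along a convergent sequence of directions; [d] is the
    differential of [f] at [x]. *)
Lemma diff_seq (f : U -> V) (d : U -> V) x (t : nat -> R) (u : nat -> U) (l : U) :
  (forall e : R, 0 < e ->
     \forall h \near (0 : U), `|f (x + h) - f x - d h| <= e * `|h|) ->
  (forall k v, d (k *: v) = k *: d v) ->
  d (u k) @[k --> \oo] --> d l ->
  (forall k, 0 < t k) -> t @ \oo --> (0 : R) -> u @ \oo --> l ->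
  (t k)^-1 *: (f (x + t k *: u k) - f x) @[k --> \oo] --> d l.
Proof.
move=> fd dZ du t0 tl ul.
have tu0 : t k *: u k @[k --> \oo] --> (0 : U).
  by rewrite -(scale0r l); apply: cvgZ.
suff : (t k)^-1 *: (f (x + t k *: u k) - f x) - d (u k) @[k --> \oo]
    --> (0 : V).
  move=> /(cvgD du); rewrite addr0; apply: cvg_trans.
  by apply: near_eq_cvg; apply: nearW => k /=; rewrite addrC subrK.
apply/cvgrPdist_le => e e0.
have [M M0 uM] : exists2 M : R, 0 < M & \forall k \near \oo, `|u k| <= M.
  exists (`|l| + 1); first by rewrite ltr_pwDr.
  move/cvgr_dist_le: ul => /(_ 1 ltr01); apply: filterS => k lu.
  rewrite -[u k](subrK l) (le_trans (ler_normD _ _))// addrC lerD2l.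
  by rewrite distrC.
have eM : 0 < e / M by rewrite divr_gt0.
have tub : \forall k \near \oo, `|f (x + t k *: u k) - f x - d (t k *: u k)|
    <= (e / M) * `|t k *: u k|.
  exact: (tu0 _ (fd _ eM)).
near=> k; rewrite sub0r normrN.
have -> : (t k)^-1 *: (f (x + t k *: u k) - f x) - d (u k) =
    (t k)^-1 *: (f (x + t k *: u k) - f x - d (t k *: u k)).
  by rewrite dZ [RHS]scalerBr scalerA mulVf ?gt_eqF// scale1r.
rewrite normrZ gtr0_norm ?invr_gt0// ler_pdivrMl//.
have /le_trans -> // : `|f (x + t k *: u k) - f x - d (t k *: u k)|
    <= (e / M) * `|t k *: u k| by near: k.
rewrite normrZ (gtr0_norm (t0 k)) mulrCA (ler_wpM2l (ltW (t0 k)))//.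
rewrite mulrAC ler_pdivrMr// (ler_wpM2l (ltW e0))//.
by near: k.
Unshelve. all: end_near. Qed.

End Differentials.

Section SmallSteps.
Context {R : realType}.

Lemma near_scale_lt (V : normedModType R) (w : V) (r : R) : 0 < r ->
  \forall t \near (0 : R)^'+, `|t *: w| < r.
Proof.
move=> r0; have w1 : 0 < `|w| + 1 by rewrite ltr_wpDl.
near=> t.
have t0 : 0 < t by near: t; exact: nbhs_right_gt.
have : t < r / (`|w| + 1) by near: t; apply: nbhs_right_lt; exact: divr_gt0.
rewrite ltr_pdivlMr// => tr; rewrite normrZ gtr0_norm//; apply: le_lt_trans tr.
by rewrite ler_wpM2l ?(ltW t0)// lerDl.
Unshelve. all: end_near. Qed.

Lemma near_scale (V : normedModType R) (w : V) (A : set V) :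
  (\forall h \near (0 : V), A h) -> \forall t \near (0 : R)^'+, A (t *: w).
Proof.
move=> /nbhs_ballP[r /= r0 rA]; apply: filterS (near_scale_lt w r0) => t tr.
by apply: rA; rewrite -ball_normE /= sub0r normrN.
Qed.

Lemma nbhs_norm (V : normedModType R) (z : V) (A : set V) :
  (\forall x \near z, A x) ->
  exists2 r : R, 0 < r & forall x, `|x - z| < r -> A x.
Proof.
move=> /nbhs_ballP[r /= r0 rA]; exists r => // x xz.
by apply: rA; rewrite -ball_normE /= distrC.
Qed.

Lemma le_eps (x y K : R) : 0 <= K ->
  (forall e : R, 0 < e -> e <= 1 -> x <= y + e * K) -> x <= y.
Proof.
move=> K0 H; apply/ler_addgt0Pr => e e0.
have K1 : 0 < K + 1 by rewrite ltr_wpDl.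
pose e' := Num.min 1 (e / (K + 1)).
have e'0 : 0 < e' by rewrite lt_min ltr01 divr_gt0.
have e'1 : e' <= 1 by rewrite ge_min lexx.
have e'K : e' * (K + 1) <= e by rewrite -ler_pdivlMr// ge_min lexx orbT.
apply: le_trans (H _ e'0 e'1) _; rewrite lerD2l.
by apply: le_trans e'K; rewrite ler_wpM2l ?(ltW e'0)// lerDl.
Qed.

End SmallSteps.

Section Taylor.
Context {R : realType} {m s : nat}.
Variable g : 'rV[R]_m -> 'rV[R]_s.
Hypothesis dg : forall x, differentiable g x.

Lemma diff_jacobian x v : 'd g x v = v *m jacobian g x.
Proof. by rewrite -deriveE// deriveEjacobian. Qed.

Lemma is_derive_line (y c : 'rV[R]_m) (t : R) j :
  is_derive t 1 (fun t : R => g (y + t *: c) 0 j)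
    ((c *m jacobian g (y + t *: c)) 0 j).
Proof.
have dv : derivable g (y + t *: c) c by exact: diff_derivable.
have E : (fun h : R => h^-1 *: (((fun t : R => g (y + t *: c) 0 j) \o shift t)
      (h *: (1 : R)) - g (y + t *: c) 0 j)) =
    (fun h : R => h^-1 *: (((fun z => g z 0 j) \o shift (y + t *: c)) (h *: c) -
      g (y + t *: c) 0 j)).
  apply/funext => h /=; congr (_ *: (g _ 0 j - _)).
  by rewrite [h *: 1]mulr1 scalerDl addrCA.
split.
  by rewrite /derivable E; move/derivable_mxP: dv => /(_ 0 j).
rewrite -deriveEjacobian// derive_mx// mxE /derive.
exact: (f_equal (fun F => lim (F @ 0^')) E).
Qed.

End Taylor.

(** The differentiability used below: [g] is differentiable with Jacobian [J]
    (acting on rows from the right), and [L] is the differential of [J] at the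
    single point [y]. *)
Record twice_diff (R : realType) m s (g : 'rV[R]_m -> 'rV[R]_s)
    (J L : 'rV[R]_m -> 'M[R]_(m, s)) (y : 'rV[R]_m) : Prop := TwiceDiff {
  td_line : forall (z c : 'rV[R]_m) (t : R) j,
    is_derive t (1 : R) (fun t : R => g (z + t *: c) 0 j)
      ((c *m J (z + t *: c)) 0 j);
  td_first : forall (z : 'rV[R]_m) (e : R), 0 < e ->
    \forall h \near (0 : 'rV[R]_m), `|g (z + h) - g z - h *m J z| <= e * `|h|;
  td_D : forall u v, L (u + v) = L u + L v;
  td_Z : forall k u, L (k *: u) = k *: L u;
  td_bound : exists2 K : R, 0 < K & forall u, `|L u| <= K * `|u|;
  td_second : forall e : R, 0 < e ->
    \forall h \near (0 : 'rV[R]_m), `|J (y + h) - J y - L h| <= e * `|h| }.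

Section Taylor2.
Context {R : realType} {m s : nat}.
Variables (g : 'rV[R]_m -> 'rV[R]_s) (J L : 'rV[R]_m -> 'M[R]_(m, s)).
Variable y : 'rV[R]_m.
Hypothesis gJL : twice_diff g J L y.

(** The expansion is centred at [y + a], but expressed by the derivatives at [y];
    its error is small relative to [|c| (|a| + |c|)], hence negligible when [a] is
    of order [t] and [c] of order [o(t)]. The mean value theorem is applied to
    [g] minus its expansion along the segment from [y + a] to [y + a + c]. *)
Lemma taylor2 (e : R) : 0 < e ->
  exists2 delta : R, 0 < delta &
    forall a c : 'rV[R]_m, `|a| <= delta -> `|c| <= delta ->
    `|g (y + a + c) - g (y + a) - c *m J y - c *m L a - 2^-1 *: (c *m L c)| <=
    e * `|c| * (`|a| + `|c|).
Proof.
move=> e0; pose e' := e / m.+1%:R.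
have e'0 : 0 < e' by rewrite divr_gt0.
have /nbhs_ballP[r /= r0 rP] := td_second gJL e'0.
exists (r / 4); first by rewrite divr_gt0.
move=> a c ar cr; apply: norm_le_coord.
  by rewrite !mulr_ge0 ?addr_ge0// ltW.
move=> i j; rewrite {i}(ord1 i).
set v1 := c *m J y; set v2 := c *m L a; set v3 := c *m L c.
pose phi (t : R) : R :=
  g (y + a + t *: c) 0 j - v1 0 j * t - v2 0 j * t - 2^-1 * v3 0 j * t ^+ 2.
pose dphi (t : R) : R := (c *m J (y + a + t *: c) - v1 - v2 - t *: v3) 0 j.
have dphiP (t : R) : is_derive t (1 : R) phi (dphi t).
  have H1 := td_line gJL (y + a) c t j.
  have H := is_deriveB (is_deriveB (is_deriveB H1
    (is_deriveZ (v1 0 j) (is_derive_id t 1)))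
    (is_deriveZ (v2 0 j) (is_derive_id t 1)))
    (is_deriveZ (2^-1 * v3 0 j) (is_deriveX 2 (is_derive_id t 1))).
  have -> : dphi t = (c *m J (y + a + t *: c)) 0 j - v1 0 j *: 1 - v2 0 j *: 1 -
      (2^-1 * v3 0 j) *: ((2%:R * t ^+ 1) *: 1).
    rewrite /dphi; move: (c *m J (y + a + t *: c)) (v1) (v2) (v3) => w w1 w2 w3.
    by rewrite !mxE /GRing.scale/= expr1; field.
  by apply: (eq_ind _ (fun f : R -> R => is_derive t 1 f _) H); apply/funext => u.
have [t t01 E] : exists2 t, t \in `[0, 1]%R & phi 1 - phi 0 = dphi t * (1 - 0).
  apply: MVT_segment => //.
  apply: derivable_within_continuous => t _.
  by have [] := dphiP t.
have -> : (g (y + a + c) - g (y + a) - v1 - v2 - 2^-1 *: v3) 0 j = phi 1 - phi 0.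
  rewrite /phi scale0r addr0 scale1r; move: (v1) (v2) (v3) => w1 w2 w3.
  by rewrite !mxE; ring.
rewrite E subr0 mulr1 /dphi.
have -> : c *m J (y + a + t *: c) - v1 - v2 - t *: v3 =
    c *m (J (y + a + t *: c) - J y - L (a + t *: c)).
  by rewrite (td_D gJL) (td_Z gJL) !mulmxBr mulmxDr -scalemxAr opprD addrA.
have t0 : 0 <= t by move: t01; rewrite in_itv/= => /andP[].
have t1 : t <= 1 by move: t01; rewrite in_itv/= => /andP[].
have tc : `|t *: c| <= `|c| by rewrite normrZ ger0_norm// ler_piMl.
have ac : `|a + t *: c| <= `|a| + `|c|.
  by rewrite (le_trans (ler_normD _ _))// lerD2l.
have br : ball (0 : 'rV[R]_m) r (a + t *: c).
  rewrite -ball_normE /= sub0r normrN (le_lt_trans ac)//.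
  by move: r0 ar cr; lra.
have := rP _ br; rewrite [y + (_ + _)]addrA => H.
rewrite (le_trans (coord_le_norm _ _ _))// (le_trans (norm_mulmx _ _))//.
rewrite -[leRHS]mulrA.
have e'm : m%:R * e' <= e.
  rewrite /e' mulrCA -[leRHS]mulr1 ler_wpM2l ?(ltW e0)//.
  by rewrite ler_pdivrMr// mul1r ler_nat.
rewrite mulrCA [leRHS]mulrCA ler_wpM2l//.
apply: (@le_trans _ _ (m%:R * (e' * (`|a| + `|c|)))).
  rewrite ler_wpM2l//; apply: le_trans H _.
  by rewrite ler_wpM2l ?(ltW e'0).
by rewrite mulrA ler_wpM2r ?addr_ge0.
Qed.

End Taylor2.

(** * Normal vectors and bounded multipliers *)

Section Moreau.
Context {R : realType} {s : nat}.

Lemma eucl_norm_continuous k : continuous (@eucl_norm R k).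
Proof.
move=> x; apply: (@continuous_comp _ _ _ (fun y => dot y y) Num.sqrt).
  exact: (@cvg_dot _ _ (nbhs x) _ id id x x _ cvg_id cvg_id).
exact: sqrt_continuous.
Qed.

Lemma eucl_dist_continuous k (y : 'rV[R]_k) :
  continuous (fun v : 'rV[R]_k => eucl_norm (y - v)).
Proof.
move=> v; apply: (@continuous_comp _ _ _ (fun v : 'rV[R]_k => y - v) (@eucl_norm R k)).
  exact: (@cvgB _ _ _ (nbhs v) _ (fun=> y) id y v (cvg_cst _) cvg_id).
exact: eucl_norm_continuous.
Qed.

(** Moreau's decomposition: [y - u] is the point of the cone nearest to [y]. *)
Lemma moreau (G : seq 'rV[R]_s) (y : 'rV[R]_s) : exists u,
  [/\ {in G, forall b, dot b u <= 0}, dot (y - u) u = 0 & fcone G (y - u)].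
Proof.
pose S := [set v | fcone G v /\ eucl_norm (y - v) <= eucl_norm y].
have y_sub v : eucl_norm (y - v) ^+ 2 = dot (y - v) (y - v) by exact: sqr_eucl_norm.
have [v [Gv vy] vmin] : exists2 v, S v & forall v', S v' ->
    eucl_norm (y - v) <= eucl_norm (y - v').
  apply: (@min_attained _ _ S (fun v => eucl_norm (y - v))
    (eucl_norm y + eucl_norm y)).
  - by exists 0; split; [exact: fcone0|rewrite subr0].
  - apply: closedI; first exact: closed_fcone.
    apply: (@preimage_closed _ _ (fun v : 'rV[R]_s => eucl_norm (y - v))
      [set r : R | r <= eucl_norm y]).
      by move=> v _; exact: eucl_dist_continuous.
    exact: closed_le.
  - move=> v [_ vy]; rewrite -[v](subKr y) (le_trans (ler_normB _ _))// lerD//.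
      exact: norm_le_eucl.
    by rewrite (le_trans (norm_le_eucl _)).
  - exact: eucl_dist_continuous.
have {}vmin v' : fcone G v' -> dot (y - v) (y - v) <= dot (y - v') (y - v').
  move=> Gv'; rewrite -!sqr_eucl_norm ler_sqr ?nnegrE ?eucl_norm_ge0//.
  have [yv'|/ltW yv'] := leP (eucl_norm (y - v')) (eucl_norm y).
    exact: vmin.
  exact: le_trans yv'.
have dir d : (forall t : R, 0 < t -> t <= 1 -> fcone G (v + t *: d)) ->
    dot (y - v) d <= 0.
  move=> Gd; apply: nearest_dot_le0 => t t0 t1.
  by rewrite -addrA -opprD; apply: vmin; exact: Gd.
exists (y - v); rewrite subKr; split => //.
  move=> b bG; rewrite dotC; apply: dir => t t0 _; apply: fconeD => //.
  by apply: fconeZ; [exact: ltW|exact: fcone_mem].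
apply/eqP; rewrite eq_le dotC dir/=; last first.
  by move=> t t0 _; apply: fconeD => //; apply: fconeZ => //; exact: ltW.
rewrite -oppr_le0 -dotNr dir// => t t0 t1.
by rewrite scalerN -{1}[v]scale1r -scalerBl; apply: fconeZ; rewrite // subr_ge0.
Qed.

End Moreau.

Section Multipliers.
Context {R : realType} {n s p : nat}.
Variables (a : 'I_p -> 'rV[R]_s) (c : 'I_p -> R).
Variables (f : 'rV[R]_n -> 'rV[R]_s) (B : 'M[R]_(n, s)) (z : 'rV[R]_n).
Let D := halfspaces a c.
Let Omega := [set x | D (f x)].
Hypothesis fB : forall e : R, 0 < e ->
  \forall h \near (0 : 'rV[R]_n), `|f (z + h) - f z - h *m B| <= e * `|h|.
Hypothesis Oz : Omega z.

Lemma diff_seq_mx (t : nat -> R) (u : nat -> 'rV[R]_n) (l : 'rV[R]_n) :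
  (forall k, 0 < t k) -> t @ \oo --> (0 : R) -> u @ \oo --> l ->
  (t k)^-1 *: (f (z + t k *: u k) - f z) @[k --> \oo] --> l *m B.
Proof.
move=> t0 tl ul; apply: (@diff_seq R _ _ f (mulmxr B)) => //.
  by move=> k v; rewrite /= -scalemxAl.
by apply: cvg_mulmx => //; exact: cvg_cst.
Qed.

(** [B] maps the tangents of [Omega] to tangents of [D], on which [lam] is
    nonpositive. *)
Lemma multiplier_normal lam :
  fcone (gens a (active a c (f z))) lam -> normal_cone Omega z (lam *m B^T).
Proof.
move=> Nlam; split=> // u [_ [uk [tk [uku tk0 tk1 Otk]]]].
rewrite dot_mulmx trmxK.
apply: (@lim_le _ (fun k => dot lam ((tk k)^-1 *: (f (z + tk k *: uk k) - f z)))).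
  by apply: cvg_dot; [exact: cvg_cst|exact: diff_seq_mx].
move=> k; rewrite dotZr pmulr_rle0 ?invr_gt0//.
exact: normal_halfspaces_le (Otk k) _ Nlam.
Qed.

Variable kappa : R.
Hypothesis kappa0 : 0 < kappa.
Hypothesis reg : \forall x \near z,
  (setdist x Omega <= kappa%:E * setdist (f x) D)%E.

(** The estimate [reg] passes to the linearised constraints: for small [t], the
    point [z + t w] is at distance at most about [kappa t |w B - u|] from
    a feasible point, and [xs] is nonpositive, up to [o(t)], on the step from [z]
    to this feasible point. *)
Lemma normal_dot_le xs w u : normal_cone Omega z xs ->
  (forall j, j \in active a c (f z) -> dot (a j) u <= 0) ->
  dot xs w <= kappa * eucl_norm xs * eucl_norm (w *m B - u).
Proof.
move=> Nxs Tu; set q := eucl_norm (w *m B - u).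
have q0 : 0 <= q := eucl_norm_ge0 _.
pose X := eucl_norm xs.
have X0 : 0 <= X := eucl_norm_ge0 _.
have k0 := ltW kappa0.
pose K : R := `|w| + kappa * (q + 1) + 1 + X * (kappa + 1).
apply: (@le_eps _ _ _ K).
  by rewrite !addr_ge0// mulr_ge0// addr_ge0.
move=> e e0 e1.
pose C : R := (s%:R * `|w| + 1)%R.
have C0 : 0 < C by rewrite ltr_wpDl.
have eC : 0 < e / C by rewrite divr_gt0.
have [r r0 rP] := nbhs_norm (normal_cone_frechet Nxs e0).
have Df := halfspaces_feasible Oz Tu.
pose Q := `|w| + kappa * (q + e) + e.
have /filter_ex[t [t0 tQ Dt ft rt]] : \forall t \near (0 : R)^'+,
    [/\ 0 < t, t * Q < r, D (f z + t *: u),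
        `|f (z + t *: w) - f z - (t *: w) *m B| <= (e / C) * `|t *: w| &
        (setdist (z + t *: w) Omega <= kappa%:E * setdist (f (z + t *: w)) D)%E].
  have reg0 : \forall h \near (0 : 'rV[R]_n),
      (setdist (z + h) Omega <= kappa%:E * setdist (f (z + h)) D)%E.
    have [r' r'0 r'P] := nbhs_norm reg.
    apply/nbhs_ballP; exists r' => //= h; rewrite -ball_normE /= sub0r normrN => hr.
    by apply: r'P; rewrite addrC addKr.
  have H1 := near_scale w (fB eC).
  have H2 := near_scale w reg0.
  have H3 := near_scale_lt (Q : R^o) r0.
  near=> t; split.
  - by near: t; exact: nbhs_right_gt.
  - by apply: le_lt_trans (ler_norm _) _; near: t.
  - by near: t.
  - by near: t.
  - by near: t.
have ef : eucl_norm (f (z + t *: w) - (f z + t *: u)) <= t * (q + e).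
  have -> : f (z + t *: w) - (f z + t *: u) =
      t *: (w *m B - u) + (f (z + t *: w) - f z - (t *: w) *m B).
    rewrite -scalemxAl scalerBr opprD addrA.
    move: (f (z + _)) (f z) (w *m B) => v1 v2 v3.
    by apply/rowP => i; rewrite !mxE; ring.
  rewrite (le_trans (eucl_normD _ _))// eucl_normZ gtr0_norm// mulrDr lerD2l.
  rewrite (le_trans (eucl_le_norm _))//.
  rewrite (le_trans (ler_wpM2l (ler0n _ _) ft))//.
  rewrite normrZ gtr0_norm// [leLHS](_ : _ = t * (e * (s%:R * `|w| / C))).
    rewrite ler_wpM2l ?(ltW t0)// ler_piMr ?(ltW e0)//.
    by rewrite ler_pdivrMr// mul1r lerDl.
  by field; rewrite gt_eqF.
have [z' Oz' zz'] : exists2 z', Omega z' &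
    eucl_norm (z + t *: w - z') < t * (kappa * (q + e) + e).
  apply: setdist_lt_ex; apply: le_lt_trans rt _.
  apply: (@le_lt_trans _ _ (kappa * (t * (q + e)))%:E).
    rewrite EFinM lee_pmul2l//.
    exact: setdist_le Dt ef.
  by rewrite lte_fin mulrCA ltr_pM2l// ltrDl.
have z'z : `|z' - z| <= t * Q.
  have -> : z' - z = t *: w - (z + t *: w - z').
    by apply/rowP => i; rewrite !mxE; ring.
  rewrite (le_trans (ler_normB _ _))// normrZ gtr0_norm//.
  rewrite [leRHS](_ : _ = t * `|w| + t * (kappa * (q + e) + e)); last by rewrite /Q; ring.
  by rewrite lerD2l (le_trans (norm_le_eucl _))// ltW.
have H1 := rP z' (le_lt_trans z'z tQ) Oz'.
have H2 := cauchy_schwarz xs (z + t *: w - z').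
have H3 : t * dot xs w = dot xs (z' - z) + dot xs (z + t *: w - z').
  by rewrite -dotDr -dotZr; congr dot; apply/rowP => i; rewrite !mxE; ring.
rewrite -(ler_pM2l t0) H3; apply: (@le_trans _ _
    (e * (t * Q) + X * (t * (kappa * (q + e) + e)))).
  apply: lerD.
    by apply: le_trans H1 _; rewrite ler_wpM2l ?(ltW e0).
  by apply: le_trans H2 _; rewrite ler_wpM2l// ltW.
rewrite [leLHS](_ : _ = t * (e * Q + X * (kappa * (q + e) + e))); last by ring.
rewrite ler_wpM2l ?(ltW t0)//.
have QK : e * Q <= e * (`|w| + kappa * (q + 1) + 1).
  by rewrite ler_wpM2l ?(ltW e0)// !lerD// ler_wpM2l// lerD2l.
rewrite [leRHS](_ : _ =
  e * (`|w| + kappa * (q + 1) + 1) + X * (kappa * (q + e) + e)).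
  by rewrite lerD2r.
by rewrite /K /X; ring.
Unshelve. all: end_near. Qed.

(** The vectors [lam *m B^T], with [lam] normal to [D] and
    [|lam| <= kappa |xs|], form a compact convex set. The residual [w] of the
    nearest point to [xs] in this set would separate [xs] from it, against
    [normal_dot_le] applied to [w] and to the projection [u] of [w *m B] to the
    tangent cone of [D]. *)
Lemma normal_multiplier xs : normal_cone Omega z xs ->
  exists lam, [/\ fcone (gens a (active a c (f z))) lam, lam *m B^T = xs &
    eucl_norm lam <= kappa * eucl_norm xs].
Proof.
move=> Nxs; set G := gens a _; pose r := kappa * eucl_norm xs.
have r0 : 0 <= r by rewrite mulr_ge0 ?eucl_norm_ge0// ltW.
pose S := [set lam : 'rV[R]_s | fcone G lam /\ eucl_norm lam <= r].
pose F lam := dot (xs - lam *m B^T) (xs - lam *m B^T).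
have [lam0 [Glam0 rlam0] lam0min] : exists2 lam, S lam &
    forall lam', S lam' -> F lam <= F lam'.
  apply: (@min_attained _ _ S F r).
  - by exists 0; split; [exact: fcone0|rewrite eucl_norm0].
  - apply: closedI; first exact: closed_fcone.
    apply: (@preimage_closed _ _ (@eucl_norm R s) [set x | x <= r]).
      by move=> x _; exact: eucl_norm_continuous.
    exact: closed_le.
  - by move=> x [_]; exact/le_trans/norm_le_eucl.
  - move=> x.
    have FC : (fun y => xs - y *m B^T) @ nbhs x --> xs - x *m B^T.
      apply: cvgB; first exact: cvg_cst.
      exact: (@cvg_mulmx _ _ (nbhs x) _ _ _ id (fun=> B^T) x _ _ cvg_id (cvg_cst _)).
    by apply: (@cvg_dot _ _ (nbhs x) _ (fun y => xs - y *m B^T) (fun y => xs - y *m B^T)).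
exists lam0; split => //.
pose w := xs - lam0 *m B^T.
suff : dot w w <= 0.
  rewrite -sqr_eucl_norm => w0; apply/esym/eqP; rewrite -subr_eq0; apply/eqP.
  apply: eucl_norm0_eq0; apply/eqP; rewrite -sqrf_eq0 eq_le w0.
  by rewrite sqr_ge0.
have S_le lam : S lam -> dot lam (w *m B) <= dot lam0 (w *m B).
  move=> [Glam rlam]; rewrite -subr_le0 -dotBl dotC dot_mulmx.
  apply: nearest_dot_le0 => t t0 t1.
  have := lam0min ((1 - t) *: lam0 + t *: lam); rewrite /F.
  have -> : xs - ((1 - t) *: lam0 + t *: lam) *m B^T =
      w - t *: ((lam - lam0) *m B^T).
    rewrite /w -addrA -opprD; congr (_ - _).
    rewrite scalemxAl -mulmxDl; congr (_ *m _).
    by rewrite scalerBl scale1r scalerBr addrAC addrA.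
  apply; have t1' : 0 <= 1 - t by rewrite subr_ge0.
  split; first by apply: fconeD; apply: fconeZ => //; exact: ltW.
  rewrite (le_trans (eucl_normD _ _))// !eucl_normZ (ger0_norm t1') gtr0_norm//.
  rewrite [leRHS](_ : _ = (1 - t) * r + t * r); last by ring.
  by apply: lerD; rewrite ler_wpM2l// ltW.
have [u [Tu vu Gv]] := moreau G (w *m B).
set v := w *m B - u in vu Gv.
have rq : r * eucl_norm v <= dot lam0 (w *m B).
  have wBE : w *m B = v + u by rewrite subrK.
  have [v0|v0] := eqVneq (eucl_norm v) 0.
    rewrite v0 mulr0 -(dot0l (w *m B)); apply: S_le.
    by split; [exact: fcone0|rewrite eucl_norm0].
  have {}v0 : 0 < eucl_norm v by rewrite lt_def v0 eucl_norm_ge0.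
  have -> : r * eucl_norm v = dot ((r / eucl_norm v) *: v) (w *m B).
    rewrite dotZl wBE dotDr vu addr0 -sqr_eucl_norm; field.
    by rewrite gt_eqF.
  apply: S_le; split; first by apply: fconeZ; rewrite ?divr_ge0// ltW.
  by rewrite eucl_normZ ger0_norm ?divr_ge0// ?(ltW v0)// divfK// gt_eqF.
have Tu' j : j \in active a c (f z) -> dot (a j) u <= 0.
  by move=> jz; apply: Tu; apply: map_f; rewrite mem_enum.
have := normal_dot_le w Nxs Tu'; rewrite -/v -/r => xw.
have -> : dot w w = dot xs w - dot lam0 (w *m B).
  by rewrite {1}/w dotBl dot_mulmx trmxK.
by rewrite subr_le0; exact: le_trans xw rq.
Qed.

End Multipliers.

(** * Limits of normal vectors *)

Lemma cvg_add_step (R : realType) (V : normedModType R) (t : nat -> R)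
    (u : nat -> V) (x l : V) :
  t @ \oo --> (0 : R) -> u @ \oo --> l -> x + t k *: u k @[k --> \oo] --> x.
Proof.
move=> tl ul; rewrite -[x in X in _ --> X]addr0; apply: cvgD; first exact: cvg_cst.
by rewrite -(scale0r l); apply: cvgZ.
Qed.

Section Quotients.
Context {R : realType} {m s : nat}.
Variables (g : 'rV[R]_m -> 'rV[R]_s) (J L : 'rV[R]_m -> 'M[R]_(m, s)).
Variable y : 'rV[R]_m.
Hypothesis gJL : twice_diff g J L y.

Lemma twice_diff0 : L 0 = 0.
Proof. by rewrite -(scale0r (0 : 'rV[R]_m)) (td_Z gJL) scale0r. Qed.

Lemma twice_diff_cvg T (F : set_system T) (u : T -> 'rV[R]_m) (l : 'rV[R]_m) :
  Filter F -> u @ F --> l -> L (u k) @[k --> F] --> L l.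
Proof.
move=> FF ul; have [K K0 LK] := td_bound gJL.
apply/cvgrPdist_lt => e e0; have eK : 0 < e / K by rewrite divr_gt0.
move/cvgr_dist_lt: ul => /(_ _ eK); apply: filterS => k.
rewrite ltr_pdivlMr// mulrC; apply: le_lt_trans.
by rewrite -scaleN1r -(td_Z gJL) -(td_D gJL) scaleN1r.
Qed.

Variables (t : nat -> R) (u : nat -> 'rV[R]_m) (v : 'rV[R]_m).
Hypothesis t0 : forall k, 0 < t k.
Hypothesis tl : t @ \oo --> (0 : R).
Hypothesis ul : u @ \oo --> v.

Lemma step_cvg0 : t k *: u k @[k --> \oo] --> (0 : 'rV[R]_m).
Proof. by rewrite -(scale0r v); apply: cvgZ. Qed.

Lemma quotient1 : (t k)^-1 *: (g (y + t k *: u k) - g y) @[k --> \oo] --> v *m J y.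
Proof.
apply: (@diff_seq R _ _ g (mulmxr (J y))) => //.
- by move=> e e0; exact: (td_first gJL).
- by move=> k w; rewrite /= -scalemxAl.
- by apply: cvg_mulmx => //; exact: cvg_cst.
Qed.

Lemma quotient_jacobian : (t k)^-1 *: (J (y + t k *: u k) - J y) @[k --> \oo] --> L v.
Proof.
apply: (@diff_seq R _ _ J L) => //.
- exact: (td_second gJL).
- exact: (td_Z gJL).
- exact: twice_diff_cvg.
Qed.

Lemma quotient2 : (t k)^-2 *: (g (y + t k *: u k) - g y - t k *: u k *m J y)
    @[k --> \oo] --> 2^-1 *: (v *m L v).
Proof.
have uLu : 2^-1 *: (u k *m L (u k)) @[k --> \oo] --> 2^-1 *: (v *m L v).
  by apply: cvgZl_tmp; apply: cvg_mulmx => //; exact: twice_diff_cvg.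
suff : (t k)^-2 *: (g (y + t k *: u k) - g y - t k *: u k *m J y) -
    2^-1 *: (u k *m L (u k)) @[k --> \oo] --> (0 : 'rV[R]_s).
  move=> /(cvgD uLu); rewrite addr0; apply: cvg_trans.
  by apply: near_eq_cvg; apply: nearW => k /=; rewrite addrC subrK.
apply/cvgrPdist_le => e e0.
pose M := `|v| + 1.
have M0 : 0 < M by rewrite ltr_wpDl.
have eM : 0 < e / M ^+ 2 by rewrite divr_gt0// exprn_gt0.
have [delta d0 dP] := taylor2 gJL eM.
have tud : \forall k \near \oo, `|t k *: u k| <= delta.
  move/cvgr_dist_le: step_cvg0 => /(_ _ d0); apply: filterS => k.
  by rewrite sub0r normrN.
have uM : \forall k \near \oo, `|u k| <= M.
  move/cvgr_dist_le: ul => /(_ 1 ltr01); apply: filterS => k lu.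
  rewrite -[u k](subrK v) (le_trans (ler_normD _ _))// addrC lerD2l.
  by rewrite distrC.
near=> k; rewrite sub0r normrN.
have tk := t0 k.
have /(dP 0 (t k *: u k)) : `|0 : 'rV[R]_m| <= delta by rewrite normr0 ltW.
have -> : `|t k *: u k| <= delta by near: k.
move=> /(_ isT); rewrite addr0 twice_diff0 mulmx0 subr0 normr0 add0r.
have -> : (t k *: u k) *m L (t k *: u k) = (t k * t k) *: (u k *m L (u k)).
  by rewrite (td_Z gJL) -scalemxAl -scalemxAr scalerA.
set x := g _ - _ - _ => xe.
have -> : (t k)^-2 *: x - 2^-1 *: (u k *m L (u k)) =
    (t k)^-2 *: (x - 2^-1 *: ((t k * t k) *: (u k *m L (u k)))).
  rewrite [RHS]scalerBr; congr (_ - _); rewrite !scalerA; congr (_ *: _).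
  by field; rewrite gt_eqF.
rewrite normrZ ger0_norm ?invr_ge0 ?exprn_ge0 ?(ltW tk)//.
rewrite ler_pdivrMl ?exprn_gt0//; apply: le_trans xe _.
rewrite normrZ gtr0_norm// [leLHS](_ : _ = t k ^+ 2 * (e / M ^+ 2 * `|u k| ^+ 2)).
  rewrite ler_wpM2l ?exprn_ge0 ?(ltW tk)// mulrAC ler_pdivrMr ?exprn_gt0//.
  rewrite ler_wpM2l ?(ltW e0)// lerXn2r ?nnegrE ?(ltW M0)//.
  by near: k.
by ring.
Unshelve. all: end_near. Qed.

End Quotients.

Lemma cvg_dsubmx (R : realType) T (F : set_system T) m n p
    (A : T -> 'M[R]_(m + n, p)) (l : 'M[R]_(m + n, p)) :
  Filter F -> A @ F --> l -> dsubmx (A k) @[k --> F] --> dsubmx l.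
Proof.
move=> FF Al; apply: cvg_mx => i j; rewrite mxE.
by under eq_fun do rewrite mxE; exact: cvg_coord.
Qed.

Section LimitMultiplier.
Context {R : realType} {m n s p : nat}.
Variables (g : 'rV[R]_(m + n) -> 'rV[R]_s).
Variables (J L : 'rV[R]_(m + n) -> 'M[R]_(m + n, s)).
Variables (a : 'I_p -> 'rV[R]_s) (c : 'I_p -> R).
Let D := halfspaces a c.
Variable y : 'rV[R]_(m + n).
Hypothesis gJL : twice_diff g J L y.
Let B z := dsubmx (J z).

(** The maximality is that of the curvature of [dot lam (g _)] along [v], among
    the multipliers with the same image under the adjoint of the full Jacobian. *)
Definition derivative_multiplier (xs : 'rV[R]_n) (v : 'rV[R]_(m + n))
    (lam : 'rV[R]_s) : Prop :=
  [/\ normal_cone D (g y) lam, lam *m (B y)^T = xs,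
    critical_cone D (g y) lam (v *m J y) &
    forall lam', normal_cone D (g y) lam' ->
      lam' *m (J y)^T = lam *m (J y)^T ->
      dot lam' (v *m L v) <= dot lam (v *m L v)].

Variables (t : nat -> R) (u : nat -> 'rV[R]_(m + n)) (v : 'rV[R]_(m + n)).
Variables (x : nat -> 'rV[R]_n) (xs vs : 'rV[R]_n).
Variables (ll : nat -> 'rV[R]_s) (lam : 'rV[R]_s) (S : {set 'I_p}).
Hypothesis t0 : forall k, 0 < t k.
Hypothesis tl : t @ \oo --> (0 : R).
Hypothesis ul : u @ \oo --> v.
Hypothesis xl : x @ \oo --> vs.
Hypothesis lll : ll @ \oo --> lam.
Hypothesis Dy : D (g y).
Hypothesis Dk : forall k, D (g (y + t k *: u k)).
Hypothesis Sk : forall k, active a c (g (y + t k *: u k)) = S.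
Hypothesis llS : forall k, fcone (gens a S) (ll k).
Hypothesis llx : forall k, ll k *m (B (y + t k *: u k))^T = xs + t k *: x k.

(** A constant set [S] of active constraints makes both [ll k] and [lam]
    orthogonal to [g (y + t k *: u k) - g y], and puts all difference quotients
    of multipliers into the same finitely generated cone. *)
Lemma limit_multiplier : derivative_multiplier xs v lam /\
  exists2 eta, normal_cone (critical_cone D (g y) lam) (v *m J y) eta &
    vs = lam *m (dsubmx (L v))^T + eta *m (B y)^T.
Proof.
have q1 := quotient1 gJL t0 tl ul.
have qJ := quotient_jacobian gJL t0 tl ul.
have q2 := quotient2 gJL t0 tl ul.
set q1k := (fun k => _ *: (g _ - g y)) in q1.
have gE k : g (y + t k *: u k) - g y = t k *: q1k k.
  by rewrite scalerA mulfV ?gt_eqF// scale1r.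
have Jl : J (y + t k *: u k) @[k --> \oo] --> J y.
  have -> : (fun k => J (y + t k *: u k)) = (fun k =>
      J y + t k *: ((t k)^-1 *: (J (y + t k *: u k) - J y))).
    apply/funext => k.
    by rewrite scalerA mulfV ?gt_eqF// scale1r [RHS]addrC subrK.
  exact: cvg_add_step qJ.
have gl : g (y + t k *: u k) @[k --> \oo] --> g y.
  have -> : (fun k => g (y + t k *: u k)) = (fun k => g y + t k *: q1k k).
    by apply/funext => k; rewrite -gE [RHS]addrC subrK.
  exact: cvg_add_step q1.
have Sy : S \subset active a c (g y).
  apply/fintype.subsetP => j jS; rewrite inE; apply/eqP.
  apply: (@lim_eq _ (fun k => dot (a j) (g (y + t k *: u k)))).
    by apply: cvg_dot => //; exact: cvg_cst.
  by move=> k; move: jS; rewrite -(Sk k) inE => /eqP.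
have Sq k j : j \in S -> dot (a j) (g (y + t k *: u k) - g y) = 0.
  move=> jS; rewrite dotBr; move/fintype.subsetP: Sy => /(_ _ jS).
  move: jS; rewrite -(Sk k) !inE => /eqP -> /eqP ->.
  by rewrite subrr.
have Sd j : j \in S -> dot (a j) (v *m J y) = 0.
  move=> jS; apply: (@lim_eq _ (fun k => dot (a j) (q1k k))).
    by apply: cvg_dot => //; exact: cvg_cst.
  by move=> k; rewrite dotZr Sq// mulr0.
have Slam : fcone (gens a S) lam by exact: fcone_lim lll llS.
have lamd : dot lam (v *m J y) = 0.
  rewrite dotC; apply: fcone_dot_eq0 Slam.
  by apply/(gensP _ _ (fun b => dot (v *m J y) b = 0)) => j jS; rewrite dotC Sd.
have Ny : normal_cone D (g y) lam.
  by apply/normal_halfspaces; split=> //; exact: fcone_gens_sub Slam.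
have Kd : critical_cone D (g y) lam (v *m J y).
  apply/critical_halfspaces => //; split=> // j jy.
  apply: (@lim_le _ (fun k => dot (a j) (q1k k))).
    by apply: cvg_dot => //; exact: cvg_cst.
  move=> k; rewrite dotZr pmulr_rle0 ?invr_gt0// dotBr subr_le0.
  by move: jy; rewrite inE => /eqP ->; exact: Dk.
have llB : ll k *m (B (y + t k *: u k))^T @[k --> \oo] --> lam *m (B y)^T.
  by apply: cvg_mulmx => //; apply: cvg_trmx; exact: cvg_dsubmx.
have lamxs : lam *m (B y)^T = xs.
  have xk : xs + t k *: x k @[k --> \oo] --> xs by exact: cvg_add_step xl.
  have E : (fun k => ll k *m (B (y + t k *: u k))^T) = (fun k => xs + t k *: x k).
    by apply/funext.
  rewrite E in llB; exact: (cvg_unique (@norm_hausdorff _ _) llB xk).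
split.
  split=> // lam' /normal_halfspaces[_ Nlam'] lamJ.
  (* On [g (y + t k *: u k) - g y], [lam'] is nonpositive and [lam] vanishes; the
     first-order terms agree, which leaves the second-order ones. *)
  rewrite -subr_le0 -dotBl.
  suff : dot (lam' - lam) (2^-1 *: (v *m L v)) <= 0.
    by rewrite dotZr pmulr_rle0 ?invr_gt0.
  have mul : (fun=> lam' - lam) @ \oo --> lam' - lam by exact: cvg_cst.
  apply: (lim_le (cvg_dot _ mul q2)) => k.
  rewrite dotZr pmulr_rle0 ?invr_gt0 ?exprn_gt0//.
  rewrite dotBr -(trmxK (J y)) -dot_mulmx mulmxBl lamJ subrr dot0l subr0.
  rewrite dotBl subr_le0.
  have -> : dot lam (g (y + t k *: u k) - g y) = 0.
    rewrite dotC; apply: fcone_dot_eq0 Slam.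
    by apply/(gensP _ _ (fun b => dot _ b = 0)) => j jS; rewrite dotC Sq.
  exact: normal_halfspaces_le (Dk k) _ Nlam'.
(* The quotients [(ll k - lam) / t k] may be unbounded: only their images under
   [(B y)^T] converge, and the image of the cone is closed. *)
pose zeta := vs - lam *m (dsubmx (L v))^T.
have zl : x k - ll k *m (dsubmx ((t k)^-1 *: (J (y + t k *: u k) - J y)))^T
    @[k --> \oo] --> zeta.
  apply: cvgB => //; apply: cvg_mulmx => //; apply: cvg_trmx.
  exact: cvg_dsubmx.
have [eta Seta zE] : exists2 eta,
    fcone (- lam :: gens a S) eta & zeta = eta *m (B y)^T.
  apply: fcone_map_ex; apply: fcone_lim zl _ => k.
  have -> : x k - ll k *m (dsubmx ((t k)^-1 *: (J (y + t k *: u k) - J y)))^T =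
      ((t k)^-1 *: (ll k - lam)) *m (B y)^T.
    rewrite [dsubmx _]linearZ/= [dsubmx _]linearB/= linearZ/= linearB/=.
    rewrite -scalemxAl -scalemxAr mulmxBr llx mulmxBl lamxs.
    move: (ll k *m _) => w; apply/rowP => i; rewrite !mxE; field.
    by rewrite gt_eqF.
  apply: fcone_map; apply: fconeZ; first by rewrite invr_ge0 ltW.
  by exists 1 => //; rewrite scale1r opprK subrK.
exists eta; first exact: critical_normal_intro Seta.
by rewrite -zE addrC subrK.
Qed.

End LimitMultiplier.

Section ParametricNormalCone.
Context {R : realType} {m n s p : nat}.
Variables (g : 'rV[R]_(m + n) -> 'rV[R]_s).
Variables (J L : 'rV[R]_(m + n) -> 'M[R]_(m + n, s)).
Variables (a : 'I_p -> 'rV[R]_s) (c : 'I_p -> R).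
Let D := halfspaces a c.
Variable y : 'rV[R]_(m + n).
Hypothesis gJL : twice_diff g J L y.
Let B z := dsubmx (J z).

Definition feasible (q : 'rV[R]_m) : set 'rV[R]_n := [set z | D (g (row_mx q z))].

Definition normal_map (z : 'rV[R]_(m + n)) : set 'rV[R]_n :=
  normal_cone (feasible (lsubmx z)) (rsubmx z).

Lemma mul_row0 h (A : 'M[R]_(m + n, s)) :
  row_mx (0 : 'rV[R]_m) h *m A = h *m dsubmx A.
Proof. by rewrite -{1}(vsubmxK A) mul_row_col mul0mx add0r. Qed.

Lemma norm_row0 (h : 'rV[R]_n) : `|row_mx (0 : 'rV[R]_m) h| = `|h|.
Proof.
apply/le_anti/andP; split.
  by rewrite (le_trans (norm_row_mx _ _))// normr0 add0r.
by rewrite -{1}(row_mxKr (0 : 'rV[R]_m) h) norm_rsubmx.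
Qed.

Lemma add_row0 (z : 'rV[R]_(m + n)) h :
  row_mx (lsubmx z) (rsubmx z + h) = z + row_mx 0 h.
Proof. by rewrite -{3}(hsubmxK z) add_row_mx addr0. Qed.

Lemma partial_first z (e : R) : 0 < e -> \forall h \near (0 : 'rV[R]_n),
  `|g (row_mx (lsubmx z) (rsubmx z + h)) - g (row_mx (lsubmx z) (rsubmx z)) -
    h *m B z| <= e * `|h|.
Proof.
move=> e0; have [r r0 rP] := nbhs_norm (td_first gJL z e0).
apply/nbhs_ballP; exists r => //= h; rewrite -ball_normE /= sub0r normrN => hr.
have := rP (row_mx 0 h); rewrite subr0 norm_row0 => /(_ hr).
by rewrite mul_row0 add_row0 hsubmxK.
Qed.

Lemma feasibleE z : feasible (lsubmx z) (rsubmx z) = D (g z).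
Proof. by rewrite /feasible /= hsubmxK. Qed.

Lemma multiplier_normal_map z lam : D (g z) ->
  fcone (gens a (active a c (g z))) lam -> normal_map z (lam *m (B z)^T).
Proof.
move=> Dz Nlam; apply: (multiplier_normal (partial_first z)).
  by rewrite /= hsubmxK.
by rewrite hsubmxK.
Qed.

Variables (kappa r : R).
Hypothesis kappa0 : 0 < kappa.
Hypothesis r0 : 0 < r.
Hypothesis reg : forall z, `|z - y| < r ->
  (setdist (rsubmx z) (feasible (lsubmx z)) <= kappa%:E * setdist (g z) D)%E.

Lemma normal_map_multiplier z x : `|z - y| < r -> normal_map z x ->
  exists lam, [/\ fcone (gens a (active a c (g z))) lam, lam *m (B z)^T = x &
    eucl_norm lam <= kappa * eucl_norm x].
Proof.
move=> zy Nx; have Dz : D (g z) by case: Nx; rewrite feasibleE.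
have zyr : 0 < r - `|z - y| by rewrite subr_gt0.
have regz : \forall x' \near rsubmx z,
    (setdist x' (feasible (lsubmx z)) <=
     kappa%:E * setdist (g (row_mx (lsubmx z) x')) D)%E.
  apply: filterS (nbhsx_ballx (rsubmx z) _ zyr) => x'; rewrite -ball_normE /= => xz.
  have zx : row_mx (lsubmx z) x' = z + row_mx 0 (x' - rsubmx z).
    by rewrite -add_row0 addrC subrK.
  have := reg (z := row_mx (lsubmx z) x'); rewrite row_mxKr row_mxKl; apply.
  rewrite zx addrAC (le_lt_trans (ler_normD _ _))// norm_row0.
  by rewrite -ltrBrDl distrC.
have [|lam] := normal_multiplier (partial_first z) _ kappa0 regz Nx.
  by rewrite /= hsubmxK.
by rewrite hsubmxK; exists lam.
Qed.

Lemma normal_map_derivative xs v vs :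
  tangent_cone (gph normal_map) (row_mx y xs) (row_mx v vs) ->
  exists2 lam, derivative_multiplier g J L a c y xs v lam &
  exists2 eta, normal_cone (critical_cone D (g y) lam) (v *m J y) eta &
    vs = lam *m (dsubmx (L v))^T + eta *m (B y)^T.
Proof.
have gphP z x : gph normal_map (row_mx z x) -> normal_map z x.
  by move=> [[z' x'] /= zx /eq_row_mx[<- <-]].
move=> [/gphP Nxs [w [t [wl t0 tl gw]]]].
pose u k := lsubmx (w k); pose x k := rsubmx (w k).
have ul : u @ \oo --> v.
  apply: cvg_mx => i j; rewrite -(row_mxKl v vs) mxE.
  by under eq_fun do rewrite mxE; exact: cvg_coord.
have xl : x @ \oo --> vs.
  apply: cvg_mx => i j; rewrite -(row_mxKr v vs) mxE.
  by under eq_fun do rewrite mxE; exact: cvg_coord.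
have {}gw k : normal_map (y + t k *: u k) (xs + t k *: x k).
  apply: gphP; have := gw k.
  by rewrite -{1}(hsubmxK (w k)) scale_row_mx add_row_mx.
have [N NP] : exists N, forall k, (N <= k)%N -> `|t k *: u k| < r /\ `|t k *: x k| <= 1.
  have H1 : \forall k \near \oo, `|t k *: u k| < r.
    move/cvgr_dist_lt: (step_cvg0 tl ul) => /(_ _ r0); apply: filterS => k.
    by rewrite sub0r normrN.
  have H2 : \forall k \near \oo, `|t k *: x k| <= 1.
    move/cvgr_dist_le: (step_cvg0 tl xl) => /(_ _ ltr01); apply: filterS => k.
    by rewrite sub0r normrN.
  by have [N _ NP] := filterI H1 H2; exists N => k Nk; exact: NP.
pose K := kappa * (n%:R * (`|xs| + 1)).
have lamP k : exists lam, [/\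
    fcone (gens a (active a c (g (y + t (k + N)%N *: u (k + N)%N)))) lam,
    lam *m (B (y + t (k + N)%N *: u (k + N)%N))^T =
      xs + t (k + N)%N *: x (k + N)%N &
    `|lam| <= K].
  have [tr t1] := NP (k + N)%N (leq_addl _ _).
  have [|lam [lam1 lam2 lam3]] := @normal_map_multiplier _ _ _ (gw (k + N)%N).
    by rewrite addrC addKr.
  exists lam; split => //; apply: le_trans (norm_le_eucl _) _.
  apply: le_trans lam3 _; rewrite ler_pM2l//.
  rewrite (le_trans (eucl_le_norm _))// ler_wpM2l//.
  by rewrite (le_trans (ler_normD _ _))// lerD2l.
have [ll llP] := choice lamP.
have llK k : `|ll k| <= K by case: (llP k).
have [phi [lam [phik phil]]] := bounded_subsequence llK.
have [S [psi [psik psiS]]] := constant_subsequence (fun k =>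
  active a c (g (y + t (phi k + N)%N *: u (phi k + N)%N))).
pose f k := (phi (psi k) + N)%N.
have fk k : (k <= f k)%N.
  rewrite /f (leq_trans (psik k))// (leq_trans (phik _))//.
  by rewrite leq_addr.
have [||||||||k|k|] := @limit_multiplier R m n s p g J L a c y gJL
    (t \o f) (u \o f) v (x \o f) xs vs (ll \o (phi \o psi)) lam S.
- by move=> k; exact: t0.
- exact: subseq_cvg tl.
- exact: subseq_cvg ul.
- exact: subseq_cvg xl.
- exact: (@subseq_cvg _ (ll \o phi)).
- by case: Nxs; rewrite feasibleE.
- by move=> k; have [] := gw (f k); rewrite feasibleE.
- exact: psiS.
- by rewrite -(psiS k); have [] := llP (phi (psi k)).
- by have [] := llP (phi (psi k)).
- by move=> lamP' etaP; exists lam.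
Qed.

End ParametricNormalCone.

(** * Construction of normal vectors in a prescribed direction *)

(** Proximal normals are regular normals: along a tangent sequence, the
    quadratic term is of higher order. *)
Lemma proximal_normal (R : realType) n (Omega : set 'rV[R]_n) (z x : 'rV[R]_n)
    (rho delta : R) : Omega z -> 0 < delta ->
  (forall z', Omega z' -> `|z' - z| < delta ->
     dot x (z' - z) <= rho * dot (z' - z) (z' - z)) ->
  normal_cone Omega z x.
Proof.
move=> Oz d0 H; split=> // u [_ [uk [tk [ul t0 tl Otk]]]].
have step0 : tk k *: uk k @[k --> \oo] --> (0 : 'rV[R]_n) by exact: step_cvg0 ul.
have [N _ NP] : \forall k \near \oo, `|tk k *: uk k| < delta.
  move/cvgr_dist_lt: step0 => /(_ _ d0); apply: filterS => k.
  by rewrite sub0r normrN.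
pose f k := (k + N)%N.
have fk k : (k <= f k)%N by exact: leq_addr.
have l1 : dot x (uk (f k)) @[k --> \oo] --> dot x u.
  by apply: cvg_dot; [exact: cvg_cst|exact: (subseq_cvg fk ul)].
have l2 : rho * dot (tk (f k) *: uk (f k)) (uk (f k)) @[k --> \oo] --> (0 : R).
  rewrite -(mulr0 rho) -(dot0l u); apply: cvgMl_tmp; apply: cvg_dot.
    exact: (subseq_cvg fk step0).
  exact: (subseq_cvg fk ul).
have l3 : dot x (uk (f k)) - rho * dot (tk (f k) *: uk (f k)) (uk (f k))
    @[k --> \oo] --> dot x u.
  by rewrite -[X in _ --> X]subr0; exact: cvgB.
apply: (lim_le l3) => k; rewrite subr_le0.
have := H _ (Otk (f k)); rewrite addrC addKr.
move=> /(_ (NP _ (leq_addl _ _))); by rewrite !dotZr mulrCA ler_pM2l.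
Qed.

Section Construction.
Context {R : realType} {m n s p : nat}.
Variables (g : 'rV[R]_(m + n) -> 'rV[R]_s).
Variables (J L : 'rV[R]_(m + n) -> 'M[R]_(m + n, s)).
Variables (a : 'I_p -> 'rV[R]_s) (c : 'I_p -> R).
Let D := halfspaces a c.
Variable y : 'rV[R]_(m + n).
Hypothesis gJL : twice_diff g J L y.
Let B z := dsubmx (J z).

Variables (v w : 'rV[R]_(m + n)) (d cc : 'rV[R]_s).
Hypothesis dE : d = v *m J y.
Hypothesis ccE : cc = w *m J y + 2^-1 *: (v *m L v).
Let V := `|v| + `|w| + 1.

Let V1 : 1 <= V.
Proof. by rewrite /V lerDr addr_ge0. Qed.

Let V0 : 0 < V. Proof. exact: lt_le_trans V1. Qed.

(** The second-order term compensates the curvature of the constraints in the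
    direction [v]; the relevant [w] is the dual solution of [lp_dual]. *)
Definition parabola (t : R) : 'rV[R]_(m + n) := t *: v + t ^+ 2 *: w.

Lemma norm_parabola t : 0 < t -> t <= 1 -> `|parabola t| <= t * V.
Proof.
move=> t0 t1; rewrite (le_trans (ler_normD _ _))// !normrZ.
rewrite !ger0_norm ?exprn_ge0 ?(ltW t0)//.
rewrite /V !mulrDr mulr1 -addrA lerD2l.
have : t ^+ 2 * `|w| <= t * `|w| by rewrite ler_wpM2r// expr2 ler_piMl// ltW.
by move: t0; lra.
Qed.

Lemma small_t (K e : R) : 0 <= K -> 0 < e ->
  \forall t \near (0 : R)^'+, [/\ 0 < t, t <= 1 & t * K <= e].
Proof.
move=> K0 e0; have K1 : 0 < K + 1 by rewrite ltr_wpDl.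
near=> t; have t0 : 0 < t by near: t; exact: nbhs_right_gt.
split=> //; first by near: t; apply: nbhs_right_le.
have : t <= e / (K + 1) by near: t; apply: nbhs_right_le; exact: divr_gt0.
rewrite ler_pdivlMr//; apply: le_trans.
by rewrite ler_wpM2l ?(ltW t0)// lerDl.
Unshelve. all: end_near. Qed.

Lemma parabola_expansion (e : R) : 0 < e -> \forall t \near (0 : R)^'+,
  `|g (y + parabola t) - (g y + t *: d + t ^+ 2 *: cc)| <= e * t ^+ 2.
Proof.
move=> e0; pose M1 := `|v *m L w + w *m L v| + `|w *m L w|.
have e1 : 0 < e / (2 * V ^+ 2) by rewrite divr_gt0// mulr_gt0// exprn_gt0.
have [delta d0 dP] := taylor2 gJL e1.
have M10 : 0 <= M1 by rewrite addr_ge0.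
have H1 := small_t (ltW V0) d0; have H2 := small_t M10 e0.
near=> t.
have [t0 t1 tV] : [/\ 0 < t, t <= 1 & t * V <= delta] by near: t.
have [_ _ tM] : [/\ 0 < t, t <= 1 & t * M1 <= e] by near: t.
have at_ := norm_parabola t0 t1.
have := dP 0 (parabola t); rewrite normr0 (ltW d0) (le_trans at_ tV) => /(_ isT isT).
rewrite addr0 (twice_diff0 gJL) mulmx0 subr0 add0r.
set rm := (X in `|X| <= _ -> _) => rm_le.
have -> : g (y + parabola t) - (g y + t *: d + t ^+ 2 *: cc) =
    rm + (2^-1 * t ^+ 3) *: (v *m L w + w *m L v + t *: (w *m L w)).
  rewrite /rm ccE dE /parabola (td_D gJL) !(td_Z gJL).
  rewrite !mulmxDl !mulmxDr -!scalemxAl -!scalemxAr !scalerA.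
  move: (v *m J y) (w *m J y) (v *m L v) (v *m L w) (w *m L v) (w *m L w).
  move: (g _) (g _) => q1 q2 q3 q4 q5 q6 q7 q8.
  by apply/rowP => i; rewrite !mxE; field.
have rm_le2 : `|rm| <= e / 2 * t ^+ 2.
  apply: le_trans rm_le _.
  have -> : e / 2 * t ^+ 2 = e / (2 * V ^+ 2) * (t * V) * (t * V).
    by field; rewrite gt_eqF.
  apply: ler_pM => //; first exact: (mulr_ge0 (ltW e1)).
  exact: (ler_wpM2l (ltW e1)).
rewrite (le_trans (ler_normD _ _))//.
have -> : e * t ^+ 2 = e / 2 * t ^+ 2 + e / 2 * t ^+ 2 by field.
apply: lerD => //.
rewrite normrZ ger0_norm ?mulr_ge0 ?exprn_ge0 ?(ltW t0)//.
have : `|v *m L w + w *m L v + t *: (w *m L w)| <= M1.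
  rewrite (le_trans (ler_normD _ _))// lerD2l normrZ gtr0_norm//.
  by rewrite ler_piMl.
move=> /(ler_wpM2l (_ : 0 <= 2^-1 * t ^+ 3)) => /(_ _)/le_trans; apply.
  by rewrite mulr_ge0// exprn_ge0// ltW.
have -> : 2^-1 * t ^+ 3 * M1 = t * M1 / 2 * t ^+ 2 by field.
by rewrite ler_wpM2r ?exprn_ge0 ?(ltW t0)// ler_wpM2r.
Unshelve. all: end_near. Qed.

Lemma near_quadratic_le (q q1 q2 q3 : R) : q <= q3 ->
  (q = q3 -> q1 <= 0 /\ q2 <= 0) ->
  \forall t \near (0 : R)^'+, q + t * q1 + t ^+ 2 * q2 <= q3.
Proof.
rewrite le_eqVlt => /orP[/eqP <- /(_ erefl)[q10 q20]|qq _].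
  near=> t; have t0 : 0 < t by near: t; exact: nbhs_right_gt.
  rewrite -addrA gerDl.
  have : t * q1 <= 0 by rewrite mulr_ge0_le0// ltW.
  have : t ^+ 2 * q2 <= 0 by rewrite mulr_ge0_le0// exprn_ge0// ltW.
  lra.
have K0 : 0 <= `|q1| + `|q2| by rewrite addr_ge0.
have qq0 : 0 < q3 - q by rewrite subr_gt0.
apply: filterS (small_t K0 qq0) => t [t0 t1]; rewrite mulrDr => tq.
have : t * q1 <= t * `|q1| by rewrite ler_wpM2l ?(ltW t0)// ler_norm.
have : t ^+ 2 * q2 <= t * `|q2|.
  apply: (@le_trans _ _ (t ^+ 2 * `|q2|)).
    by rewrite ler_wpM2l ?exprn_ge0 ?(ltW t0)// ler_norm.
  by rewrite ler_wpM2r// expr2 ler_piMl// ltW.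
by move: tq; lra.
Unshelve. all: end_near. Qed.

Hypothesis Dy : D (g y).
Hypothesis Td : forall j, j \in active a c (g y) -> dot (a j) d <= 0.
Hypothesis Tc : forall j, j \in active a c (g y) -> dot (a j) cc <= 0.

Lemma parabola_feasible : \forall t \near (0 : R)^'+,
  D (g y + t *: d + t ^+ 2 *: cc).
Proof.
apply: filter_forall => j.
have H : dot (a j) (g y) = c j -> dot (a j) d <= 0 /\ dot (a j) cc <= 0.
  by move=> yj; split; [apply: Td|apply: Tc]; rewrite inE yj.
apply: filterS (near_quadratic_le (Dy j) H) => t.
by rewrite !dotDr !dotZr; apply.
Qed.

Variables (lam eta : 'rV[R]_s).
Hypothesis lamd : dot lam d = 0.
Hypothesis etad : dot eta d = 0.
Hypothesis lamc : dot lam cc = 0.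
Let Lm := `|lam| + `|eta|.
Let Lm0 : 0 <= Lm. Proof. by rewrite addr_ge0. Qed.

Lemma norm_lam t : 0 < t -> t <= 1 -> `|lam + t *: eta| <= Lm.
Proof.
move=> t0 t1; rewrite (le_trans (ler_normD _ _))// lerD2l normrZ gtr0_norm//.
by rewrite ler_piMl.
Qed.

Lemma parabola_complementarity (e : R) : 0 < e -> \forall t \near (0 : R)^'+,
  `|dot (lam + t *: eta) (g (y + parabola t) - g y)| <= e * t ^+ 2.
Proof.
move=> e0; have sL : 0 < s%:R * Lm + 1 by rewrite ltr_wpDl// mulr_ge0.
have e1 : 0 < e / (2 * (s%:R * Lm + 1)) by rewrite divr_gt0// mulr_gt0.
have e2 : 0 < e / 2 by rewrite divr_gt0.
have H1 := small_t (normr_ge0 (dot eta cc)) e2.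
have H2 := parabola_expansion e1.
near=> t.
have [t0 t1 te] : [/\ 0 < t, t <= 1 & t * `|dot eta cc| <= e / 2] by near: t.
have [rm rmE] : exists rm, rm = g (y + parabola t) - (g y + t *: d + t ^+ 2 *: cc).
  by eexists.
have rm_le : `|rm| <= e / (2 * (s%:R * Lm + 1)) * t ^+ 2 by rewrite rmE; near: t.
have -> : dot (lam + t *: eta) (g (y + parabola t) - g y) =
    dot (lam + t *: eta) rm + t ^+ 3 * dot eta cc.
  have -> : g (y + parabola t) - g y = rm + t *: d + t ^+ 2 *: cc.
    by rewrite rmE; apply/rowP => i; rewrite !mxE; ring.
  rewrite !dotDr !dotZr !(dotDl lam) !dotZl lamd etad lamc; ring.
rewrite (le_trans (ler_normD _ _))//.
have -> : e * t ^+ 2 = e / 2 * t ^+ 2 + e / 2 * t ^+ 2 by field.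
apply: lerD; last first.
  rewrite normrM ger0_norm ?exprn_ge0 ?(ltW t0)//.
  have -> : t ^+ 3 * `|dot eta cc| = t * `|dot eta cc| * t ^+ 2 by ring.
  by rewrite ler_wpM2r ?exprn_ge0 ?(ltW t0).
rewrite (le_trans (dot_le_norm _ _))//.
apply: (@le_trans _ _ (s%:R * (Lm * (e / (2 * (s%:R * Lm + 1)) * t ^+ 2)))).
  by rewrite ler_wpM2l// ler_pM// norm_lam.
have -> : s%:R * (Lm * (e / (2 * (s%:R * Lm + 1)) * t ^+ 2)) =
    e / 2 * t ^+ 2 * (s%:R * Lm / (s%:R * Lm + 1)).
  by field; rewrite gt_eqF.
have e2t : 0 <= e / 2 * t ^+ 2 by rewrite (mulr_ge0 (ltW e2))// exprn_ge0// ltW.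
rewrite ler_piMr//.
by rewrite ler_pdivrMr// mul1r lerDl.
Unshelve. all: end_near. Qed.

Let xs := lam *m (B y)^T.
Let vs := lam *m (dsubmx (L v))^T + eta *m (B y)^T.

(** Up to [o(t)|zeta|] and a multiple of [|zeta|^2], the function
    [zeta |-> dot (lam + t eta) (g (_ + (0, zeta)))] is linear with slope
    [xs + t vs] at the points of the parabola; the definition of [vs] accounts for
    the variation of [g] and of the multiplier to first order in [t]. *)
Lemma multiplier_slope : exists2 M : R, 0 < M & forall e : R, 0 < e ->
  exists2 delta : R, 0 < delta & \forall t \near (0 : R)^'+,
  forall zeta : 'rV[R]_n, `|zeta| <= delta ->
  `|dot (lam + t *: eta) (g (y + parabola t + row_mx 0 zeta) - g (y + parabola t)) -
    dot (xs + t *: vs) zeta| <= M * `|zeta| ^+ 2 + e * t * `|zeta|.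
Proof.
have [K K0 LK] := td_bound gJL.
pose N : R := (m + n)%:R.
pose C := s%:R * (Lm * (N * (K * V))).
have C0 : 0 <= C by rewrite !mulr_ge0// ltW.
pose C4 := s%:R * (Lm * (N * K)).
have C40 : 0 <= C4 by rewrite !mulr_ge0// ltW.
exists (C4 + 1); first by rewrite ltr_wpDl.
move=> e e0; pose m0 := Num.min 1 (e / 2).
have m00 : 0 < m0 by rewrite lt_min ltr01 divr_gt0.
have m01 : m0 <= 1 by rewrite ge_min lexx.
have m0e : m0 <= e / 2 by rewrite ge_min lexx orbT.
have sL : 0 < s%:R * Lm + 1 by rewrite ltr_wpDl// mulr_ge0.
pose e1 := m0 / ((s%:R * Lm + 1) * V).
have e10 : 0 < e1 by rewrite divr_gt0// mulr_gt0.
have [delta d0 dP] := taylor2 gJL e10.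
exists delta => //.
have e6 : 0 < e / 2 by rewrite divr_gt0.
have H1 := small_t (ltW V0) d0.
have H2 := small_t (mulr_ge0 (ler0n R 3) C0) e6.
near=> t => zeta zd.
have [t0 t1 tV] : [/\ 0 < t, t <= 1 & t * V <= delta] by near: t.
have [_ _ tC] : [/\ 0 < t, t <= 1 & t * (3 * C) <= e / 2] by near: t.
pose z0 : 'rV[R]_(m + n) := row_mx 0 zeta.
have nz0 : `|z0| = `|zeta| by rewrite norm_row0.
have at_ := norm_parabola t0 t1.
have := dP (parabola t) z0 (le_trans at_ tV); rewrite nz0 => /(_ zd).
set rm := (X in `|X| <= _ -> _) => rm_le.
have rmE := erefl rm; rewrite {2}/rm in rmE; clearbody rm.
set X := `|zeta| in zd nz0 rm_le *.
have X0 : 0 <= X by exact: normr_ge0.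
have dotL (b : 'rV[R]_s) (u : 'rV[R]_(m + n)) : `|b| <= Lm -> `|u| <= V ->
    `|dot b (z0 *m L u)| <= C * X.
  move=> bL uV; rewrite (le_trans (dot_le_norm _ _))// /C -!mulrA ler_wpM2l//.
  rewrite ler_pM// (le_trans (norm_mulmx _ _))// nz0 -/N ler_wpM2l//.
  by rewrite mulrA [leRHS]mulrC ler_wpM2l// (le_trans (LK _))// ler_wpM2l// ltW.
have lamL : `|lam| <= Lm by rewrite lerDl.
have etaL : `|eta| <= Lm by rewrite lerDr.
have vV : `|v| <= V by rewrite /V -addrA lerDl addr_ge0.
have wV : `|w| <= V by rewrite /V addrAC lerDr addr_ge0.
have A1 := dotL lam w lamL wV.
have A2 := dotL eta v etaL vV.
have A3 := dotL eta w etaL wV.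
have A4 : `|dot (lam + t *: eta) (z0 *m L z0)| <= C4 * X ^+ 2.
  rewrite (le_trans (dot_le_norm _ _))// /C4 -!mulrA ler_wpM2l//.
  rewrite ler_pM// ?norm_lam// (le_trans (norm_mulmx _ _))// nz0 -/N ler_wpM2l//.
  by rewrite expr2 [leRHS]mulrCA ler_wpM2l// -nz0 LK.
have A5 : `|dot (lam + t *: eta) rm| <= X * (m0 * t + m0 * X).
  rewrite (le_trans (dot_le_norm _ _))//.
  apply: (@le_trans _ _ (s%:R * (Lm * (e1 * X * (t * V + X))))).
    rewrite ler_wpM2l// ler_pM// ?norm_lam// (le_trans rm_le)//.
    apply: ler_wpM2l; first exact: (mulr_ge0 (ltW e10)).
    by rewrite lerD2r.
  have -> : s%:R * (Lm * (e1 * X * (t * V + X))) =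
      X * ((s%:R * Lm / (s%:R * Lm + 1)) * m0 * (t + X / V)).
    by rewrite /e1; field; rewrite !gt_eqF.
  have f0 : 0 <= s%:R * Lm / (s%:R * Lm + 1).
    by rewrite divr_ge0 ?(ltW sL)// mulr_ge0.
  have f1 : s%:R * Lm / (s%:R * Lm + 1) <= 1.
    by rewrite ler_pdivrMr// mul1r lerDl.
  rewrite ler_wpM2l// -mulrDr; apply: ler_pM.
  - by rewrite mulr_ge0// ltW.
  - by rewrite addr_ge0 ?divr_ge0// ltW.
  - by rewrite ler_piMl// ltW.
  - by rewrite lerD2l ler_pdivrMr// ler_peMr.
have -> : dot (lam + t *: eta) (g (y + parabola t + z0) - g (y + parabola t)) -
      dot (xs + t *: vs) zeta =
    t ^+ 2 * (dot lam (z0 *m L w) + dot eta (z0 *m L v)) +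
    t ^+ 3 * dot eta (z0 *m L w) +
    2^-1 * dot (lam + t *: eta) (z0 *m L z0) + dot (lam + t *: eta) rm.
  have -> : g (y + parabola t + z0) - g (y + parabola t) = rm + z0 *m J y +
      (t *: (z0 *m L v) + t ^+ 2 *: (z0 *m L w)) + 2^-1 *: (z0 *m L z0).
    rewrite rmE /parabola [L (_ + _)](td_D gJL) !(td_Z gJL) mulmxDr -!scalemxAr.
    move: (z0 *m J y) (z0 *m L v) (z0 *m L w) (z0 *m L z0) (g _) (g _).
    by move=> q1 q2 q3 q4 q5 q6; apply/rowP => i; rewrite !mxE; ring.
  have -> : dot (xs + t *: vs) zeta = dot lam (z0 *m J y) +
      t * (dot lam (z0 *m L v) + dot eta (z0 *m J y)).
    rewrite /z0 !mul_row0 /xs /vs dotDl dotZl dotDl !dot_mulmx !trmxK.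
    by [].
  by rewrite !dotDr !dotZr !(dotDl lam) !dotZl; field.
have t2 : t ^+ 2 <= t by rewrite expr2 ler_piMl// ltW.
have t3 : t ^+ 3 <= t ^+ 2 by rewrite exprS ler_piMl// ?exprn_ge0 ?ltW.
have CX0 : 0 <= C * X by rewrite mulr_ge0.
have tri (x1 x2 x3 x4 : R) :
    `|x1 + x2 + x3 + x4| <= `|x1| + `|x2| + `|x3| + `|x4|.
  apply: le_trans (ler_normD _ _) _; rewrite lerD2r.
  apply: le_trans (ler_normD _ _) _; rewrite lerD2r.
  exact: ler_normD.
apply: le_trans (tri _ _ _ _) _.
have T1 : `|t ^+ 2 * (dot lam (z0 *m L w) + dot eta (z0 *m L v))| <=
    t ^+ 2 * (2 * (C * X)).
  rewrite normrM ger0_norm ?exprn_ge0 ?(ltW t0)// ler_wpM2l ?exprn_ge0 ?(ltW t0)//.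
  by rewrite (le_trans (ler_normD _ _))//; move: A1 A2; lra.
have T2 : `|t ^+ 3 * dot eta (z0 *m L w)| <= t ^+ 2 * (C * X).
  rewrite normrM ger0_norm ?exprn_ge0 ?(ltW t0)// ler_pM ?exprn_ge0 ?(ltW t0)//.
have T3 : `|2^-1 * dot (lam + t *: eta) (z0 *m L z0)| <= C4 * X ^+ 2.
  rewrite normrM ger0_norm//; apply: le_trans A4.
  by rewrite ler_piMl// invf_le1// ler1n.
have T4 : t ^+ 2 * (2 * (C * X)) + t ^+ 2 * (C * X) <= e / 2 * t * X.
  have -> : t ^+ 2 * (2 * (C * X)) + t ^+ 2 * (C * X) = t * (3 * C) * (t * X) by ring.
  by rewrite -[leRHS]mulrA ler_wpM2r// mulr_ge0// ltW.
have T5 : X * (m0 * t + m0 * X) <= e / 2 * t * X + X ^+ 2.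
  have -> : X * (m0 * t + m0 * X) = m0 * (t * X) + m0 * X ^+ 2 by ring.
  apply: lerD; last by rewrite ler_piMl// exprn_ge0.
  by rewrite -[leRHS]mulrA ler_wpM2r// mulr_ge0// ltW.
have -> : (C4 + 1) * X ^+ 2 + e * t * X =
  (e / 2 * t * X + C4 * X ^+ 2) + (e / 2 * t * X + X ^+ 2) by field.
move: T1 T2 T3 T4 T5 A5; lra.
Unshelve. all: end_near. Qed.

End Construction.

Section ConstructedNormals.
Context {R : realType}.

Lemma first_order_continuous k s (f : 'rV[R]_k -> 'rV[R]_s) (B : 'M[R]_(k, s)) x :
  (forall e : R, 0 < e ->
     \forall h \near (0 : 'rV[R]_k), `|f (x + h) - f x - h *m B| <= e * `|h|) ->
  {for x, continuous f}.
Proof.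
move=> fB; apply/(@cvgrPdist_lt _ _ _ (nbhs x) (nbhs_filter x) f (f x)) => e e0.
have [r r0 rP] := nbhs_norm (fB 1 ltr01).
pose K : R := 1 + k%:R * `|B| + 1.
have K0 : 0 < K by rewrite ltr_wpDl// addr_ge0// mulr_ge0.
have eK : 0 < e / K by rewrite divr_gt0.
have re0 : 0 < Num.min r (e / K) by rewrite lt_min r0.
apply: filterS (nbhsx_ballx x _ re0) => z; rewrite -ball_normE /= lt_min distrC.
move=> /andP[zr ze]; have := rP (z - x); rewrite subr0 => /(_ zr).
rewrite [x + _]addrC subrK mul1r => H.
have -> : f x - f z = - (f z - f x - (z - x) *m B + (z - x) *m B).
  by rewrite subrK opprB.
rewrite normrN (le_lt_trans (ler_normD _ _))//.
rewrite ltr_pdivlMr// in ze; apply: le_lt_trans ze.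
rewrite /K !mulrDr mulr1 -[leLHS]addr0 lerD// lerD//.
rewrite (le_trans (norm_mulmx _ _))// mulrCA; exact: lexx.
Qed.

Lemma closed_halfspaces s p (a : 'I_p -> 'rV[R]_s) (c : 'I_p -> R) :
  closed (halfspaces a c).
Proof.
rewrite (_ : halfspaces a c =
    \bigcap_(j in [set: 'I_p]) (dot (a j) @^-1` [set x | x <= c j])).
  apply: closed_bigI => j _; apply: preimage_closed; last exact: closed_le.
  by move=> x _; exact: dot_continuous.
by apply/seteqP; split=> x /= H j; [move=> _; exact: H|exact: (H j I)].
Qed.

Lemma prox_ineq k (rho : R) (x z zeta u : 'rV[R]_k) :
  rho * dot zeta zeta - dot x z <=
    rho * dot (u + zeta) (u + zeta) - dot x (u + z) ->
  dot (x - (2 * rho) *: zeta) u <= rho * dot u u.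
Proof. by rewrite dotBl dotZl !dotDr !dotDl (dotC u zeta); lra. Qed.

Context {m n s p : nat}.
Variables (g : 'rV[R]_(m + n) -> 'rV[R]_s).
Variables (J L : 'rV[R]_(m + n) -> 'M[R]_(m + n, s)).
Variables (a : 'I_p -> 'rV[R]_s) (c : 'I_p -> R).
Let D := halfspaces a c.
Variable y : 'rV[R]_(m + n).
Hypothesis gJL : twice_diff g J L y.
Let B z := dsubmx (J z).
Variables (kappa r : R).
Hypothesis kappa0 : 0 < kappa.
Hypothesis r0 : 0 < r.
Hypothesis reg : forall z, `|z - y| < r ->
  (setdist (rsubmx z) (feasible g a c (lsubmx z)) <= kappa%:E * setdist (g z) D)%E.

Lemma closed_feasible q : closed (feasible g a c q).
Proof.
apply: (@preimage_closed _ _ (fun z => g (row_mx q z)) D); last exact: closed_halfspaces.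
move=> z _; apply: (@first_order_continuous _ _ _ (B (row_mx q z))) => e e0.
by have := partial_first gJL (row_mx q z) e0; rewrite row_mxKl row_mxKr.
Qed.

(** The normal vectors come from the minimisers of
    [- dot (xs + t vs) z + rho |z - z0|^2] over the feasible set, near the point
    [z0] of the parabola. The multiplier [lam + t eta] bounds this function from
    below, and the feasible point [zh] from above, so that the minimiser is at
    distance [o(t)] from [z0]. *)
Theorem normal_map_approached xs v lam eta :
  derivative_multiplier g J L a c y xs v lam ->
  normal_cone (critical_cone D (g y) lam) (v *m J y) eta ->
  approached (gph (normal_map g a c)) (row_mx y xs)
    (row_mx v (lam *m (dsubmx (L v))^T + eta *m (B y)^T)).
Proof.
move=> [Nlam lamxs Kd lammax] Neta.
have [etad seg] := critical_normal_segment Nlam Neta.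
have [Dy Glam] := (normal_halfspaces _ _ _ _).1 Nlam.
have [Td lamd] := (critical_halfspaces _ _ Dy).1 Kd.
have [w [Tc lamc]] : exists w : 'rV[R]_(m + n),
    {in gens a (active a c (g y)), forall b,
      dot b (w *m J y + 2^-1 *: (v *m L v)) <= 0} /\
    dot lam (w *m J y + 2^-1 *: (v *m L v)) = 0.
  apply: lp_dual => // lam' Glam' lamJ; apply: lammax => //.
  by apply/normal_halfspaces.
have [d dE] : exists d, d = v *m J y by eexists.
have [cc ccE] : exists cc, cc = w *m J y + 2^-1 *: (v *m L v) by eexists.
rewrite -dE in etad seg Td lamd; rewrite -ccE in Tc lamc.
have {}Tc j : j \in active a c (g y) -> dot (a j) cc <= 0.
  by move=> jy; apply: Tc; apply: map_f; rewrite mem_enum.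
have [M M0 slope] := multiplier_slope gJL v w lam eta.
rewrite -/(B y) lamxs in slope.
set vs := lam *m _ + _ in slope *.
(* The penalty dominates the quadratic error [M] of [multiplier_slope]. *)
pose rho := M + 1.
have rho0 : 0 < rho by rewrite addr_gt0.
move=> e e_gt0; pose e0 := e / (2 * (1 + 2 * rho)).
have rho2 : 0 < 1 + 2 * rho by rewrite addr_gt0// mulr_gt0.
have e00 : 0 < e0 by rewrite divr_gt0// mulr_gt0.
pose C2 := kappa * s%:R + 1.
have C20 : 0 < C2 by rewrite ltr_wpDl// mulr_ge0// ltW.
pose Kc := 1 + n%:R * ((`|xs| + `|vs|) * C2) + rho * (n%:R * C2 ^+ 2).
have Kc0 : 0 < Kc.
  have C20' := ltW C20.
  have A0 : 0 <= n%:R * ((`|xs| + `|vs|) * C2).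
    by rewrite mulr_ge0// (mulr_ge0 _ C20')// addr_ge0.
  have B0 : 0 <= rho * (n%:R * C2 ^+ 2).
    by rewrite (mulr_ge0 (ltW rho0))// mulr_ge0// exprn_ge0.
  by rewrite /Kc -addrA ltr_pwDl// addr_ge0.
(* With this [ep], the inequality [Xmain] below implies [X <= e0 * t]. *)
pose ep := Num.min 1 (Num.min (e0 / 2) (e0 ^+ 2 / (4 * Kc))).
have ep0 : 0 < ep.
  by rewrite !lt_min ltr01 !divr_gt0 ?exprn_gt0// mulr_gt0.
have ep1 : ep <= 1 by rewrite ge_min lexx.
have epe : ep <= e0 / 2 by rewrite /ep !ge_min lexx orbT.
have epK : Kc * ep <= e0 ^+ 2 / 4.
  have : ep <= e0 ^+ 2 / (4 * Kc) by rewrite /ep !ge_min lexx !orbT.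
  rewrite ler_pdivlMr ?mulr_gt0// => h; rewrite ler_pdivlMr//.
  by apply: le_trans h; rewrite -mulrA mulrCA [Kc * _]mulrC.
have [delta delta0 slopet] := slope ep ep0.
pose V := `|v| + `|w| + 1.
have V0 : 0 < V by rewrite ltr_wpDl// addr_ge0.
have comp := parabola_complementarity gJL dE ccE lamd etad lamc ep0.
have expan := parabola_expansion gJL dE ccE ep0.
have feas := parabola_feasible Dy Td Tc.
have r2 : 0 < r / 2 by rewrite divr_gt0.
have delta2 : 0 < delta / 2 by rewrite divr_gt0.
have e2 : 0 < e / 2 by rewrite divr_gt0.
have T1 := small_t (ltW V0) r2.
have T2 := small_t (ltW C20) delta0.
have T3 := small_t (ltW e00) delta2.
have T4 := small_t (normr_ge0 w) e2.
near=> t.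
have [t0 t1 tV] : [/\ 0 < t, t <= 1 & t * V <= r / 2] by near: t.
have [_ _ tC] : [/\ 0 < t, t <= 1 & t * C2 <= delta] by near: t.
have [_ _ te0] : [/\ 0 < t, t <= 1 & t * e0 <= delta / 2] by near: t.
have [_ _ tw] : [/\ 0 < t, t <= 1 & t * `|w| <= e / 2] by near: t.
set yt := y + parabola v w t.
have comp_t : `|dot (lam + t *: eta) (g yt - g y)| <= ep * t ^+ 2.
  by rewrite /yt; near: t.
have expan_t : `|g yt - (g y + t *: d + t ^+ 2 *: cc)| <= ep * t ^+ 2.
  by rewrite /yt; near: t.
have feas_t : D (g y + t *: d + t ^+ 2 *: cc) by near: t.
have seg_t : normal_cone D (g y + t *: d) (lam + t *: eta) by near: t.
have slope_t : forall zeta : 'rV[R]_n, `|zeta| <= delta ->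
  `|dot (lam + t *: eta) (g (yt + row_mx 0 zeta) - g yt) -
    dot (xs + t *: vs) zeta| <= M * `|zeta| ^+ 2 + ep * t * `|zeta|.
  by rewrite /yt; near: t.
(* [lam + t eta] is normal to [D] at [g y + t d], and orthogonal to [d]. *)
have lam_le x : D x -> dot (lam + t *: eta) (x - g y) <= 0.
  move=> Dx; have [Dz Gz] := (normal_halfspaces _ _ _ _).1 seg_t.
  have := normal_halfspaces_le Dx (fintype.subxx _) Gz.
  have -> : x - g y = x - (g y + t *: d) + t *: d by rewrite opprD addrA subrK.
  rewrite (dotDr (x - _)) (dotZr t d) (dotDl lam _ d) (dotZl t _ d) lamd etad.
  by rewrite mulr0 addr0 mulr0 addr0.
pose q := lsubmx yt; pose z0 := rsubmx yt.
have ytz : `|yt - y| < r.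
  rewrite addrC addKr (le_lt_trans (norm_parabola v w t0 t1))//.
  by rewrite (le_lt_trans tV)// ltr_pdivrMr// ltr_pMr// ltr1n.
have ept : 0 < ep * t ^+ 2 by rewrite mulr_gt0// exprn_gt0.
(* The regularity assumption repairs the second-order error of the parabola. *)
have [zh Fzh zhz] : exists2 zh, feasible g a c q zh &
    eucl_norm (z0 - zh) < C2 * (ep * t ^+ 2).
  apply: setdist_lt_ex; apply: le_lt_trans (reg ytz) _.
  apply: (@le_lt_trans _ _ (kappa * (s%:R * (ep * t ^+ 2)))%:E).
    rewrite EFinM lee_pmul2l//; apply: setdist_le feas_t _.
    by rewrite (le_trans (eucl_le_norm _))// ler_wpM2l.
  by rewrite lte_fin /C2 mulrDl mul1r [ltLHS]mulrA ltrDl.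
pose S := [set z | feasible g a c q z /\ `|z - z0| <= delta].
pose xt := xs + t *: vs.
pose phi z := rho * dot (z - z0) (z - z0) - dot xt z.
have zh_le : `|zh - z0| <= C2 * (ep * t ^+ 2).
  by rewrite distrC (le_trans (norm_le_eucl _))// ltW.
have t2 : t ^+ 2 <= t by rewrite expr2 ler_piMl// ltW.
have ept1 : ep * t ^+ 2 <= t.
  by rewrite (le_trans _ t2)// ler_piMl// exprn_ge0// ltW.
have Szh : S zh.
  split=> //; apply: le_trans zh_le _; apply: le_trans tC.
  by rewrite mulrC ler_wpM2r// ltW.
have shift_cvg (z : 'rV[R]_n) : (fun x => x - z0) @ nbhs z --> z - z0.
  exact: (@cvgB _ _ _ (nbhs z) _ id (fun=> z0) z z0 cvg_id (cvg_cst _)).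
have [zs [Fzs zs_delta] zsmin] : exists2 z, S z & forall z', S z' -> phi z <= phi z'.
  apply: (@min_attained _ _ S phi (`|z0| + delta)).
  - by exists zh.
  - apply: closedI; first exact: closed_feasible.
    apply: (@preimage_closed _ _ (fun z : 'rV[R]_n => `|z - z0|)
      [set x : R | x <= delta]).
      by move=> z _; exact: cvg_norm (shift_cvg z).
    exact: closed_le.
  - move=> z [_ zd]; rewrite -[z](subrK z0) (le_trans (ler_normD _ _))// addrC.
    by rewrite lerD2l.
  - move=> z.
    have zd : (fun x => dot (x - z0) (x - z0)) @ nbhs z --> dot (z - z0) (z - z0).
      exact: (@cvg_dot _ _ (nbhs z) _ (fun x => x - z0) (fun x => x - z0) _ _ _
        (shift_cvg z) (shift_cvg z)).
    have rd : (fun x => rho * dot (x - z0) (x - z0)) @ nbhs z -->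
        rho * dot (z - z0) (z - z0).
      exact: (@cvgMl_tmp _ _ (nbhs z) _ _ rho _ zd).
    exact: (@cvgB _ _ _ (nbhs z) _ _ (dot xt) _ _ rd (@dot_continuous _ _ xt z)).
pose zeta := zs - z0; pose X := `|zeta|.
have X0 : 0 <= X := normr_ge0 _.
have zsE : row_mx q zs = yt + row_mx 0 zeta.
  by rewrite -add_row0 [_ + (zs - _)]addrC subrK.
have xt_le : dot xt zeta <= M * X ^+ 2 + ep * t * X + ep * t ^+ 2.
  have := slope_t zeta zs_delta; rewrite -zsE -/xt -/X dotBr => H1.
  have H2 := lam_le _ Fzs; rewrite dotBr in H2.
  have H3 := comp_t; rewrite dotBr in H3.
  move: H1 H3; rewrite !ler_norml => /andP[H1 _] /andP[H3 _].
  by move: H1 H2 H3; lra.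
have Xmain : X ^+ 2 <= ep * t * X + Kc * ep * t ^+ 2.
  have H1 := zsmin _ Szh; rewrite /phi -/zeta in H1.
  have H2 : X ^+ 2 <= dot zeta zeta := sqr_norm_le_dot zeta.
  have H3 : dot xt (zs - zh) = dot xt zeta - dot xt (zh - z0).
    by rewrite -dotBr /zeta opprB addrA subrK.
  have xt_norm : `|xt| <= `|xs| + `|vs|.
    rewrite (le_trans (ler_normD _ _))// lerD2l normrZ gtr0_norm//.
    by rewrite ler_piMl.
  have H4 : `|dot xt (zh - z0)| <= n%:R * ((`|xs| + `|vs|) * C2) * (ep * t ^+ 2).
    rewrite (le_trans (dot_le_norm _ _))// -!mulrA ler_wpM2l//.
    by rewrite ler_pM.
  have H5 : dot (zh - z0) (zh - z0) <= n%:R * C2 ^+ 2 * (ep * t ^+ 2).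
    rewrite (le_trans (ler_norm _))// (le_trans (dot_le_norm _ _))//.
    rewrite -[leRHS]mulrA ler_wpM2l//.
    apply: (@le_trans _ _ (C2 * (ep * t ^+ 2) * (C2 * (ep * t ^+ 2)))).
      exact: ler_pM.
    have -> : C2 * (ep * t ^+ 2) * (C2 * (ep * t ^+ 2)) =
      C2 ^+ 2 * (ep * t ^+ 2 * (ep * t ^+ 2)) by ring.
    rewrite ler_wpM2l ?exprn_ge0 ?(ltW C20)// ler_piMr ?(ltW ept)//.
    exact: le_trans ept1 t1.
  have H6 : rho * dot (zh - z0) (zh - z0) <= rho * (n%:R * C2 ^+ 2) * (ep * t ^+ 2).
    by rewrite -[leRHS]mulrA ler_wpM2l// ltW.
  have H7 : rho * X ^+ 2 <= rho * dot zeta zeta by rewrite ler_wpM2l// ltW.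
  move: H4; rewrite ler_norml => /andP[H4 _].
  rewrite dotBr in H3.
  have -> : Kc * ep * t ^+ 2 = ep * t ^+ 2 +
      n%:R * ((`|xs| + `|vs|) * C2) * (ep * t ^+ 2) +
      rho * (n%:R * C2 ^+ 2) * (ep * t ^+ 2) by rewrite /Kc; ring.
  have -> : X ^+ 2 = rho * X ^+ 2 - M * X ^+ 2 by rewrite /rho; ring.
  by move: H1 H3 H4 H6 H7 xt_le; lra.
have Xt : X <= e0 * t.
  rewrite leNgt; apply/negP => tX.
  have et0 : 0 < e0 * t by rewrite mulr_gt0.
  have X1 : 0 < X := lt_trans et0 tX.
  have H1 : ep * t * X <= 2^-1 * X ^+ 2.
    have -> : 2^-1 * X ^+ 2 = 2^-1 * X * X by rewrite expr2 mulrA.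
    rewrite ler_wpM2r// (@le_trans _ _ (e0 / 2 * t))//.
      by rewrite ler_wpM2r// ltW.
    by move: tX; lra.
  have H2 : Kc * ep * t ^+ 2 <= 4^-1 * X ^+ 2.
    apply: (@le_trans _ _ (e0 ^+ 2 / 4 * t ^+ 2)).
      by rewrite ler_wpM2r// exprn_ge0// ltW.
    have -> : e0 ^+ 2 / 4 * t ^+ 2 = 4^-1 * (e0 * t) ^+ 2 by field.
    by rewrite ler_wpM2l// lerXn2r ?nnegrE// ltW.
  have : 0 < X ^+ 2 by rewrite exprn_gt0.
  by move: Xmain H1 H2; lra.
have Nzs : normal_cone (feasible g a c q) zs (xt - (2 * rho) *: zeta).
  apply: (@proximal_normal _ _ _ _ _ rho (delta / 2)) => // z' Fz' zz'.
  have Sz' : S z'.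
    split=> //; have -> : z' - z0 = (z' - zs) + zeta by rewrite /zeta addrA subrK.
    rewrite (le_trans (ler_normD _ _))// [leRHS](splitr delta) lerD//; first exact: ltW.
    by rewrite -/X (le_trans Xt)// mulrC.
  have := zsmin _ Sz'; rewrite /phi.
  have -> : z' - z0 = (z' - zs) + zeta by rewrite /zeta addrA subrK.
  rewrite -/zeta => H; apply: (@prox_ineq _ _ _ zs).
  by rewrite subrK.
exists (row_mx (v + t *: w + t^-1 *: row_mx 0 zeta) (vs - (2 * rho / t) *: zeta)).
  rewrite opp_row_mx add_row_mx (le_trans (norm_row_mx _ _))//.
  have -> : v + t *: w + t^-1 *: row_mx 0 zeta - v = t *: w + t^-1 *: row_mx 0 zeta.
    by rewrite -(addrA v) [LHS]addrC addKr.
  rewrite addrAC subrr sub0r normrN normrZ -/X.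
  have tX : t^-1 * X <= e0 by rewrite ler_pdivrMl// mulrC.
  have H1 : `|t *: w + t^-1 *: row_mx 0 zeta| <= e / 2 + e0.
    rewrite (le_trans (ler_normD _ _))// !normrZ gtr0_norm// lerD//.
    by rewrite gtr0_norm ?invr_gt0// norm_row0.
  have H2 : `|2 * rho / t| * X <= 2 * rho * e0.
    rewrite ger0_norm ?divr_ge0 ?mulr_ge0 ?(ltW rho0) ?(ltW t0)//.
    by rewrite -[leLHS]mulrA ler_wpM2l// mulr_ge0// ltW.
  apply: le_trans (lerD H1 H2) _.
  have -> : e / 2 + e0 + 2 * rho * e0 = e / 2 + e0 * (1 + 2 * rho) by ring.
  have -> : e0 * (1 + 2 * rho) = e / 2 by rewrite /e0; field; rewrite gt_eqF.
  by rewrite -splitr.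
exists (row_mx q zs, xt - (2 * rho) *: zeta).
  by rewrite /= /normal_map row_mxKl row_mxKr.
rewrite /= zsE scale_row_mx add_row_mx; congr row_mx.
  rewrite /yt /parabola !scalerDr !scalerA mulfV ?gt_eqF// scale1r -expr2.
  by rewrite !addrA.
rewrite /xt (scalerBr t vs) scalerA addrA; congr (_ - _ *: _).
by field; rewrite gt_eqF.
Unshelve. all: end_near. Qed.

End ConstructedNormals.

(** * Jacobians, Hessians and the data of the theorem *)

Section Jacobians.
Context {R : realType}.

Lemma linear_bound_cvg (U V : normedModType R) (d : U -> V) (K : R) x :
  (forall u v, d (u + v) = d u + d v) -> (forall k u, d (k *: u) = k *: d u) ->
  (forall u, `|d u| <= K * `|u|) -> d z @[z --> x] --> d x.
Proof.
move=> dD dZ dK; apply/(@cvgrPdist_lt _ _ _ (nbhs x) (nbhs_filter x) d (d x)) => e e0.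
have K1 : 0 < `|K| + 1 by rewrite ltr_wpDl.
have eK : 0 < e / (`|K| + 1) by rewrite divr_gt0.
apply: filterS (nbhsx_ballx x _ eK) => z; rewrite -ball_normE /=.
rewrite ltr_pdivlMr// mulrC; apply: le_lt_trans.
have -> : d x - d z = d (x - z) by rewrite dD -[- z]scaleN1r dZ scaleN1r.
rewrite (le_trans (dK _))// ler_wpM2r//.
by rewrite (le_trans (ler_norm K))// lerDl.
Qed.

(** A first-order estimate with a bounded linear map [d] determines the
    Jacobian. *)
Lemma mul_jacobian k q (f : 'rV[R]_k -> 'rV[R]_q) (d : 'rV[R]_k -> 'rV[R]_q) x
    (K : R) v :
  (forall u v, d (u + v) = d u + d v) -> (forall a u, d (a *: u) = a *: d u) ->
  (forall u, `|d u| <= K * `|u|) ->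
  (forall e : R, 0 < e ->
     \forall h \near (0 : 'rV[R]_k), `|f (x + h) - f x - d h| <= e * `|h|) ->
  v *m jacobian f x = d v.
Proof.
move=> dD dZ dK fd.
have dl : linear d by move=> a u w; rewrite dD dZ.
pose dlin : {linear 'rV[R]_k -> 'rV[R]_q} :=
  HB.pack d (GRing.isLinear.Build _ _ _ _ d dl).
have -> : v *m jacobian f x = 'd f x v by rewrite /jacobian mul_rV_lin1.
rewrite (@diff_unique _ _ _ f dlin x)//.
  by move=> z; exact: (linear_bound_cvg dD dZ dK).
apply/eqaddoP => e e0; apply: filterS (fd e e0) => h.
rewrite [X in _ -> `|X| <= _](_ : _ = f (x + h) - f x - d h)//.
rewrite -[LHS]/(f (h + x) - (f x + d h)).
by rewrite opprD addrA [h + x]addrC.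
Qed.

Lemma derivable_dot (U : normedModType R) q (lam : 'rV[R]_q) (f : U -> 'rV[R]_q) x v :
  derivable f x v -> 'D_v (fun z => dot lam (f z)) x = dot lam ('D_v f x).
Proof.
move=> df; apply: cvg_lim => //.
rewrite [X in X @ _](_ : _ =
    (fun h : R => dot lam (h^-1 *: ((f \o shift x) (h *: v) - f x)))); last first.
  by apply/funext => h; rewrite dotZr dotBr.
exact: (@cvg_dot _ _ (0^') _ (fun=> lam) _ lam _ _ (cvg_cst _) df).
Qed.

Lemma derivable_mulmx (U : normedModType R) k q (u : 'rV[R]_k) (M : U -> 'M[R]_(k, q))
    x v :
  derivable M x v ->
  derivable (fun z => u *m M z) x v /\ 'D_v (fun z => u *m M z) x = u *m 'D_v M x.
Proof.
move=> dM.
have H : (fun h : R => h^-1 *: (((fun z => u *m M z) \o shift x) (h *: v) - u *m M x))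
    @ 0^' --> u *m 'D_v M x.
  rewrite [X in X @ _](_ : _ =
      (fun h : R => u *m (h^-1 *: ((M \o shift x) (h *: v) - M x)))); last first.
    by apply/funext => h; rewrite -scalemxAr mulmxBr.
  exact: (@cvg_mulmx _ _ (0^') _ _ _ (fun=> u) _ u _ _ (cvg_cst _) dM).
by split; [apply/cvg_ex; exists (u *m 'D_v M x)|exact: cvg_lim].
Qed.

Lemma dot_sumr (I : finType) q (lam : 'rV[R]_q) (f : I -> 'rV[R]_q) :
  dot lam (\sum_i f i) = \sum_i dot lam (f i).
Proof. by elim/big_rec2: _ => [|i u v _ <-]; rewrite ?dot0r// dotDr. Qed.

Lemma C2_twice_diff m s (g : 'rV[R]_m -> 'rV[R]_s) y :
  C2 g -> twice_diff g (jacobian g) ('d (jacobian g) y) y.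
Proof.
move=> [[dg _] [dJ _]]; split.
- by move=> z c t j; exact: is_derive_line.
- move=> z e e0; apply: filterS (diff_bound (dg z) e0) => h.
  by rewrite diff_jacobian.
- by move=> u v; rewrite linearD.
- by move=> k u; rewrite linearZ.
- have [K K0 dK] := linear_lipschitz (diff_continuous (dJ y)).
  by exists K.
- by move=> e e0; exact: diff_bound.
Qed.

Lemma curvatureE l n s (g : 'rV[R]_(l + n + n) -> 'rV[R]_s) lam y v :
  C2 g -> curvature g lam y v = dot lam (v *m 'd (jacobian g) y v).
Proof.
move=> [[dg _] [dJ _]].
have dderiv z w : derivable g z w by exact: diff_derivable.
have Jderiv z w : derivable (jacobian g) z w by exact: diff_derivable.
have HE i j : hessian (fun z => dot lam (g z)) y i j =
    dot lam (delta_mx 0 j *m 'd (jacobian g) y (delta_mx 0 i)).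
  rewrite mxE.
  have -> : (fun z => 'D_(delta_mx 0 j) (fun z => dot lam (g z)) z) =
      (fun z => dot lam (delta_mx 0 j *m jacobian g z)).
    by apply/funext => z; rewrite derivable_dot// deriveEjacobian.
  have [d1 d2] := derivable_mulmx (delta_mx 0 j) (Jderiv y (delta_mx 0 i)).
  by rewrite derivable_dot// d2 deriveE.
rewrite /curvature.
have vE : v = \sum_i v 0 i *: delta_mx 0 i by exact: row_sum_delta.
have -> : dot lam (v *m 'd (jacobian g) y v) =
    \sum_j \sum_i v 0 i * v 0 j *
      dot lam (delta_mx 0 j *m 'd (jacobian g) y (delta_mx 0 i)).
  rewrite {1}[v in v *m _]vE mulmx_suml dot_sumr; apply: eq_bigr => j _.
  rewrite {1}[v in 'd _ _ v]vE linear_sum mulmx_sumr dot_sumr.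
  apply: eq_bigr => i _.
  by rewrite linearZ/= -scalemxAr -scalemxAl !dotZr mulrA.
rewrite dotE; apply: eq_bigr => j _; rewrite mxE mulr_suml; apply: eq_bigr => i _.
by rewrite HE mulrAC.
Qed.

End Jacobians.

Section Diagonal.
Context {R : realType} {l n s p : nat}.
Variable g : 'rV[R]_(l + n + n) -> 'rV[R]_s.
Variables (a : 'I_p -> 'rV[R]_s) (c : 'I_p -> R).
Let D := halfspaces a c.
Variables (J L : 'rV[R]_(l + n + n) -> 'M[R]_(l + n + n, s)).
Variable px : 'rV[R]_(l + n).
Let y := diag_xx px.
Hypothesis gJL : twice_diff g J L y.

Lemma diag_xxD (u v : 'rV[R]_(l + n)) : diag_xx (u + v) = diag_xx u + diag_xx v.
Proof. by rewrite /diag_xx linearD/= add_row_mx. Qed.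

Lemma diag_xxZ k (u : 'rV[R]_(l + n)) : diag_xx (k *: u) = k *: diag_xx u.
Proof. by rewrite /diag_xx linearZ/= scale_row_mx. Qed.

Lemma norm_diag_xx (u : 'rV[R]_(l + n)) : `|diag_xx u| <= 2 * `|u|.
Proof.
rewrite (le_trans (norm_row_mx _ _))// mulr_natl mulr2n lerD2l.
exact: norm_rsubmx.
Qed.

Lemma near_diag_xx (A : set 'rV[R]_(l + n + n)) :
  (\forall h \near (0 : 'rV[R]_(l + n + n)), A h) ->
  \forall h \near (0 : 'rV[R]_(l + n)), A (diag_xx h).
Proof.
move=> /nbhs_norm[r r0 rP]; have r2 : 0 < r / 2 by rewrite divr_gt0.
apply: filterS (nbhsx_ballx _ _ r2) => h; rewrite -ball_normE /= sub0r normrN => hr.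
apply: rP; rewrite subr0 (le_lt_trans (norm_diag_xx h))//.
by rewrite mulrC -ltr_pdivlMr.
Qed.

Lemma mul_jacobian_gtilde qu : qu *m jacobian (gtilde g) px = diag_xx qu *m J y.
Proof.
apply: (@mul_jacobian _ _ _ _ (fun u => diag_xx u *m J y) _
  ((l + n + n)%:R * (2 * `|J y|))).
- by move=> u v; rewrite diag_xxD mulmxDl.
- by move=> k u; rewrite diag_xxZ -scalemxAl.
- move=> u; rewrite (le_trans (norm_mulmx _ _))// -mulrA ler_wpM2l// mulrAC.
  by rewrite ler_wpM2r// norm_diag_xx.
- move=> e e0; have e2 : 0 < e / 2 by rewrite divr_gt0.
  apply: filterS (near_diag_xx (td_first gJL y e2)) => h.
  rewrite /gtilde diag_xxD => /le_trans; apply.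
  by rewrite -[leLHS]mulrA ler_wpM2l ?(ltW e0)// ler_pdivrMl// norm_diag_xx.
Qed.

Lemma bTE : bT g px = dsubmx (J y).
Proof.
have H (h : 'rV[R]_n) : h *m bT g px = h *m dsubmx (J y).
  apply: (@mul_jacobian _ _ _ _ (fun u => u *m dsubmx (J y)) _ (n%:R * `|dsubmx (J y)|)).
  - by move=> u v; rewrite mulmxDl.
  - by move=> k u; rewrite -scalemxAl.
  - by move=> u; rewrite (le_trans (norm_mulmx _ _))// -mulrA [`|u| * _]mulrC.
  - move=> e e0; have := partial_first gJL y e0.
    by rewrite /y /diag_xx row_mxKl row_mxKr.
by apply/row_matrixP => i; rewrite !rowE H.
Qed.

Lemma mul_jacobian_bT (lam : 'rV[R]_s) qu (bT' : 'rV[R]_(l + n) -> 'M[R]_(n, s)) :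
  (forall px', bT' px' = dsubmx (J (diag_xx px'))) ->
  qu *m jacobian (fun px' => lam *m (bT' px')^T) px =
  lam *m (dsubmx (L (diag_xx qu)))^T.
Proof.
move=> bTE'; have [K K0 LK] := td_bound gJL.
have nb (A : 'M[R]_(l + n + n, s)) : `|lam *m (dsubmx A)^T| <= s%:R * `|lam| * `|A|.
  rewrite (le_trans (norm_mulmx _ _))// norm_trmx mulrA ler_wpM2l ?mulr_ge0//.
  exact: norm_dsubmx.
apply: (@mul_jacobian _ _ _ _ (fun u => lam *m (dsubmx (L (diag_xx u)))^T) _
  (s%:R * `|lam| * (K * 2))).
- by move=> u v; rewrite diag_xxD (td_D gJL) !linearD.
- by move=> k u; rewrite diag_xxZ (td_Z gJL) !linearZ.
- move=> u; rewrite (le_trans (nb _))// -[leRHS]mulrA ler_wpM2l ?mulr_ge0//.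
  by rewrite (le_trans (LK _))// -mulrA ler_wpM2l ?(ltW K0)// norm_diag_xx.
- move=> e e0; have sl : 0 < 2 * (s%:R * `|lam| + 1).
    by rewrite mulr_gt0// ltr_wpDl// mulr_ge0.
  have e2 : 0 < e / (2 * (s%:R * `|lam| + 1)) by rewrite divr_gt0.
  apply: filterS (near_diag_xx (td_second gJL e2)) => h.
  rewrite !bTE' diag_xxD => H.
  have -> : lam *m (dsubmx (J (diag_xx px + diag_xx h)))^T -
      lam *m (dsubmx (J (diag_xx px)))^T - lam *m (dsubmx (L (diag_xx h)))^T =
      lam *m (dsubmx (J (diag_xx px + diag_xx h) - J (diag_xx px) - L (diag_xx h)))^T.
    by move: (J _) (J _) (L _) => A1 A2 A3; rewrite !linearB.
  rewrite (le_trans (nb _))//.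
  apply: (@le_trans _ _
      (s%:R * `|lam| * (e / (2 * (s%:R * `|lam| + 1)) * (2 * `|h|)))).
    rewrite ler_wpM2l ?mulr_ge0// (le_trans H)//.
    by rewrite (ler_wpM2l (ltW e2))// norm_diag_xx.
  have -> : s%:R * `|lam| * (e / (2 * (s%:R * `|lam| + 1)) * (2 * `|h|)) =
     (e * `|h|) * (s%:R * `|lam| / (s%:R * `|lam| + 1)).
    by field; rewrite gt_eqF// ltr_wpDl// mulr_ge0.
  rewrite ler_piMr ?mulr_ge0 ?(ltW e0)// ler_pdivrMr ?mul1r ?lerDl//.
Qed.

End Diagonal.

(** * Directional metric subregularity *)

Section Subregular.
Context {R : realType} {l n s p : nat}.
Variable g : 'rV[R]_(l + n + n) -> 'rV[R]_s.
Variables (a : 'I_p -> 'rV[R]_s) (c : 'I_p -> R).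
Let D := halfspaces a c.
Variables (J L : 'rV[R]_(l + n + n) -> 'M[R]_(l + n + n, s)).
Variable px : 'rV[R]_(l + n).
Let y := diag_xx px.
Hypothesis gJL : twice_diff g J L y.
Let B z := dsubmx (J z).

Lemma dir_ball_scale k (rho delta : R) (u : 'rV[R]_k) : 0 < rho -> 0 < delta ->
  \forall t \near (0 : R)^'+, dir_ball rho delta u (t *: u).
Proof.
move=> rho0 delta0; have e0 := small_t (eucl_norm_ge0 u) rho0.
apply: filterS e0 => t [t0 _ tu]; split; rewrite eucl_normZ gtr0_norm//.
rewrite scalerA [eucl_norm u * t]mulrC subrr eucl_norm0.
by rewrite !mulr_ge0 ?eucl_norm_ge0// ltW.
Qed.

Variables (qu : 'rV[R]_(l + n)) (lam eta : 'rV[R]_s).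
Let v := diag_xx qu.
Hypothesis Nlam : normal_cone D (g y) lam.
Hypothesis Neta : normal_cone (critical_cone D (g y) lam) (v *m J y) eta.

(** The segment [(g + t d, lam + t eta)] stays in the graph of [N_D], so that
    the residual along the direction is [o(t)]; subregularity then gives exact
    solutions at distance [o(t)]. *)
Lemma subregular_pairs : dir_subregular (Fmap g D) (row_mx qu eta) (row_mx px lam) 0 ->
  forall e : R, 0 < e -> \forall t \near (0 : R)^'+,
  exists px' mu, [/\ normal_cone D (gtilde g px') mu,
    `|px' - (px + t *: qu)| <= e * t & `|mu - (lam + t *: eta)| <= e * t].
Proof.
move=> [_ [U [kap [[rho [delta [rho0 delta0 UP]]] kap0 sub]]]] e e0.
have kap1 : 0 < 2 * (kap + 1) by rewrite mulr_gt0// ltr_wpDl.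
have sq : 0 < s%:R * (2 * `|qu|) + 1 by rewrite ltr_wpDl// !mulr_ge0.
pose e1 := e / (2 * (kap + 1)) / (s%:R * (2 * `|qu|) + 1).
have e10 : 0 < e1.
  by rewrite !divr_gt0.
have [_ seg] := critical_normal_segment Nlam Neta.
have dir := dir_ball_scale (row_mx qu eta) rho0 delta0.
have first := near_scale (qu : 'rV[R]_(l + n)) (near_diag_xx (td_first gJL y e10)).
near=> t.
have t0 : 0 < t by near: t; exact: nbhs_right_gt.
have dirt : dir_ball rho delta (row_mx qu eta) (t *: row_mx qu eta) by near: t.
have segt : normal_cone D (g y + t *: (v *m J y)) (lam + t *: eta) by near: t.
have firstt : `|g (y + diag_xx (t *: qu)) - g y - diag_xx (t *: qu) *m J y| <=
    e1 * `|diag_xx (t *: qu)| by near: t.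
have et : 0 < e * t by rewrite mulr_gt0.
set z := row_mx px lam + t *: row_mx qu eta.
have zE : z = row_mx (px + t *: qu) (lam + t *: eta).
  by rewrite /z scale_row_mx add_row_mx.
have resid : (setdist 0 (Fmap g D z) <= (e / (2 * (kap + 1)) * t)%:E)%E.
  have Fz : Fmap g D z (row_mx (g (y + diag_xx (t *: qu)) - (g y + t *: (v *m J y))) 0).
    exists (row_mx (g y + t *: (v *m J y)) (lam + t *: eta)).
      by exists (g y + t *: (v *m J y), lam + t *: eta).
    rewrite zE row_mxKl row_mxKr /gtilde diag_xxD opp_row_mx add_row_mx.
    by rewrite subrr.
  apply: setdist_le Fz _; rewrite sub0r eucl_normN.
  have -> : eucl_norm (row_mx (g (y + diag_xx (t *: qu)) - (g y + t *: (v *m J y))) 0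
      : 'rV[R]_(s + s)) = eucl_norm (g (y + diag_xx (t *: qu)) - (g y + t *: (v *m J y))).
    by rewrite /eucl_norm dot_row_mx dot0l addr0.
  rewrite (le_trans (eucl_le_norm _))//.
  have -> : g (y + diag_xx (t *: qu)) - (g y + t *: (v *m J y)) =
      g (y + diag_xx (t *: qu)) - g y - diag_xx (t *: qu) *m J y.
    by rewrite opprD addrA diag_xxZ scalemxAl.
  rewrite (le_trans (ler_wpM2l _ firstt))//.
  rewrite diag_xxZ normrZ gtr0_norm//.
  apply: (@le_trans _ _ (s%:R * (e1 * (t * (2 * `|qu|))))).
    by rewrite !ler_wpM2l// ?(ltW e10) ?(ltW t0)// norm_diag_xx.
  have -> : s%:R * (e1 * (t * (2 * `|qu|))) = e / (2 * (kap + 1)) * t *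
      (s%:R * (2 * `|qu|) / (s%:R * (2 * `|qu|) + 1)).
    by rewrite /e1; field; rewrite !gt_eqF// ltr_wpDl.
  rewrite ler_piMr//; first by rewrite mulr_ge0 ?divr_ge0// ltW.
  by rewrite ler_pdivrMr// mul1r lerDl.
have [x Fx zx] : exists2 x, Fmap g D x 0 & eucl_norm (z - x) < e * t.
  apply: (@setdist_lt_ex _ _ [set x | Fmap g D x 0]).
  have := sub _ (UP _ dirt); rewrite -/z => /le_lt_trans; apply.
  apply: (@le_lt_trans _ _ (kap%:E * (e / (2 * (kap + 1)) * t)%:E)%E).
    by apply: lee_wpmul2l; rewrite ?lee_fin.
  rewrite -EFinM lte_fin.
  have -> : kap * (e / (2 * (kap + 1)) * t) = e * t * (kap / (2 * (kap + 1))).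
    by field; rewrite gt_eqF// ltr_wpDl.
  by rewrite gtr_pMr// ltr_pdivrMr//; move: kap0; lra.
have {}zx : `|x - z| <= e * t.
  by rewrite distrC (le_trans (norm_le_eucl _))// ltW.
exists (lsubmx x), (rsubmx x); split.
- case: Fx => w [[w1 w2] /= Nw <-] /eqP; rewrite subr_eq0 => /eqP/eq_row_mx[-> ->].
  exact: Nw.
- apply: le_trans zx.
  have -> : lsubmx x - (px + t *: qu) = lsubmx (x - z).
    by rewrite linearB/= zE row_mxKl.
  exact: norm_lsubmx.
- apply: le_trans zx.
  have -> : rsubmx x - (lam + t *: eta) = rsubmx (x - z).
    by rewrite linearB/= zE row_mxKr.
  exact: norm_rsubmx.
Unshelve. all: end_near. Qed.

Lemma product_difference (mu : 'rV[R]_s) (t : R) (P Q S : 'M[R]_(s, n)) :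
  (mu - (lam + t *: eta)) *m P + (t *: eta) *m (P - Q) + lam *m (P - Q - t *: S) =
  mu *m P - lam *m Q - t *: (lam *m S + eta *m Q).
Proof.
rewrite !(mulmxBl, mulmxDl, mulmxBr, mulmxDr) -!scalemxAl -!scalemxAr scalerDr.
move: (mu *m P) (lam *m P) (eta *m P) (lam *m Q) (eta *m Q) (lam *m S).
by move=> q1 q2 q3 q4 q5 q6; apply/rowP => i; rewrite !mxE; ring.
Qed.

(** The normal vectors are [mu *m (B (diag_xx px'))^T] for the pairs of
    [subregular_pairs]; expanding this product to first order in [t] gives the
    tangent. *)
Theorem subregular_approached :
  dir_subregular (Fmap g D) (row_mx qu eta) (row_mx px lam) 0 ->
  approached (gph (Gmap g D)) (row_mx px (lam *m (B y)^T))
    (row_mx qu (lam *m (dsubmx (L v))^T + eta *m (B y)^T)).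
Proof.
move=> subreg e e0.
have [K K0 LK] := td_bound gJL.
pose W := 2 * (`|qu| + 1).
have W0 : 0 < W by rewrite mulr_gt0// ltr_wpDl.
pose C1 := `|J y| + (1 + K) * W.
have C10 : 0 < C1 by rewrite ltr_wpDl// mulr_gt0// addr_gt0.
pose C := s%:R * (C1 + `|lam| * (W + 2 * K)) + 1.
have C0 : 0 < C.
  rewrite ltr_wpDl// mulr_ge0// addr_ge0 ?(ltW C10)// mulr_ge0// addr_ge0 ?(ltW W0)//.
  by rewrite mulr_ge0// ltW.
pose ep := Num.min 1 (Num.min (e / 2) (e / (4 * C))).
have ep0 : 0 < ep by rewrite !lt_min ltr01 !divr_gt0// mulr_gt0.
have ep1 : ep <= 1 by rewrite ge_min lexx.
have epe : ep <= e / 2 by rewrite /ep !ge_min lexx orbT.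
have epC : ep * C <= e / 4.
  have : ep <= e / (4 * C) by rewrite /ep !ge_min lexx !orbT.
  by rewrite ler_pdivlMr ?mulr_gt0// => h; rewrite ler_pdivlMr// -mulrA [C * _]mulrC.
have pairs := subregular_pairs subreg ep0.
have [r r0 rP] := nbhs_norm (td_second gJL ep0).
have r2 : 0 < r / 2 by rewrite divr_gt0.
have e4 : 0 < e / 4 by rewrite divr_gt0.
have KW0 : 0 <= s%:R * (`|eta| * ((1 + K) * W)).
  by rewrite !mulr_ge0 ?(ltW W0)// addr_ge0// ltW.
have T1 := small_t (ltW W0) r2.
have T2 := small_t KW0 e4.
near=> t.
have [t0 t1 tW] : [/\ 0 < t, t <= 1 & t * W <= r / 2] by near: t.
have [_ _ te] : [/\ 0 < t, t <= 1 & t * (s%:R * (`|eta| * ((1 + K) * W))) <= e / 4].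
  by near: t.
have [px' [mu [Nmu px'_le mu_le]]] : exists px' mu, [/\ normal_cone D (gtilde g px') mu,
    `|px' - (px + t *: qu)| <= ep * t & `|mu - (lam + t *: eta)| <= ep * t] by near: t.
pose dx := px' - px.
have yE : diag_xx px' = y + diag_xx dx by rewrite -diag_xxD addrC subrK.
have dx_le : `|dx - t *: qu| <= ep * t by rewrite /dx -addrA -opprD.
have ddx : `|diag_xx dx| <= W * t.
  rewrite (le_trans (norm_diag_xx _))// /W -mulrA ler_wpM2l//.
  rewrite -[dx](subrK (t *: qu)) (le_trans (ler_normD _ _))// normrZ gtr0_norm//.
  have : ep * t <= t by rewrite ler_piMl// ltW.
  by move: dx_le; rewrite mulrDl mul1r [`|qu| * t]mulrC; lra.
have ddxv : `|diag_xx dx - t *: v| <= 2 * (ep * t).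
  have -> : diag_xx dx - t *: v = diag_xx (dx - t *: qu).
    by rewrite diag_xxD -[- (t *: qu)]scaleN1r !diag_xxZ scaleN1r.
  by rewrite (le_trans (norm_diag_xx _))// ler_wpM2l.
set dJ := J (diag_xx px') - J y.
have dJ1 : `|dJ - L (diag_xx dx)| <= ep * (W * t).
  have := rP (diag_xx dx); rewrite subr0 -yE => H.
  rewrite (le_trans (H _))// ?ler_wpM2l ?(ltW ep0)//.
  rewrite (le_lt_trans ddx)// mulrC (le_lt_trans tW)//.
  by rewrite ltr_pdivrMr// ltr_pMr// ltr1n.
have dJ2 : `|dJ| <= (1 + K) * W * t.
  rewrite -[dJ](subrK (L (diag_xx dx))) (le_trans (ler_normD _ _))//.
  have H1 : ep * (W * t) <= W * t by rewrite ler_piMl// mulr_ge0// ltW.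
  have H2 : `|L (diag_xx dx)| <= K * (W * t).
    by rewrite (le_trans (LK _))// ler_wpM2l// ltW.
  by move: H1 H2 dJ1; lra.
have dJ3 : `|dJ - t *: L v| <= ep * (W + 2 * K) * t.
  have -> : dJ - t *: L v = dJ - L (diag_xx dx) + L (diag_xx dx - t *: v).
    rewrite (td_D gJL) -[- (t *: v)]scaleN1r !(td_Z gJL) scaleN1r.
    by rewrite addrA subrK.
  rewrite (le_trans (ler_normD _ _))//.
  have H2 : `|L (diag_xx dx - t *: v)| <= K * (2 * (ep * t)).
    by rewrite (le_trans (LK _))// ler_wpM2l// ltW.
  by move: H2 dJ1; lra.
have J' : `|J (diag_xx px')| <= C1.
  rewrite -[J _](subrK (J y)) (le_trans (ler_normD _ _))// addrC lerD2l.
  rewrite -/dJ (le_trans dJ2)// ler_piMr// mulr_ge0 ?(ltW W0)//.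
  by rewrite addr_ge0// ltW.
pose xs' := mu *m (B (diag_xx px'))^T.
pose elt := lam *m (dsubmx (L v))^T + eta *m (B y)^T.
have xs'_le : `|xs' - lam *m (B y)^T - t *: elt| <= e / 2 * t.
  have -> : xs' - lam *m (B y)^T - t *: elt =
      (mu - (lam + t *: eta)) *m (dsubmx (J (diag_xx px')))^T +
      (t *: eta) *m (dsubmx dJ)^T + lam *m (dsubmx (dJ - t *: L v))^T.
    have -> : (dsubmx dJ)^T = (B (diag_xx px'))^T - (B y)^T by rewrite /dJ !linearB.
    have -> : (dsubmx (dJ - t *: L v))^T =
        (B (diag_xx px'))^T - (B y)^T - t *: (dsubmx (L v))^T.
      by rewrite /dJ !linearB/= !linearZ.
    by rewrite product_difference.
  have N1 : `|(mu - (lam + t *: eta)) *m (dsubmx (J (diag_xx px')))^T| <=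
      s%:R * (ep * t * C1).
    rewrite (le_trans (norm_mulmx _ _))// norm_trmx ler_wpM2l// ler_pM//.
    exact: le_trans (norm_dsubmx _) J'.
  have N2 : `|(t *: eta) *m (dsubmx dJ)^T| <= e / 4 * t.
    rewrite (le_trans (norm_mulmx _ _))// norm_trmx normrZ gtr0_norm//.
    apply: (@le_trans _ _ (s%:R * (t * `|eta| * ((1 + K) * W * t)))).
      rewrite ler_wpM2l// ler_wpM2l ?mulr_ge0 ?(ltW t0)//.
      exact: le_trans (norm_dsubmx _) dJ2.
    have -> : s%:R * (t * `|eta| * ((1 + K) * W * t)) =
      t * (s%:R * (`|eta| * ((1 + K) * W))) * t by ring.
    by rewrite ler_wpM2r// ltW.
  have N3 : `|lam *m (dsubmx (dJ - t *: L v))^T| <=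
      s%:R * (`|lam| * (ep * (W + 2 * K) * t)).
    rewrite (le_trans (norm_mulmx _ _))// norm_trmx ler_wpM2l// ler_wpM2l//.
    exact: le_trans (norm_dsubmx _) dJ3.
  rewrite (le_trans (ler_normD _ _))// (le_trans (lerD (ler_normD _ _) (lexx _)))//.
  have N4 : ep * C * t <= e / 4 * t by rewrite ler_wpM2r// ltW.
  have -> : e / 2 * t = e / 4 * t + e / 4 * t by field.
  have : s%:R * (ep * t * C1) + s%:R * (`|lam| * (ep * (W + 2 * K) * t)) <= ep * C * t.
    have -> : ep * C * t = s%:R * (ep * t * C1) +
       s%:R * (`|lam| * (ep * (W + 2 * K) * t)) + ep * t by rewrite /C; ring.
    by rewrite lerDl mulr_ge0// ltW.
  by move: N1 N2 N3 N4; lra.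
exists (row_mx (t^-1 *: dx) (t^-1 *: (xs' - lam *m (B y)^T))).
  rewrite opp_row_mx add_row_mx (le_trans (norm_row_mx _ _))//.
  have scal (V : normedModType R) (x1 x2 : V) (k : R) :
      `|x1 - t *: x2| <= k * t -> `|t^-1 *: x1 - x2| <= k.
    have -> : t^-1 *: x1 - x2 = t^-1 *: (x1 - t *: x2).
      by rewrite scalerBr scalerA mulVf ?gt_eqF// scale1r.
    by rewrite normrZ gtr0_norm ?invr_gt0// ler_pdivrMl// mulrC.
  rewrite [leRHS](splitr e) lerD//; last exact: scal.
  exact: le_trans (scal _ _ _ _ dx_le) epe.
exists (px', xs').
  have [Dpx Gmu] := (normal_halfspaces _ _ _ _).1 Nmu.
  have := multiplier_normal_map gJL (z := diag_xx px') Dpx Gmu.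
  by rewrite /normal_map row_mxKl row_mxKr.
rewrite /= scale_row_mx !scalerA mulfV ?gt_eqF// !scale1r add_row_mx.
by congr row_mx; rewrite addrC subrK.
Unshelve. all: end_near. Qed.

End Subregular.

(** * The graphical derivatives of Psi and Gmap *)

Section Reformulation.
Context {R : realType} {l n s p : nat}.
Variable g : 'rV[R]_(l + n + n) -> 'rV[R]_s.
Variables (a : 'I_p -> 'rV[R]_s) (c : 'I_p -> R).
Let D := halfspaces a c.
Variables (px qu : 'rV[R]_(l + n)) (xs : 'rV[R]_n).
Hypothesis hg : C2 g.
Let y := diag_xx px.

Lemma mul_trmx_dsubmx (lam : 'rV[R]_s) (A : 'M[R]_(l + n + n, s)) :
  lam *m (dsubmx A)^T = rsubmx (lam *m A^T).
Proof.
by rewrite -{2}(vsubmxK A) tr_col_mx mul_mx_row row_mxKr.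
Qed.

(** The conditions on [mu] in [Xi] only depend on its image under the adjoint of
    the Jacobian of [g], so they are inherited by [lam], and [mu] may be taken
    equal to [lam]. *)
Lemma Lambda_tildeP lam : Lambda_tilde g D px xs qu lam <->
  derivative_multiplier g (jacobian g) ('d (jacobian g) y) a c y xs (diag_xx qu) lam.
Proof.
have td := C2_twice_diff y hg.
rewrite /Lambda_tilde /Xi /Lambda_dir /Lambda.
split.
  move=> [mu [Nmu muxs [Td mud]] [[Nlam lamJ] lammax]].
  move: muxs Td mud; rewrite /= (bTE td) (mul_jacobian_gtilde td) => muxs Td mud.
  split => //.
  - by rewrite mul_trmx_dsubmx lamJ -mul_trmx_dsubmx.
  - split=> //=; rewrite -(trmxK (jacobian g y)) -dot_mulmx lamJ dot_mulmx trmxK.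
    exact: mud.
  - move=> lam' Nlam' lamJ'; have H := lammax lam' (conj Nlam' (etrans lamJ' lamJ)).
    by rewrite !(curvatureE _ _ _ hg) in H.
move=> [Nlam lamxs Kd lammax]; exists lam.
  by split=> //; rewrite ?(bTE td)// (mul_jacobian_gtilde td).
split; first by split.
move=> lam' [Nlam' lamJ']; rewrite !(curvatureE _ _ _ hg).
exact: (lammax lam' Nlam' lamJ').
Qed.

Lemma second_order_eltE lam eta : second_order_elt g px qu lam eta =
  lam *m (dsubmx ('d (jacobian g) y (diag_xx qu)))^T +
  eta *m (dsubmx (jacobian g y))^T.
Proof.
have td := C2_twice_diff y hg.
rewrite /second_order_elt (bTE td) (mul_jacobian_bT td)// => px'.
exact: bTE (C2_twice_diff _ hg).
Qed.

Lemma critical_normalE lam : critical_normal g D px qu lam =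
  normal_cone (critical_cone D (g y) lam) (diag_xx qu *m jacobian g y).
Proof. by rewrite /critical_normal (mul_jacobian_gtilde (C2_twice_diff y hg)). Qed.

Lemma Gmap_derivative_sub v : graphical_derivative (Gmap g D) px xs qu v ->
  graphical_derivative (Psi g D) y xs (diag_xx qu) v.
Proof.
have PsiG px' : Psi g D (diag_xx px') = Gmap g D px'.
  by rewrite /Psi /Gmap /diag_xx row_mxKl row_mxKr.
pose f (w : 'rV[R]_(l + n + n)) : 'rV[R]_(l + n + n + n) :=
  row_mx (diag_xx (lsubmx w)) (rsubmx w).
have gphf w : gph (Gmap g D) w -> gph (Psi g D) (f w).
  move=> [[px' x'] /= Gx <-]; exists (diag_xx px', x') => /=.
    by rewrite PsiG.
  by rewrite /f row_mxKl row_mxKr.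
have fD w w' : f (w + w') = f w + f w'.
  by rewrite /f [lsubmx _]linearD [rsubmx _]linearD diag_xxD [RHS]add_row_mx.
have fZ k w : f (k *: w) = k *: f w.
  by rewrite /f [lsubmx _]linearZ [rsubmx _]linearZ diag_xxZ [RHS]scale_row_mx.
have fK w : `|f w| <= 3 * `|w|.
  rewrite (le_trans (norm_row_mx _ _))//.
  have := norm_rsubmx w; have := norm_lsubmx w.
  by have := norm_diag_xx (lsubmx w); lra.
have fE x1 x2 : f (row_mx x1 x2) = row_mx (diag_xx x1) x2.
  by rewrite /f row_mxKl row_mxKr.
move=> [/gphf Gx [w [t [wl t0 tl gw]]]]; rewrite /graphical_derivative /= -!fE.
split=> //; exists (f \o w), t; split=> //.
  exact: (cvg_comp _ _ wl (@linear_bound_cvg _ _ _ f 3 (row_mx qu v) fD fZ fK)).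
by move=> k; rewrite /= -fZ -fD; exact: gphf.
Qed.

End Reformulation.

Theorem theorem4p2 (R : realType) (l n s : nat)
    (g : 'rV[R]_(l + n + n) -> 'rV[R]_s) (D : set 'rV[R]_s)
    (f : 'rV[R]_(l + n) -> 'rV[R]_n) (pb : 'rV[R]_l) (xb : 'rV[R]_n)
    (hg : C2 g) (hD : convex_polyhedral D) (hf : C1 f)
    (hsol : [set f (row_mx pb xb) + y | y in Gmap g D (row_mx pb xb)] 0)
    (hreg : exists2 kappa : R, 0 < kappa &
       \forall y \near row_mx (row_mx pb xb) xb,
         (setdist (rsubmx y) (Gamma g D (lsubmx y)) <=
          kappa%:E * setdist (g y) D)%E) :
  \forall px \near row_mx pb xb,
    Gmap g D px !=set0 ->
    forall xs : 'rV[R]_n, Gmap g D px xs ->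
    (forall qu : 'rV[R]_(l + n),
       graphical_derivative (Gmap g D) px xs qu `<=`
         graphical_derivative (Psi g D) (diag_xx px) xs (diag_xx qu) /\
       graphical_derivative (Psi g D) (diag_xx px) xs (diag_xx qu) =
         \bigcup_(lam in Lambda_tilde g D px xs qu)
           [set second_order_elt g px qu lam eta |
              eta in critical_normal g D px qu lam]) /\
    (forall (qu : 'rV[R]_(l + n)) (lam eta : 'rV[R]_s),
       Lambda_tilde g D px xs qu lam ->
       critical_normal g D px qu lam eta ->
       dir_subregular (Fmap g D) (row_mx qu eta) (row_mx px lam) 0 ->
       graphical_derivative (Gmap g D) px xs qu
         (second_order_elt g px qu lam eta) /\
       derivable_tangent (gph (Gmap g D)) (row_mx px xs)
         (row_mx qu (second_order_elt g px qu lam eta))).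
Proof.
have [p [a [c DE]]] := convex_polyhedralP hD.
rewrite DE in hreg hsol *.
have [kappa kappa0 /nbhs_norm[r r0 rP]] := hreg.
have r4 : 0 < r / 4 by rewrite divr_gt0.
have r2 : 0 < r / 2 by rewrite divr_gt0.
apply: filterS (nbhsx_ballx (row_mx pb xb : 'rV[R]_(l + n)) _ r4) => px.
rewrite -ball_normE /= => pxr _ xs Gxs.
have regy z : `|z - diag_xx px| < r / 2 ->
    (setdist (rsubmx z) (feasible g a c (lsubmx z)) <=
     kappa%:E * setdist (g z) (halfspaces a c))%E.
  move=> zy; apply: rP.
  have -> : row_mx (row_mx pb xb) xb = diag_xx (row_mx pb xb).
    by rewrite /diag_xx row_mxKr.
  rewrite -(subrK (diag_xx px) z) -addrA.
  have -> : diag_xx px - diag_xx (row_mx pb xb) = - diag_xx (row_mx pb xb - px).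
    by rewrite diag_xxD -[- px]scaleN1r diag_xxZ scaleN1r opprB.
  rewrite (le_lt_trans (ler_normD _ _))// normrN.
  by have := norm_diag_xx (row_mx pb xb - px); lra.
have td := C2_twice_diff (diag_xx px) hg.
have Psixs : gph (Psi g (halfspaces a c)) (row_mx (diag_xx px) xs).
  exists (diag_xx px, xs) => //=.
  by rewrite /Psi /diag_xx row_mxKl row_mxKr.
split=> [qu|qu lam eta Llam Neta subreg].
  split; first by move=> v; exact: Gmap_derivative_sub.
  apply/seteqP; split=> [v Dv|v [lam Llam [eta Neta <-]]].
    have [lam lamP [eta etaP vE]] := normal_map_derivative td kappa0 r2 regy Dv.
    exists lam; first exact/(Lambda_tildeP _ _ _ _ _ hg).
    exists eta; first by rewrite (critical_normalE _ _ _ _ hg).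
    by rewrite (second_order_eltE _ _ hg).
  rewrite /graphical_derivative /= (second_order_eltE _ _ hg).
  apply: approached_tangent => //.
  apply: (normal_map_approached td kappa0 r2 regy).
    exact/(Lambda_tildeP _ _ _ _ _ hg).
  by rewrite -(critical_normalE _ _ _ _ hg).
have [Nlam lamxs Kd _] := (Lambda_tildeP _ _ _ _ _ hg _).1 Llam.
have gphxs : gph (Gmap g (halfspaces a c)) (row_mx px xs) by exists (px, xs).
rewrite (critical_normalE _ _ _ _ hg) in Neta.
have app := subregular_approached td Nlam Neta subreg.
rewrite lamxs -(second_order_eltE _ _ hg) in app.
by split; [exact: approached_tangent|exact: approached_derivable].
Qed.
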